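(* Let $\mathcal{F}$ be a countable class of measurable functions from $\mathcal{X}$ to $\mathbb{R}$. Let $X_1,\dots,X_n$ be independent $\mathcal{X}$-valued random variables such that $\mathbb{E}f(X_i)=0$ for all $f\in\mathcal{F}$ and $i=1,\dots,n$. Let $$Z=\sup_{f\in\mathcal{F}}\Bigl|\sum_{i=1}^nf(X_i)\Bigr| .$$ Then for all real $q\ge2$, $$\|(Z-\mathbb{E}[Z])_+\|_q\le\sqrt{2\kappa q}\,(\Sigma+\sigma)+2\kappa q\Bigl(\|M\|_q+\sup_{1\le i\le n,\,f\in\mathcal{F}}\|f(X_i)\|_2\Bigr),$$ and furthermore $$\|Z\|_q\le2\,\mathbb{E}[Z]+2\sigma\sqrt{2\kappa q}+20\kappa q\,\|M\|_q+4\sqrt{\kappa q}\,\|M\|_2 .$$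
   Context: $\mathcal{X}$ is a measurable space. The quantities $\Sigma,\sigma\ge0$ and the random variable $M$ are defined by $$\Sigma^2=\mathbb{E}\Bigl[\sup_{f\in\mathcal{F}}\sum_{i=1}^nf^2(X_i)\Bigr],\qquad \sigma^2=\sup_{f\in\mathcal{F}}\mathbb{E}\Bigl[\sum_{i=1}^nf^2(X_i)\Bigr],\qquad M=\sup_{1\le i\le n,\,f\in\mathcal{F}}|f(X_i)| .$$ $x_+=\max(x,0)$, $\|Y\|_q=(\mathbb{E}|Y|^q)^{1/q}$, $\kappa=\frac{\sqrt e}{2(\sqrt e-1)}<1.271$. Each inequality is understood as trivially true when its right-hand side is infinite. *)

(* Defs.v *)
From HB Require Import structures.
From mathcomp Require Import all_boot all_order all_algebra.
From mathcomp Require Import all_classical all_reals all_analysis.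

Set Implicit Arguments.
Unset Strict Implicit.
Unset Printing Implicit Defensive.

Import Order.TTheory GRing.Theory Num.Theory.
Import numFieldNormedType.Exports.

Local Open Scope classical_set_scope.
Local Open Scope ring_scope.
Local Open Scope ereal_scope.

Definition mutually_independent d dS (T : measurableType d)
    (S : measurableType dS) (R : realType) (P : probability T R)
    (I : finType) (X : I -> {RV P >-> S}) : Prop :=
  forall (J : {set I}) (B : I -> set S),
    (forall i, i \in J -> measurable (B i)) ->
    P (\bigcap_(i in [set` J]) (X i @^-1` B i)) =
      \prod_(i in J) P (X i @^-1` B i).

(* Supremum computed in [0, +oo], for families of nonnegative quantities: the
   supremum over an empty index set is 0, whereas [ereal_sup set0] is -oo. *)
Definition nneg_sup (R : realType) (I : Type) (A : set I) (g : I -> \bar R) :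
    \bar R :=
  ereal_sup (0 |` (g @` A)).

Definition kappa (R : realType) : R :=
  (Num.sqrt (expR 1) / (2 * (Num.sqrt (expR 1) - 1)))%R.

Section empirical_process.
Context d dS (T : measurableType d) (S : measurableType dS) (R : realType).
Variables (P : probability T R) (n : nat).
Variables (X : 'I_n -> {RV P >-> S}) (F : set (S -> R)).

Definition supZ (t : T) : \bar R :=
  nneg_sup F (fun f => `| \sum_(i < n) f (X i t) |%:E).

Definition supM (t : T) : \bar R :=
  nneg_sup ([set: 'I_n] `*` F) (fun p => `| p.2 (X p.1 t) |%:E).

Definition strong_sd : \bar R :=
  sqrte (\int[P]_t nneg_sup F (fun f => (\sum_(i < n) f (X i t) ^+ 2)%R%:E)).

Definition weak_sd : \bar R :=
  sqrte (nneg_sup F (fun f => 'E_P[(fun t => \sum_(i < n) f (X i t) ^+ 2)%R])).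

Definition sup_norm2 : \bar R :=
  nneg_sup ([set: 'I_n] `*` F) (fun p => 'N[P]_2%:E[EFin \o (p.2 \o X p.1)]).

End empirical_process.

(* Main.v *)
Require Import Defs.
From HB Require Import structures.
From mathcomp Require Import all_boot all_order all_algebra.
From mathcomp Require Import all_classical all_reals all_analysis.
From mathcomp Require Import measurable_realfun.
From mathcomp Require Import ring lra.

Set Implicit Arguments.
Unset Strict Implicit.
Unset Printing Implicit Defensive.

Import Order.TTheory GRing.Theory Num.Theory.
Import numFieldNormedType.Exports.

Local Open Scope classical_set_scope.
Local Open Scope ring_scope.

(** Everything rests on one moment inequality for a nonnegative function [Z] of
    independent variables ([moment_bound]). Let [V_+] be the sum over [i] of the
    mean of [(Z - Z_i) ^ 2] on [Z > Z_i], where [Z_i] is [Z] after resampling the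
    i-th variable and the mean is over the new value only. If [V_+ <= D ^ 2] then
    the L^q norm of [(Z - E Z)_+] is at most [sqrt (2 kappa q)] times that of [D].

    The reason is an entropy method for powers. For [W > 0] the functional
    [E (W ^ q) - (E (W ^ (q - 1))) ^ (q / (q - 1))] is at most the sum of its
    conditional versions, one for each variable ([entropy_subadditive]); this
    comes from Young's inequality and the scalar inequality [powR_cross]. In one
    variable it is bounded by a covariance, so that
    [E (W ^ q) <= (E (W ^ (q - 1))) ^ (q / (q - 1)) + q E (W ^ (q - 2) V_+)]
    ([moment_recursion]). Hoelder's inequality makes this a recursion from [q - 1]
    to [q] for [W = (Z - E Z)_+], and [kappa] is the constant for which it closes.

    For [Z = sup |sum_i f(X_i)|], resampling [X_i] lowers [Z] by at most
    [|f(X_i) - f(X_i')|] with [f] attaining the supremum, so that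
    [V_+ <= sigma ^ 2 + S ^ 2] with [S ^ 2 = sup_f sum_i f(X_i) ^ 2]. The mean of
    [S] is at most [Sigma], and its fluctuations obey the same moment inequality,
    now with [V_+ <= M ^ 2 + sup_(i, f) E f(X_i) ^ 2]. This is the first claim
    ([discrete_upper_tail]).

    For the second claim [Sigma] is removed: with [m] the L^q norm of [M],
    [Sigma ^ 2 <= sigma ^ 2 + 16 m E Z + 4/3 m ^ 2] ([strong_variance_le]). The
    squares are truncated at the level [2 m]; below it symmetrization and
    contraction compare them with [Z], above it they are summable because with
    probability at least 3/4 no variable exceeds the level. The first claim
    and the inequality between arithmetic and geometric means finish the proof
    ([discrete_moment]).

    All of this takes place on finite product spaces, where means are finite sums.
    A finite class on a general space is reduced to that case by rounding its
    values: the rounded variables are independent with finitely many values, they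
    are centered up to an error that tends to 0, and Fatou's lemma gives the limit
    ([class_upper_tail], [class_moment]). Finite subclasses then increase to the
    countable class ([Lnorm_sup_approx]). *)


(** * Inequalities for real powers *)

Section powR_inequalities.
Context {R : realType}.
Implicit Types q r s t u w x y : R.

(** Young's inequality with second factor 1. *)
Lemma powR_ge1Dx x r : 0 <= x -> 1 <= r -> 1 + r * (x - 1) <= x `^ r.
Proof.
move=> x0; rewrite le_eqVlt => /predU1P[<-|r1]; first by rewrite powRr1//; lra.
have r0 : 0 < r by lra.
have := @conjugate_powR R x 1 r (r / (r - 1)) x0 ler01 r0 _ _.
rewrite powR1 mulr1 invf_div mul1r => H.
have {}H : x <= x `^ r / r + (r - 1) / r.
  by apply: H; [rewrite divr_gt0// subr_gt0|field; lra].
have -> : 1 + r * (x - 1) = r * (x - (r - 1) / r) by field; lra.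
rewrite -ler_pdivlMl//; lra.
Qed.

Lemma powR_ge_tangent x y r : 0 <= x -> 0 < y -> 1 <= r ->
  y `^ r + r * y `^ (r - 1) * (x - y) <= x `^ r.
Proof.
move=> x0 y0 r1.
have yE : y `^ r = y * y `^ (r - 1) by rewrite mulr_powRB1 ?ltW//; lra.
have := powR_ge1Dx (divr_ge0 x0 (ltW y0)) r1.
rewrite -(ler_pM2r (powR_gt0 r y0)) -powRM ?divr_ge0 ?(ltW y0)// divfK ?gt_eqF//.
apply: le_trans; rewrite yE le_eqVlt; apply/orP; left; apply/eqP.
by field; rewrite gt_eqF.
Qed.

Lemma powR_jensen2 t x y r : 0 <= t <= 1 -> 0 <= x -> 0 <= y -> 1 <= r ->
  (t * x + (1 - t) * y) `^ r <= t * x `^ r + (1 - t) * y `^ r.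
Proof.
move=> /andP[t0 t1] x0 y0 r1; set z := t * x + _.
have t1' : 0 <= 1 - t by lra.
have := addr_ge0 (mulr_ge0 t0 x0) (mulr_ge0 t1' y0).
rewrite -/z le_eqVlt => /predU1P[<-|z0].
  by rewrite powR0 ?addr_ge0 ?mulr_ge0 ?powR_ge0//; lra.
have := ler_wpM2l t0 (powR_ge_tangent x0 z0 r1).
have := ler_wpM2l t1' (powR_ge_tangent y0 z0 r1).
move=> /lerD /[apply]; rewrite [leRHS]addrC; apply: le_trans.
by rewrite le_eqVlt; apply/orP; left; apply/eqP; rewrite /z; ring.
Qed.

Lemma powR_young q u w : 1 < q -> 0 <= u -> 0 <= w ->
  q * (u * w `^ (q - 1)) <= u `^ q + (q - 1) * w `^ q.
Proof.
move=> q1 u0 w0; have q0 : 0 < q by lra.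
have := @conjugate_powR R u (w `^ (q - 1)) q (q / (q - 1)) u0 (powR_ge0 _ _) q0.
have qE : (q - 1) * (q / (q - 1)) = q by field; lra.
rewrite -powRrM qE invf_div.
move=> H; rewrite -ler_pdivlMl//.
have -> : q^-1 * (u `^ q + (q - 1) * w `^ q) =
  u `^ q / q + w `^ q * ((q - 1) / q) by field; lra.
by apply: H; [rewrite divr_gt0//; lra|field; lra].
Qed.

(** Convexity of the power at [y / x + (1 - 1 / x) = (x + y - 1) / x]. *)
Lemma powR_slope_ge1 x y s : 1 <= s -> 0 < x -> 0 <= y -> 1 <= x ->
  0 <= x + y - 1 -> (x + y - 1) `^ s <= x `^ (s - 1) * (y `^ s + x - 1).
Proof.
move=> s1 x0 y0 x1 u0.
have t01 : 0 <= x^-1 <= 1 by rewrite invr_ge0 ltW//= invf_le1.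
have := powR_jensen2 t01 y0 ler01 s1; rewrite powR1 !mulr1 => H.
have -> : x + y - 1 = x * (x^-1 * y + (1 - x^-1)) by field; rewrite gt_eqF.
rewrite powRM ?(ltW x0)//; last by rewrite addr_ge0 ?mulr_ge0 ?invr_ge0 ?(ltW x0) ?subr_ge0//; case/andP: t01.
rewrite -(@mulr_powRB1 _ x s) ?(ltW x0)//; last by lra.
rewrite [leLHS]mulrAC [x * _]mulrC -mulrA [leLHS]mulrC -mulrA.
rewrite [leLHS]mulrC -mulrA ler_wpM2l ?powR_ge0//.
apply: (le_trans (ler_wpM2r (ltW x0) H)).
by rewrite le_eqVlt; apply/orP; left; apply/eqP; field; rewrite gt_eqF.
Qed.

(** Convexity of the power at [x * ((x + y - 1) / x) + (1 - x) = y]. *)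
Lemma powR_slope_le1 x y s : 1 <= s -> 0 < x -> 0 <= y -> x <= 1 ->
  0 <= x + y - 1 -> x `^ (s - 1) * (y `^ s + x - 1) <= (x + y - 1) `^ s.
Proof.
move=> s1 x0 y0 x1 u0.
have t01 : 0 <= x <= 1 by rewrite ltW.
have := powR_jensen2 t01 (divr_ge0 u0 (ltW x0)) ler01 s1.
have -> : x * ((x + y - 1) / x) + (1 - x) * 1 = y by field; rewrite gt_eqF.
rewrite powR1 !mulr1 => H.
have {}H : y `^ s + x - 1 <= x * ((x + y - 1) / x) `^ s by lra.
apply: (le_trans (ler_wpM2l (powR_ge0 _ _) H)).
rewrite mulrA [_ * x]mulrC mulr_powRB1 ?(ltW x0)//; last by lra.
by rewrite -powRM ?divr_ge0 ?(ltW x0)// mulrCA divff ?gt_eqF// mulr1.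
Qed.


Let crossD (s y t : R) : R := (s + 1) / s * (t `^ s - 1) * (y `^ s - 1)
  - (t + y - 1) `^ (s + 1) - 1 + t `^ (s + 1) + y `^ (s + 1).

Let dcrossD (s y t : R) : R :=
  (s + 1) * (t `^ (s - 1) * (y `^ s + t - 1) - (t + y - 1) `^ s).

Let is_derive_crossD s y t : 1 <= s -> 0 < t -> 0 < t + y - 1 ->
  is_derive t 1 (crossD s y) (dcrossD s y t).
Proof.
move=> s1 t0 u0.
have d1 := is_derive1_powR s t0.
have d2 := is_derive1_powR (s + 1) t0.
have d3 : is_derive t 1 (fun t => (t + y - 1) `^ (s + 1))
    ((s + 1) * (t + y - 1) `^ s).
  have d4 := is_derive1_powR (s + 1) u0.
  have d5 : is_derive t 1 (fun t => t + y - 1) 1.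
    by apply: is_derive_eq; rewrite addr0 subr0.
  have := @is_derive1_comp _ (@powR R ^~ (s + 1)) (fun t => t + y - 1) t _ _ d4 d5.
  by rewrite addrK mulr1.
apply: is_derive_eq.
rewrite /dcrossD.
rewrite addrK -(@mulr_powRB1 _ t s) ?(ltW t0)//; last by lra.
rewrite /GRing.scale/=; field; lra.
Qed.

Let crossD1 s y : crossD s y 1 = 0.
Proof. by rewrite /crossD !powR1 [1 + y]addrC addrK; ring. Qed.

Let crossD_mvt s y a b : 1 <= s -> 0 < a -> 0 < a + y - 1 -> a <= b ->
  exists2 c, c \in `[a, b] & crossD s y b - crossD s y a = dcrossD s y c * (b - a).
Proof.
move=> s1 a0 u0 ab.
have H t : a <= t -> is_derive t 1 (crossD s y) (dcrossD s y t).
  by move=> xt; apply: is_derive_crossD => //; lra.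
apply: MVT_segment => //.
  by move=> t /[!in_itv]/= /andP[/ltW/H].
apply: derivable_within_continuous => t /[!in_itv]/= /andP[/H h _].
exact: ex_derive.
Qed.

Let crossD_ge0 s x y : 1 <= s -> 0 < x -> 0 < y -> 0 < x + y - 1 ->
  0 <= crossD s y x.
Proof.
move=> s1 x0 y0 u0; have [x1|/ltW x1] := leP x 1.
- have [c /[!in_itv]/= /andP[xc c1]] := @crossD_mvt s y x 1 s1 x0 u0 x1.
  rewrite crossD1 sub0r => /eqP; rewrite eqr_oppLR => /eqP ->.
  rewrite -mulNr mulr_ge0 ?subr_ge0//.
  rewrite /dcrossD -mulrN mulr_ge0//; first by lra.
  by rewrite oppr_ge0 subr_le0; apply: powR_slope_le1 => //; lra.
- have y0' : 0 < 1 + y - 1 by lra.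
  have [c /[!in_itv]/= /andP[c1 cx]] := @crossD_mvt s y 1 x s1 ltr01 y0' x1.
  rewrite crossD1 subr0 => ->; rewrite mulr_ge0 ?subr_ge0//.
  rewrite /dcrossD mulr_ge0//; first by lra.
  by rewrite subr_ge0; apply: powR_slope_ge1 => //; lra.
Qed.

Let crossD_ge0_boundary s y : 1 <= s -> 0 < y -> y < 1 -> 0 <= crossD s y (1 - y).
Proof.
move=> s1 y0 y1; set x := 1 - y.
have x0 : 0 < x by rewrite /x; lra.
pose f t := (s + 1) / s * (t `^ s - 1) * (y `^ s - 1) - 1 + t `^ (s + 1) + y `^ (s + 1).
have fE : crossD s y x = f x.
  by rewrite /crossD /f /x subrK subrr powR0 ?subr0//; lra.
have fp t : x < t -> 0 <= f t.
  move=> xt; apply: (@le_trans _ _ (crossD s y t)).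
    by apply: crossD_ge0 => //; move: xt; rewrite /x; lra.
  rewrite /crossD /f; have := powR_ge0 (t + y - 1) (s + 1); lra.
have cf : {for x, continuous f}.
  apply/differentiable_continuous; rewrite -derivable1_diffP.
  have d1 := is_derive1_powR s x0.
  have d2 := is_derive1_powR (s + 1) x0.
  rewrite /f; apply: ex_derive.
rewrite fE leNgt; apply/negP => fx0.
have : \forall t \near x^'+, f t < 0.
  have : f t @[t --> x^'+] --> f x by apply: cvg_at_right_filter.
  by move=> /cvgr_lt; apply.
move=> /(filterI (nbhs_right_gt x)) /filter_ex[t [xt]].
by rewrite ltNge fp.
Qed.

(** The scalar core of the subadditivity of the power entropy. As a function
    of [x] the difference of the two sides vanishes at [x = 1], and the sign
    of its derivative is that of [x `^ (s - 1) * (y `^ s + x - 1) - (x + y -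
    1) `^ s], which [powR_slope_ge1] and [powR_slope_le1] decide on either
    side of 1. On [x + y <= 1], where the maximum vanishes, Young's inequality
    compares [x] with [1 - y]. *)
Lemma powR_cross s x y : 1 <= s -> 0 < x -> 0 < y ->
  Num.max (x + y - 1) 0 `^ (s + 1) + 1 - x `^ (s + 1) - y `^ (s + 1) <=
  (s + 1) / s * (x `^ s - 1) * (y `^ s - 1).
Proof.
move=> s1 x0 y0; have [u0|u0] := ltP 0 (x + y - 1).
  by have := crossD_ge0 s1 x0 y0 u0; rewrite /crossD; lra.
rewrite powR0; last by lra.
have y1 : y < 1 by lra.
have := crossD_ge0_boundary s1 y0 y1; rewrite /crossD subrK subrr powR0; last by lra.
set x1 := 1 - y => Dx1.
have x10 : 0 < x1 by rewrite /x1; lra.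
have xx1 : x <= x1 by rewrite /x1; lra.
have s11 : 1 < s + 1 by lra.
have := powR_young s11 (ltW x10) (ltW x0); rewrite addrK => Y.
have ys : y `^ s <= y by apply: ge1r_powR; rewrite ?y0 ?(ltW y1).
have x1s : x `^ s <= x1 `^ s by apply: ge0_ler_powR; rewrite ?nnegrE ?(ltW x0) ?(ltW x10)//; lra.
have x1q : x1 `^ (s + 1) = x1 * x1 `^ s by rewrite -[in RHS](addrK 1 s) mulr_powRB1 ?(ltW x10)//; lra.
have A : (x1 `^ s - x `^ s) * x1 <= (x1 `^ s - x `^ s) * (1 - y `^ s).
  by rewrite ler_wpM2l ?subr_ge0// /x1; lra.
have B : x1 `^ (s + 1) - x `^ (s + 1) <= (s + 1) / s * ((x1 `^ s - x `^ s) * x1).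
  by rewrite mulrAC ler_pdivlMr; [rewrite x1q in Y *; lra|lra].
have k0 : 0 <= (s + 1) / s by rewrite divr_ge0//; lra.
have := ler_wpM2l k0 A; lra.
Qed.

End powR_inequalities.

(** * Weighted averages over a finite type *)

Section powR_order.
Context {R : realType}.
Implicit Types q r x y : R.

Lemma ler_powR_root q x y : 0 < q -> 0 <= x -> 0 <= y ->
  (x <= y `^ q) = (x `^ q^-1 <= y).
Proof.
move=> q0 x0 y0; have qV : 0 < q^-1 by rewrite invr_gt0.
apply/idP/idP => [|] h.
  have := @ge0_ler_powR _ _ (ltW qV) x (y `^ q) x0 (powR_ge0 _ _) h.
  by rewrite -powRrM divff ?gt_eqF// powRr1.
have := @ge0_ler_powR _ _ (ltW q0) (x `^ q^-1) y (powR_ge0 _ _) y0 h.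
by rewrite -powRrM mulVf ?gt_eqF// powRr1.
Qed.

Lemma ler_powR2 q x y : 0 < q -> 0 <= x -> 0 <= y ->
  (x `^ q <= y `^ q) = (x <= y).
Proof.
move=> q0 x0 y0; rewrite ler_powR_root ?powR_ge0//.
by rewrite -powRrM divff ?gt_eqF// powRr1.
Qed.

(** Lets a moment bound be proved under a strict positivity assumption on its
    right-hand side. *)
Lemma ler_powR_closure q x r : 0 < q -> 0 <= x -> 0 <= r ->
  (forall e, 0 < e -> x <= (r + e) `^ q) -> x <= r `^ q.
Proof.
move=> q0 x0 r0 H; rewrite ler_powR_root//; apply/ler_addgt0Pr => e e0.
by rewrite -ler_powR_root ?H// addr_ge0// ltW.
Qed.

End powR_order.

Definition wsum {R : realType} {T : finType} (w f : T -> R) := \sum_t w t * f t.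

Section wsum.
Context {R : realType} {T : finType} (w : T -> R).
Hypotheses (w_ge0 : forall t, 0 <= w t) (w_sum1 : \sum_t w t = 1).
Implicit Types (f g : T -> R) (c q r b : R).

Lemma ler_wsum f g : (forall t, f t <= g t) -> wsum w f <= wsum w g.
Proof. by move=> fg; apply: ler_sum => t _; rewrite ler_wpM2l. Qed.

Lemma wsum_ge0 f : (forall t, 0 <= f t) -> 0 <= wsum w f.
Proof. by move=> f0; apply: sumr_ge0 => t _; rewrite mulr_ge0. Qed.

Lemma wsumD f g : wsum w (fun t => f t + g t) = wsum w f + wsum w g.
Proof. by rewrite /wsum -big_split/=; apply: eq_bigr => t _; rewrite mulrDr. Qed.

Lemma wsumZ c f : wsum w (fun t => c * f t) = c * wsum w f.
Proof. by rewrite /wsum mulr_sumr; apply: eq_bigr => t _; rewrite mulrCA. Qed.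

Lemma wsumZr c f : wsum w (fun t => f t * c) = wsum w f * c.
Proof. by rewrite /wsum mulr_suml; apply: eq_bigr => t _; rewrite mulrA. Qed.

Lemma wsumN f : wsum w (fun t => - f t) = - wsum w f.
Proof. by rewrite /wsum -sumrN; apply: eq_bigr => t _; rewrite mulrN. Qed.

Lemma wsumB f g : wsum w (fun t => f t - g t) = wsum w f - wsum w g.
Proof. by rewrite wsumD wsumN. Qed.

Lemma wsum_cst c : wsum w (fun=> c) = c.
Proof. by rewrite /wsum -mulr_suml w_sum1 mul1r. Qed.

Lemma wsum_sum (J : Type) (l : seq J) (P : pred J) (F : J -> T -> R) :
  wsum w (fun t => \sum_(j <- l | P j) F j t) =
  \sum_(j <- l | P j) wsum w (F j).
Proof.
rewrite /wsum exchange_big/=; apply: eq_bigr => t _.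
by rewrite mulr_sumr.
Qed.

Lemma eq_wsum f g : f =1 g -> wsum w f = wsum w g.
Proof. by move=> fg; apply: eq_bigr => t _; rewrite fg. Qed.

Lemma wsum_gt0 f : (forall t, 0 < f t) -> 0 < wsum w f.
Proof.
move=> f0; rewrite lt_neqAle wsum_ge0 ?andbT; last by move=> t; exact/ltW.
apply/eqP => /esym /psumr_eq0P wf; have := w_sum1; rewrite big1.
  by move/eqP; rewrite eq_sym oner_eq0.
move=> t _; have /eqP := wf (fun t _ => mulr_ge0 (w_ge0 t) (ltW (f0 t))) t isT.
by rewrite mulf_eq0 (gt_eqF (f0 t)) orbF => /eqP.
Qed.

Lemma wsum_le_max f c : (forall t, f t <= c) -> wsum w f <= c.
Proof. by move=> fc; rewrite -[leRHS]wsum_cst; apply: ler_wsum. Qed.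

(** Averages the tangent inequality at the mean. *)
Lemma wsum_jensen f r : 1 <= r -> (forall t, 0 <= f t) ->
  wsum w f `^ r <= wsum w (fun t => f t `^ r).
Proof.
move=> r1 f0; have := wsum_ge0 f0.
rewrite le_eqVlt => /predU1P[<-|m0].
  by rewrite powR0 ?wsum_ge0// => [t|]; [exact: powR_ge0|rewrite gt_eqF//; lra].
set m := wsum w f in m0 *.
apply: (@le_trans _ _ (wsum w (fun t => m `^ r + r * m `^ (r - 1) * (f t - m)))).
  by rewrite wsumD wsumZ wsumB !wsum_cst subrr mulr0 addr0.
by apply: ler_wsum => t; apply: powR_ge_tangent.
Qed.

Lemma wsum_lyapunov f q r b : 0 < r -> r <= q -> 0 <= b -> (forall t, 0 <= f t) ->
  wsum w (fun t => f t `^ q) <= b `^ q -> wsum w (fun t => f t `^ r) <= b `^ r.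
Proof.
move=> r0 rq b0 f0 fb; have q0 : 0 < q by lra.
have qr : 1 <= q / r by rewrite ler_pdivlMr// mul1r.
rewrite -(@ler_powR2 _ (q / r)) ?powR_ge0//; last 2 first.
  by rewrite divr_gt0.
  by rewrite wsum_ge0// => t; exact: powR_ge0.
apply: (le_trans (wsum_jensen qr _)) => [t|]; first exact: powR_ge0.
have qrE : r * (q / r) = q by field; rewrite gt_eqF.
rewrite -powRrM qrE; apply: le_trans fb.
rewrite le_eqVlt; apply/orP; left; apply/eqP; apply: eq_wsum => t.
by rewrite -powRrM qrE.
Qed.

(** Minkowski's inequality when one summand is constant: after scaling by [c +
    b] it is convexity of the power at the weights [c / (c + b)] and [b / (c +
    b)]. *)
Lemma wsum_minkowski_cst f c q b : 1 <= q -> 0 <= c -> 0 <= b ->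
  (forall t, 0 <= f t) -> wsum w (fun t => f t `^ q) <= b `^ q ->
  wsum w (fun t => (c + f t) `^ q) <= (c + b) `^ q.
Proof.
move=> q1 c0 b0 f0 fb; have q0 : 0 < q by lra.
apply: ler_powR_closure => //; first by apply: wsum_ge0 => t; exact: powR_ge0.
  exact: addr_ge0.
move=> e e0; set B := b + e; have B0 : 0 < B by rewrite /B; lra.
have {}fb : wsum w (fun t => f t `^ q) <= B `^ q.
  by apply: (le_trans fb); rewrite ler_powR2// /B; lra.
rewrite -addrA -/B; set k := c / (c + B); have cB : 0 < c + B by lra.
have k01 : 0 <= k <= 1 by rewrite /k divr_ge0 ?(ltW cB)//= ler_pdivrMr// mul1r lerDl ltW.
apply: (@le_trans _ _ (wsum w (fun t => (c + B) `^ q *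
    (k + (1 - k) * ((B `^ q)^-1 * f t `^ q))))).
  apply: ler_wsum => t.
  have fE : c + f t = (c + B) * (k * 1 + (1 - k) * (f t / B)).
    by rewrite /k; field; rewrite !gt_eqF.
  have fB : 0 <= f t / B by rewrite divr_ge0 ?(ltW B0).
  rewrite fE powRM ?(ltW cB)//; last first.
    by case/andP: k01 => k0 k1; rewrite mulr1 addr_ge0// mulr_ge0// subr_ge0.
  rewrite ler_wpM2l ?powR_ge0//.
  apply: (le_trans (powR_jensen2 k01 ler01 fB q1)).
  rewrite powR1 mulr1 [f t / B]mulrC powRM ?invr_ge0 ?(ltW B0)//.
  by rewrite -powR_inv1 ?(ltW B0)// -powRrM mulN1r powRN.
rewrite wsumZ ler_piMr ?powR_ge0// wsumD wsum_cst !wsumZ -/k.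
have : (B `^ q)^-1 * wsum w (fun t => f t `^ q) <= 1.
  by rewrite mulrC ler_pdivrMr ?powR_gt0// mul1r.
case/andP: k01 => k0 k1; rewrite -subr_ge0 in k1.
by move=> /(ler_wpM2l k1); lra.
Qed.

End wsum.

(** * Finite product probability spaces *)

Section product_expectation.
Context {R : realType} {I A : finType} (p : I -> A -> R).
Hypotheses (p_ge0 : forall i a, 0 <= p i a) (p_sum1 : forall i, \sum_a p i a = 1).
Notation X := {ffun I -> A}.
Implicit Types (f g : X -> R) (x : X) (i j : I).

Definition upd x i (a : A) : X := [ffun k => if k == i then a else x k].
Definition pwt x : R := \prod_i p i (x i).
Definition pmean f : R := wsum pwt f.
(** The conditional expectation given all coordinates but [i]. *)
Definition cmean i f x : R := wsum (p i) (fun a => f (upd x i a)).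
Definition indep_of i f := forall x a, f (upd x i a) = f x.

Lemma pwt_ge0 x : 0 <= pwt x.
Proof. exact: prodr_ge0. Qed.

Lemma pwt_sum1 : \sum_x pwt x = 1.
Proof.
rewrite /pwt -(bigA_distr_bigA (fun i a => p i a)) big1//.
Qed.

Lemma upd_same x i a : upd x i a i = a.
Proof. by rewrite ffunE eqxx. Qed.

Lemma upd_other x i a k : k != i -> upd x i a k = x k.
Proof. by rewrite ffunE => /negbTE ->. Qed.

Lemma updxx x i : upd x i (x i) = x.
Proof. by apply/ffunP => k; rewrite ffunE; case: eqVneq => [->|]. Qed.

Lemma upd_upd x i a b : upd (upd x i a) i b = upd x i b.
Proof. by apply/ffunP => k; rewrite !ffunE; case: (k == i). Qed.

Lemma upd_comm x i j a b : i != j ->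
  upd (upd x i a) j b = upd (upd x j b) i a.
Proof.
move=> ij; apply/ffunP => k; rewrite !ffunE.
have [->|//] := eqVneq k j.
by rewrite eq_sym (negbTE ij).
Qed.

Lemma cmean_indep i f : indep_of i (cmean i f).
Proof. by move=> x a; apply: eq_wsum => b; rewrite upd_upd. Qed.

Lemma cmean_indepM i f g : indep_of i f ->
  cmean i (fun x => f x * g x) =1 (fun x => f x * cmean i g x).
Proof.
by move=> fi x; rewrite -wsumZ; apply: eq_wsum => a; rewrite fi.
Qed.

Lemma cmean_id i f : indep_of i f -> cmean i f =1 f.
Proof.
move=> fi x; transitivity (wsum (p i) (fun=> f x)).
  by apply: eq_wsum => a; rewrite fi.
by rewrite wsum_cst.
Qed.

Lemma cmean_comm i j f : i != j -> cmean i (cmean j f) =1 cmean j (cmean i f).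
Proof.
move=> ij x; rewrite /cmean /wsum.
under eq_bigr do rewrite mulr_sumr.
rewrite exchange_big/=; apply: eq_bigr => b _; rewrite mulr_sumr.
by apply: eq_bigr => a _; rewrite upd_comm// mulrCA.
Qed.

Lemma cmean_indep_other i j f : indep_of j f -> i != j -> indep_of j (cmean i f).
Proof.
by move=> fj ij x a; apply: eq_wsum => b; rewrite upd_comm 1?eq_sym// fj.
Qed.

(** The map that exchanges [x i] with the resampled value is an involution of
    pairs that preserves the product weight. *)
Lemma pmean_cmean i f : pmean (cmean i f) = pmean f.
Proof.
have wE x a : pwt (upd x i a) * p i (x i) = pwt x * p i a.
  rewrite /pwt (bigD1 i)//= [in RHS](bigD1 i)//= upd_same.
  rewrite (eq_bigr (fun k => p k (x k))) => [|k ki]; first by ring.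
  by rewrite upd_other.
have -> : pmean f = \sum_(z : X * A) pwt z.1 * p i z.2 * f z.1.
  rewrite -(pair_bigA _ (fun x a => pwt x * p i a * f x))/=.
  apply: eq_bigr => x _; under eq_bigr do rewrite mulrAC.
  by rewrite -mulr_sumr p_sum1 mulr1.
rewrite (reindex_inj (h := fun z : X * A => (upd z.1 i z.2, z.1 i)))/=; last first.
  apply: (can_inj (g := fun z : X * A => (upd z.1 i z.2, z.1 i))) => -[x a]/=.
  by rewrite upd_upd upd_same updxx.
rewrite -(pair_bigA _ (fun x a => pwt (upd x i a) * p i (x i) * f (upd x i a)))/=.
apply: eq_bigr => x _; rewrite mulr_sumr; apply: eq_bigr => a _.
by rewrite wE mulrA.
Qed.

Lemma pmean_fst i (h : A -> R) : pmean (fun x => h (x i)) = wsum (p i) h.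
Proof.
rewrite -(pmean_cmean i) -[RHS](wsum_cst pwt_sum1).
by apply: eq_wsum => x; apply: eq_wsum => a; rewrite upd_same.
Qed.

Lemma indep_all_cst f : (forall i, indep_of i f) -> forall x, f x = pmean f.
Proof.
move=> fi x; rewrite -[LHS](wsum_cst pwt_sum1); apply: eq_wsum => y.
pose z (l : seq I) := [ffun k => if k \in l then y k else x k] : X.
have zE l : f (z l) = f x.
  elim: l => [|i l IH]; first by congr f; apply/ffunP => k; rewrite ffunE.
  rewrite -IH -[RHS](fi i _ (y i)); congr f; apply/ffunP => k.
  by rewrite !ffunE inE; have [->|] := eqVneq k i.
rewrite -(zE (enum I)); congr f; apply/ffunP => k.
by rewrite ffunE mem_enum.
Qed.

End product_expectation.

(** * Subadditivity of the power entropy *)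

Section one_variable.
Context {R : realType}.

Lemma le_eq_sub (a b c d : R) : b <= a -> a - b = c - d -> d <= c.
Proof. by rewrite -subr_ge0 -(subr_ge0 d) => + <-. Qed.

(** The homogeneous form of [powR_cross], at [x / z] and [y / z]. *)
Lemma powR_cross_scaled (s x y z : R) : 1 <= s -> 0 < x -> 0 < y -> 0 < z ->
  Num.max (x + y - z) 0 `^ (s + 1) + z `^ (s + 1) - x `^ (s + 1) - y `^ (s + 1) <=
  (s + 1) / s * z `^ (1 - s) * ((x `^ s - z `^ s) * (y `^ s - z `^ s)).
Proof.
move=> s1 x0 y0 z0; have z0' := ltW z0.
have xz : 0 < x / z by rewrite divr_gt0.
have yz : 0 < y / z by rewrite divr_gt0.
have := powR_cross s1 xz yz; rewrite -(ler_pM2l (powR_gt0 (s + 1) z0)).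
have sc r t : 0 < t -> (t / z) `^ r = t `^ r / z `^ r.
  move=> t0; rewrite powRM ?invr_ge0 ?(ltW t0)// -powR_inv1// -powRrM mulN1r.
  by rewrite powRN.
have -> : x / z + y / z - 1 = z^-1 * (x + y - z) by field; rewrite gt_eqF.
rewrite -[X in Num.max _ X](mulr0 z^-1) -maxr_pMr ?invr_ge0//.
rewrite !sc//; set M := Num.max _ _.
have M0 : 0 <= M by rewrite /M le_max lexx orbT.
rewrite powRM ?invr_ge0// -[z^-1]powR_inv1// -powRrM mulN1r powRN.
have -> : z `^ (s + 1) = z `^ s * z by rewrite powRD ?powRr1// (gt_eqF z0) implybT.
have -> : z `^ (1 - s) = z / z `^ s by rewrite powRB ?powRr1// (gt_eqF z0) implybT.
have zs := powR_gt0 s z0.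
move=> /le_eq_sub; apply; field; rewrite !gt_eqF//=; lra.
Qed.

Lemma powR_slope_sym (q u v : R) : 2 <= q -> 0 < u -> 0 < v ->
  (u `^ (q - 1) - v `^ (q - 1)) * (u - v) <=
  (q - 1) * (u `^ (q - 2) * Num.max (u - v) 0 ^+ 2 +
             v `^ (q - 2) * Num.max (v - u) 0 ^+ 2).
Proof.
move=> q2; wlog uv : u v / v <= u.
  move=> H u0 v0; have [vu|/ltW uv] := leP v u; first exact: H.
  by have := H v u uv v0 u0; lra.
move=> u0 v0; rewrite max_l ?subr_ge0// max_r ?subr_le0// expr0n/= mulr0 addr0.
have s1 : 1 <= q - 1 by lra.
have := powR_ge_tangent (ltW v0) u0 s1.
have -> : q - 1 - 1 = q - 2 by ring.
rewrite -subr_ge0 in uv => T.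
have {}T : u `^ (q - 1) - v `^ (q - 1) <= (q - 1) * u `^ (q - 2) * (u - v) by lra.
by rewrite expr2 !mulrA ler_wpM2r.
Qed.

(** For [g := W `^ (q - 1)] and [phi t := t `^ (q / (q - 1))] the tangent of
    [phi] at each value of [g] bounds the left-hand side by the covariance of
    [g] and [phi' g], that is of [W `^ (q - 1)] and a multiple of [W]; a
    covariance is an average over two independent copies, where
    [powR_slope_sym] applies. *)
Lemma wsum_entropy_le (T : finType) (w W : T -> R) (q : R) : 2 <= q ->
  (forall t, 0 <= w t) -> \sum_t w t = 1 -> (forall t, 0 < W t) ->
  wsum w (fun b => W b `^ q) -
    wsum w (fun b => W b `^ (q - 1)) `^ (q / (q - 1)) <=
  q * wsum w (fun b => W b `^ (q - 2) *
                       wsum w (fun c => Num.max (W b - W c) 0 ^+ 2)).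
Proof.
move=> q2 w0 w1 W0; set s := q - 1; have s0 : 0 < s by rewrite /s; lra.
have q1 : 1 < q by lra.
set G := wsum w (fun b => W b `^ s); have G0 : 0 <= G.
  by apply: wsum_ge0 => // t; exact: powR_ge0.
have YG : (G `^ s^-1) `^ (q - 1) = G.
  by rewrite -powRrM mulVf ?powRr1// gt_eqF.
have Yq : (G `^ s^-1) `^ q = G `^ (q / s) by rewrite -powRrM mulrC.
(* Young's inequality in place of the tangent inequality. *)
have young b : q * W b * G - W b `^ q <= s * G `^ (q / s).
  have := powR_young q1 (ltW (W0 b)) (powR_ge0 G s^-1).
  by rewrite YG Yq -/s; lra.
have {young} : q * (wsum w W * G) - wsum w (fun b => W b `^ q) <= s * G `^ (q / s).
  apply: le_trans (wsum_le_max w0 w1 young).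
  by rewrite wsumB wsumZr wsumZ mulrA.
have WE b : W b `^ q = W b * W b `^ s by rewrite mulr_powRB1 ?(ltW (W0 b))//; lra.
set V := wsum w (fun b => _ * _).
pose D b c := W b `^ s * (W b - W c).
have DE : wsum w (fun b => W b `^ q) - wsum w W * G = wsum w (fun b => wsum w (D b)).
  transitivity (wsum w (fun b => W b `^ q - W b `^ s * wsum w W)).
    by rewrite wsumB wsumZr mulrC.
  apply: eq_wsum => b; rewrite /D wsumZ wsumB wsum_cst//.
  by rewrite WE; ring.
have DC : wsum w (fun b => wsum w (D b)) = wsum w (fun b => wsum w (D ^~ b)).
  rewrite /wsum; under eq_bigr do rewrite mulr_sumr.
  rewrite exchange_big/=; apply: eq_bigr => b _; rewrite mulr_sumr.
  by apply: eq_bigr => c _; rewrite mulrCA.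
pose N b c := W b `^ (q - 2) * Num.max (W b - W c) 0 ^+ 2.
have VE : V = wsum w (fun b => wsum w (N b)).
  by apply: eq_wsum => b; rewrite -wsumZ.
have NC : wsum w (fun b => wsum w (N b)) = wsum w (fun b => wsum w (N ^~ b)).
  rewrite /wsum; under eq_bigr do rewrite mulr_sumr.
  rewrite exchange_big/=; apply: eq_bigr => b _; rewrite mulr_sumr.
  by apply: eq_bigr => c _; rewrite mulrCA.
have DN : wsum w (fun b => wsum w (fun c => D b c + D c b)) <=
          wsum w (fun b => wsum w (fun c => s * (N b c + N c b))).
  apply: ler_wsum => // b; apply: ler_wsum => // c.
  by have := powR_slope_sym q2 (W0 b) (W0 c); rewrite /D /N -/s; lra.
have {}DN : wsum w (fun b => wsum w (D b)) <= s * V.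
  move: DN; under eq_wsum do rewrite wsumD.
  under [leRHS]eq_wsum do rewrite wsumZ wsumD.
  by rewrite wsumD wsumZ wsumD -DC -NC -VE; lra.
move=> Y; rewrite -(ler_pM2l s0).
have := ler_wpM2l (ltW (lt_trans ltr01 q1)) DN; rewrite -DE.
by rewrite -/s -/G in Y *; rewrite /s in Y *; lra.
Qed.

End one_variable.

Section tensorization_arith.
Context {R : realType}.

(** Here [a], [b], [c] stand for the (q - 1)-th roots of two conditional means
    and of the iterated mean, [u] for the positive part of [a + b - c], and
    the letters ending in [q] for q-th powers. *)
Lemma tensorization_arith (q s K a b c u g aq bq cq uq wq C D1 D2 : R) :
  uq + cq - aq - bq <= K * C * (D1 * D2) -> q * (u * g) <= uq + s * wq ->
  q * ((a + b - c) * g) <= q * (u * g) ->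
  q * (a * g) + q * (b * g) - q * (c * g) - aq - bq + cq - K * (C * D1 * D2)
  <= s * wq.
Proof.
have -> : K * C * (D1 * D2) = K * (C * D1 * D2) by rewrite !mulrA.
have -> : q * ((a + b - c) * g) = q * (a * g) + q * (b * g) - q * (c * g) by ring.
move: (K * _) (q * (a * g)) (q * (b * g)) (q * (c * g)) (q * (u * g)) (s * wq).
by move=> *; lra.
Qed.

(** Averaging the pointwise inequality; the term [h] is the product of two
    fluctuations and has mean zero. *)
Lemma tensorization_wsum (T : finType) (w : T -> R) (s K : R)
    (f1 f2 f3 a1 a2 a3 h g : T -> R) : (forall t, 0 <= w t) ->
  (forall t, (s + 1) * f1 t + (s + 1) * f2 t - (s + 1) * f3 t - a1 t - a2 t
             + a3 t - K * h t <= s * g t) ->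
  wsum w f1 = wsum w a1 -> wsum w f2 = wsum w a2 -> wsum w f3 = wsum w a3 ->
  wsum w h = 0 -> s * (wsum w a2 - wsum w a3) <= s * (wsum w g - wsum w a1).
Proof.
move=> w0 H E1 E2 E3 E0; have := ler_wsum w0 H.
rewrite wsumB wsumD wsumB wsumB wsumB wsumD !wsumZ E1 E2 E3 E0.
move: (wsum w a1) (wsum w a2) (wsum w a3) (wsum w g) => A1 A2 A3 G H'.
by apply: le_eq_sub H' _; ring.
Qed.

End tensorization_arith.

Section tensorization.
Context {R : realType} {I A : finType} (p : I -> A -> R).
Hypotheses (p_ge0 : forall i a, 0 <= p i a) (p_sum1 : forall i, \sum_a p i a = 1).
Notation X := {ffun I -> A}.
Notation E := (pmean p).
Notation cmean := (cmean p).
Implicit Types (f g : X -> R) (x : X) (i j : I).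

Let w0 : forall x, 0 <= pwt p x. Proof. exact: pwt_ge0. Qed.
Let w1 : \sum_x pwt p x = 1. Proof. exact: pwt_sum1. Qed.

Lemma cmean_gt0 i g : (forall x, 0 < g x) -> forall x, 0 < cmean i g x.
Proof. by move=> g0 x; apply: wsum_gt0. Qed.

Lemma pmean_cmean_indepM i f g : indep_of i f ->
  E (fun x => f x * g x) = E (fun x => f x * cmean i g x).
Proof.
by move=> fi; rewrite -(pmean_cmean p_sum1 i); apply: eq_wsum => x; rewrite cmean_indepM.
Qed.

(** The [i]-th conditional entropy for the convex function [t `^ (q / (q -
    1))]. *)
Definition entropy (q : R) i g : R := E (fun x => g x `^ (q / (q - 1))) -
  E (fun x => cmean i g x `^ (q / (q - 1))).

(** Averaging over another coordinate decreases the entropy. Put [W := g `^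
    (1/s)] with [s := q - 1], and let [a], [b], [c] be the same roots of
    [cmean i g], [cmean j g] and of the iterated mean. Young's inequality for
    [u := max (a + b - c) 0] and [W `^ s] bounds [W `^ q] from below by [u * W
    `^ s] and [u `^ q]; the first has mean at least that of [a `^ q + b `^ q -
    c `^ q], and [powR_cross_scaled] bounds the second by the same quantity up
    to a product of fluctuations of mean zero. *)
Lemma entropy_cmean (q : R) i j g : 2 <= q -> i != j -> (forall x, 0 < g x) ->
  entropy q i (cmean j g) <= entropy q i g.
Proof.
move=> q2 ij g0; set s := q - 1. have s1 : 1 <= s by rewrite /s; lra.
have s0 : 0 < s by lra.
have q0 : 0 <= q by lra.
have q1 : 1 < q by lra.
have qE : q = s + 1 by rewrite /s; ring.
pose r (t : R) := t `^ s^-1.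
have r_gt0 t : 0 < t -> 0 < r t by exact: powR_gt0.
have rs t : 0 < t -> r t `^ s = t.
  by move=> /ltW t0; rewrite /r -powRrM mulVf ?powRr1// gt_eqF.
have rq t : t `^ (q / s) = r t `^ q by rewrite /r -powRrM mulrC.
have rr t : 0 < t -> r t * t = r t `^ q.
  move=> t0; rewrite -[X in _ * X]rs// -(@mulr_powRB1 _ (r t) q) ?(ltW (r_gt0 _ t0))//.
  lra.
set gi := cmean i g; set gj := cmean j g; set gij := cmean i (cmean j g).
have gi0 : forall x, 0 < gi x := cmean_gt0 i g0.
have gj0 : forall x, 0 < gj x := cmean_gt0 j g0.
have gij0 : forall x, 0 < gij x := cmean_gt0 i gj0.
have gij_i : indep_of i gij by apply: cmean_indep.
have gijC : gij =1 cmean j gi by apply: cmean_comm.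
have gij_j : indep_of j gij by move=> x a; rewrite !gijC cmean_indep.
have key x : q * (r (gi x) * g x) + q * (r (gj x) * g x) - q * (r (gij x) * g x)
    - r (gi x) `^ q
    - r (gj x) `^ q + r (gij x) `^ q
    - q / s * ((r (gij x) `^ (1 - s) * (gi x - gij x)) * (gj x - gij x))
    <= s * r (g x) `^ q.
  have := powR_cross_scaled s1 (r_gt0 _ (gi0 x)) (r_gt0 _ (gj0 x)) (r_gt0 _ (gij0 x)).
  set u := Num.max _ 0; rewrite -qE !rs//.
  have u0 : 0 <= u by rewrite /u le_max lexx orbT.
  have uxy : r (gi x) + r (gj x) - r (gij x) <= u by rewrite /u le_max lexx.
  have := powR_young q1 u0 (ltW (r_gt0 _ (g0 x))); rewrite -/s rs// => Y C.
  have H := ler_wpM2l q0 (ler_wpM2r (ltW (g0 x)) uxy).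
  exact: tensorization_arith C Y H.
have ri f i0 : indep_of i0 f -> indep_of i0 (fun x => r (f x)).
  by move=> fi x a; rewrite fi.
have Egi : E (fun x => r (gi x) * g x) = E (fun x => r (gi x) `^ q).
  rewrite (@pmean_cmean_indepM i); last exact/ri/cmean_indep.
  by apply: eq_wsum => x; rewrite rr.
have Egj : E (fun x => r (gj x) * g x) = E (fun x => r (gj x) `^ q).
  rewrite (@pmean_cmean_indepM j); last exact/ri/cmean_indep.
  by apply: eq_wsum => x; rewrite rr.
have Egij : E (fun x => r (gij x) * g x) = E (fun x => r (gij x) `^ q).
  rewrite (@pmean_cmean_indepM i); last exact: ri.
  rewrite (@pmean_cmean_indepM j); last exact: ri.
  by apply: eq_wsum => x; rewrite -/gi -gijC rr.
have E0 : E (fun x => (r (gij x) `^ (1 - s) * (gi x - gij x)) * (gj x - gij x)) = 0.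
  rewrite (@pmean_cmean_indepM i) => [|x a]; last by rewrite !gij_i /gi cmean_indep.
  rewrite -[RHS](wsum_cst w1); apply: eq_wsum => x.
  have -> : cmean i (fun x => gj x - gij x) x = gij x - cmean i gij x by exact: wsumB.
  by rewrite (cmean_id p_sum1 gij_i) subrr mulr0.
rewrite qE in key Egi Egj Egij.
rewrite /entropy -(ler_pM2l s0) -/s.
have eE f : E (fun x => f x `^ (q / s)) = wsum (pwt p) (fun x => r (f x) `^ (s + 1)).
  by apply: eq_wsum => x; rewrite rq -qE.
rewrite !eE; exact: tensorization_wsum w0 key Egi Egj Egij E0.
Qed.

Let cmeans g l := foldr cmean g l.

Let cmeans_gt0 g l : (forall x, 0 < g x) -> forall x, 0 < cmeans g l x.
Proof. by move=> g0; elim: l => //= j l IH x; exact: cmean_gt0. Qed.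

Let cmeans_indep g l i : i \in l -> indep_of i (cmeans g l).
Proof.
elim: l => //= j l IH; rewrite inE.
have [->|ij] := eqVneq i j; first by move=> _; exact: cmean_indep.
by move=> /= il; apply: cmean_indep_other; [exact: IH|rewrite eq_sym].
Qed.

Let pmean_cmeans g l : E (cmeans g l) = E g.
Proof. by elim: l => //= j l IH; rewrite pmean_cmean. Qed.

(** Telescoping: the coordinates are averaged out one after the other, and
    each increment is an entropy of an average, at most the entropy of [g]
    itself by [entropy_cmean]. *)
Lemma entropy_subadditive (q : R) g : 2 <= q -> (forall x, 0 < g x) ->
  E (fun x => g x `^ (q / (q - 1))) - E g `^ (q / (q - 1)) <=
  \sum_i entropy q i g.
Proof.
move=> q2 g0; set a := q / (q - 1).
have entL i l : i \notin l -> entropy q i (cmeans g l) <= entropy q i g.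
  elim: l => //= j l IH; rewrite inE negb_or => /andP[ij il].
  by apply: le_trans (IH il); apply: entropy_cmean => //; exact: cmeans_gt0.
have tele l : uniq l ->
    E (fun x => g x `^ a) - E (fun x => cmeans g l x `^ a) <= \sum_(i <- l) entropy q i g.
  elim: l => [_|i l IH]; first by rewrite big_nil subrr.
  rewrite big_cons /= => /andP[il ul].
  by have := IH ul; have := entL i l il; rewrite /entropy -/a/=; lra.
have := tele _ (enum_uniq I); rewrite big_enum/=.
have cmeansg x : cmeans g (enum I) x = E g.
  rewrite (indep_all_cst p_sum1 (f := cmeans g (enum I))) ?pmean_cmeans// => i.
  by apply: cmeans_indep; rewrite mem_enum.
suff -> : E (fun x => cmeans g (enum I) x `^ a) = E g `^ a by [].
by rewrite -[RHS](wsum_cst w1); apply: eq_wsum => x; rewrite cmeansg.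
Qed.

(** The variance proxy [V_+] of [Z]: squared positive increments under
    resampling of one coordinate. *)
Definition Vplus (Z : X -> R) x : R :=
  \sum_i wsum (p i) (fun a => Num.max (Z x - Z (upd x i a)) 0 ^+ 2).

(** Subadditivity of the entropy of [W `^ (q - 1)], then [wsum_entropy_le] in
    each coordinate. *)
Lemma moment_recursion (q : R) (W : X -> R) : 2 <= q -> (forall x, 0 < W x) ->
  E (fun x => W x `^ q) <=
  E (fun x => W x `^ (q - 1)) `^ (q / (q - 1)) +
  q * E (fun x => W x `^ (q - 2) * Vplus W x).
Proof.
move=> q2 W0; rewrite -lerBlDl.
have s0 : q - 1 != 0 by rewrite gt_eqF//; lra.
have := entropy_subadditive q2 (fun x => powR_gt0 (q - 1) (W0 x)).
have -> : E (fun x => (W x `^ (q - 1)) `^ (q / (q - 1))) = E (fun x => W x `^ q).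
  by apply: eq_wsum => x; rewrite -powRrM mulrC divfK.
move=> /le_trans; apply.
have -> : E (fun x => W x `^ (q - 2) * Vplus W x) =
    \sum_i E (fun x => W x `^ (q - 2) *
      wsum (p i) (fun a => Num.max (W x - W (upd x i a)) 0 ^+ 2)).
  by rewrite -wsum_sum; apply: eq_wsum => x; rewrite mulr_sumr.
rewrite mulr_sumr; apply: ler_sum => i _.
rewrite /entropy -(pmean_cmean p_sum1 i) -wsumB.
rewrite -[E (fun x => W x `^ (q - 2) * _)](pmean_cmean p_sum1 i) -wsumZ.
apply: ler_wsum => // x.
have := @wsum_entropy_le _ _ (p i) (fun a => W (upd x i a)) q q2 (p_ge0 i) (p_sum1 i).
move=> /(_ (fun=> W0 _)).
have -> : wsum (p i) (fun b => W (upd x i b) `^ q) =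
    cmean i (fun x => (W x `^ (q - 1)) `^ (q / (q - 1))) x.
  by apply: eq_wsum => a; rewrite -powRrM mulrC divfK.
move=> /le_trans; apply; rewrite le_eqVlt; apply/orP; left; apply/eqP.
congr (q * _); apply: eq_wsum => a; congr (_ * _); apply: eq_wsum => c.
by rewrite upd_upd.
Qed.

End tensorization.

(** * The moment inequality for functions of independent variables *)

Section kappa.
Context {R : realType}.

Lemma kappaE : 2 * kappa R = (1 - expR (- 2^-1))^-1.
Proof.
have e0 : 0 < expR (2^-1 : R) := expR_gt0 _.
have e1 : 1 < expR (2^-1 : R) by rewrite expR_gt1.
have sE : Num.sqrt (expR 1) = expR (2^-1 : R).
  rewrite -[RHS]ger0_norm ?ltW// -sqrtr_sqr; congr Num.sqrt.
  by rewrite expr2 -expRD; congr expR; lra.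
by rewrite /kappa sE expRN; field; rewrite !gt_eqF//= ?subr_gt0.
Qed.

Lemma expR_half_bounds : 5 / 9 <= expR (- 2^-1 : R) < 1.
Proof.
rewrite expR_lt1 oppr_lt0 invr_gt0 ltr0n andbT.
have -> : expR (- 2^-1 : R) = expR (- 8^-1) ^+ 4.
  by rewrite -expRM_natl; congr expR; lra.
have h : 7 / 8 <= expR (- 8^-1 : R) by apply: le_trans (expR_ge1Dx _); lra.
apply: (@le_trans _ _ ((7 / 8) ^+ 4)); first by lra.
by rewrite lerXn2r// nnegrE; lra.
Qed.

Lemma kappa_ge : 9 / 4 <= 2 * kappa R.
Proof.
have /andP[h1 h2] := expR_half_bounds.
rewrite kappaE -[leLHS]invrK lef_pV2 ?posrE ?invr_gt0 ?subr_gt0//; lra.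
Qed.

End kappa.

Section holder.
Context {R : realType}.

Lemma powR_young2 (r u w : R) : 2 <= r -> 0 <= u -> 0 <= w ->
  w `^ (r - 2) * u ^+ 2 <= 2 / r * u `^ r + (r - 2) / r * w `^ r.
Proof.
rewrite le_eqVlt => /predU1P[<-|r2] u0 w0.
  by rewrite subrr powRr0 -powR_mulrn//; lra.
have r0 : 0 < r / 2 by lra.
have r'0 : 0 < r / (r - 2) by rewrite divr_gt0//; lra.
have c : (r / 2)^-1 + (r / (r - 2))^-1 = 1 by field; rewrite !gt_eqF//; lra.
have := conjugate_powR (exprn_ge0 2 u0) (powR_ge0 w (r - 2)) r0 r'0 c.
have -> : (u ^+ 2) `^ (r / 2) = u `^ r.
  by rewrite -powR_mulrn// -powRrM; congr powR; field.
have -> : (w `^ (r - 2)) `^ (r / (r - 2)) = w `^ r.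
  by rewrite -powRrM; congr powR; field; rewrite gt_eqF//; lra.
rewrite !invf_div mulrC => /le_trans; apply; rewrite le_eqVlt; apply/orP; left.
by apply/eqP; ring.
Qed.

Lemma wsum_holder2 (T : finType) (w D W : T -> R) (r b Y : R) :
  (forall t, 0 <= w t) -> 2 <= r -> 0 < b -> 0 < Y ->
  (forall t, 0 <= D t) -> (forall t, 0 <= W t) ->
  wsum w (fun t => D t `^ r) <= b `^ r -> wsum w (fun t => W t `^ r) <= Y `^ r ->
  wsum w (fun t => W t `^ (r - 2) * D t ^+ 2) <= Y `^ (r - 2) * b ^+ 2.
Proof.
move=> w0 r2 b0 Y0 D0 W0 HD HW.
have r0 : 0 < r by lra.
have scale (s c t : R) : 0 < c -> 0 <= t -> t `^ s = c `^ s * (t / c) `^ s.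
  move=> c0 t0; rewrite -powRM ?(ltW c0) ?divr_ge0// ?(ltW c0)//.
  by rewrite mulrC divfK ?gt_eqF.
have k1 : 0 <= 2 / r by rewrite divr_ge0// ltW.
have k2 : 0 <= (r - 2) / r by rewrite divr_ge0 ?subr_ge0// ltW.
pose G t := 2 / r * ((b `^ r)^-1 * D t `^ r) + (r - 2) / r * ((Y `^ r)^-1 * W t `^ r).
apply: (@le_trans _ _ (wsum w (fun t => Y `^ (r - 2) * b ^+ 2 * G t))).
  apply: ler_wsum => // t; rewrite (scale (r - 2) Y)//.
  have -> : D t ^+ 2 = b ^+ 2 * (D t / b) ^+ 2 by field; rewrite gt_eqF.
  rewrite mulrACA ler_wpM2l//.
    by rewrite mulr_ge0 ?powR_ge0// sqr_ge0.
  have Db : 0 <= D t / b by rewrite divr_ge0// ltW.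
  have WY : 0 <= W t / Y by rewrite divr_ge0// ltW.
  apply: (le_trans (powR_young2 r2 Db WY)); rewrite /G.
  by rewrite (scale r b (D t))// (scale r Y (W t))// !mulKf ?gt_eqF ?powR_gt0.
rewrite wsumZ ler_piMr//; first by rewrite mulr_ge0 ?powR_ge0// sqr_ge0.
rewrite /G wsumD !wsumZ.
have h1 : (b `^ r)^-1 * wsum w (fun t => D t `^ r) <= 1.
  by rewrite mulrC ler_pdivrMr ?powR_gt0// mul1r.
have h2 : (Y `^ r)^-1 * wsum w (fun t => W t `^ r) <= 1.
  by rewrite mulrC ler_pdivrMr ?powR_gt0// mul1r.
apply: (le_trans (lerD (ler_wpM2l k1 h1) (ler_wpM2l k2 h2))).
suff -> : 2 / r * 1 + (r - 2) / r * 1 = 1 by [].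
by field; rewrite gt_eqF.
Qed.

(** The step from [r - 1] to [r] in [moment_bound_gt0]. Since [(1 - 1/r) `^
    (r/2) <= exp (-1/2)] and [1 / (2 kappa) = 1 - exp (-1/2)], the first term
    is at most [exp (-1/2)] and the second below [1 - exp (-1/2)]; this is
    where the value of [kappa] comes from. *)
Lemma kappa_contraction (r rho : R) : 2 <= r -> 0 < rho ->
  Num.sqrt (2 * kappa R * r) * rho < 1 ->
  (Num.sqrt (2 * kappa R * (r - 1)) * rho) `^ r + r * rho ^+ 2 < 1.
Proof.
move=> r2 rho0; have := @kappa_ge R; set K := 2 * kappa R => K2.
have K0 : 0 < K by lra.
have r0 : 0 < r by lra.
have s0 : 0 <= r - 1 by lra.
have Kr0 : 0 <= K * r by rewrite mulr_ge0// ltW.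
have Ks0 : 0 <= K * (r - 1) by rewrite mulr_ge0// ltW.
move=> H.
have {}H : K * r * rho ^+ 2 < 1.
  rewrite -[K * r]sqr_sqrtr// -exprMn exprn_ilt1//.
  by rewrite mulr_ge0 ?sqrtr_ge0// ltW.
have h1 : (Num.sqrt (K * (r - 1)) * rho) `^ r <= expR (- 2^-1).
  have -> : expR (- 2^-1 : R) = expR (- (2 * r)^-1) `^ r.
    by rewrite -expRM; congr expR; field; rewrite gt_eqF.
  rewrite ler_powR2// ?expR_ge0//; last by rewrite mulr_ge0 ?sqrtr_ge0// ltW.
  rewrite -(@ler_pXn2r _ 2)// ?nnegrE ?expR_ge0//; last by rewrite mulr_ge0 ?sqrtr_ge0// ltW.
  rewrite exprMn sqr_sqrtr// -expRM_natl.
  have -> : 2%:R * - (2 * r)^-1 = - r^-1 by field; rewrite gt_eqF.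
  apply: le_trans (expR_ge1Dx _).
  rewrite -(ler_pM2r r0) mulrDl mulNr mulVf ?gt_eqF// mul1r.
  have := ler_wpM2l s0 (ltW H); lra.
have : K * (r * rho ^+ 2) < K * (1 - expR (- 2^-1)).
  have /andP[_ e1] := @expR_half_bounds R.
  have -> : K * (1 - expR (- 2^-1)) = 1.
    by rewrite /K kappaE mulVf// gt_eqF// subr_gt0.
  by rewrite mulrA.
by rewrite ltr_pM2l//; lra.
Qed.

End holder.

Section moment_bound.
Context {R : realType} {I A : finType} (p : I -> A -> R).
Hypotheses (p_ge0 : forall i a, 0 <= p i a) (p_sum1 : forall i, \sum_a p i a = 1).
Notation X := {ffun I -> A}.
Notation E := (pmean p).
Implicit Types (Z W D : X -> R) (x : X) (i j : I) (q r b : R).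

Let w0 : forall x, 0 <= pwt p x. Proof. exact: pwt_ge0. Qed.
Let w1 : \sum_x pwt p x = 1. Proof. exact: pwt_sum1. Qed.

Lemma ler_Vplus Z W x :
  (forall y, Num.max (W x - W y) 0 <= Num.max (Z x - Z y) 0) ->
  Vplus p W x <= Vplus p Z x.
Proof.
move=> ZW; apply: ler_sum => i _; apply: ler_wsum => // a.
by apply: lerXn2r => //; rewrite nnegrE le_max lexx orbT.
Qed.

(** [moment_recursion] at [q = 2], applied to [Z + 1] to have a positive
    function. The factor 2 is harmless, because [2 * kappa] exceeds it. *)
Lemma efron_stein Z : (forall x, 0 <= Z x) ->
  E (fun x => (Z x - E Z) ^+ 2) <= 2 * E (Vplus p Z).
Proof.
move=> Z0; pose W x := Z x + 1.
have W0 x : 0 < W x by rewrite /W ltr_wpDl.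
have := moment_recursion p_ge0 p_sum1 (lexx 2) W0.
have -> : 2 - 1 = 1 :> R by ring.
have -> : 2 / 1 = 2%:R :> R by rewrite divr1.
have -> : E (fun x => W x `^ 1) = E Z + 1.
  rewrite -[X in _ + X](wsum_cst w1) -wsumD; apply: eq_wsum => x.
  by rewrite powRr1 ?ltW.
have EZ0 : 0 <= E Z by exact: wsum_ge0.
have -> : E (fun x => W x `^ 2) = E (fun x => Z x ^+ 2 + (2 * Z x + 1)).
  by apply: eq_wsum => x; rewrite powR_mulrn ?ltW// /W; ring.
have -> : E (fun x => W x `^ (2 - 2) * Vplus p W x) = E (Vplus p Z).
  apply: eq_wsum => x; rewrite subrr powRr0 mul1r; apply: eq_bigr => i _.
  by apply: eq_wsum => a; rewrite /W opprD addrACA subrr addr0.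
have -> : E (fun x => Z x ^+ 2 + (2 * Z x + 1)) = E (fun x => Z x ^+ 2) + (2 * E Z + 1).
  by rewrite [LHS]wsumD wsumD wsumZ (wsum_cst w1).
have -> : E (fun x => (Z x - E Z) ^+ 2) = E (fun x => Z x ^+ 2) - E Z ^+ 2.
  transitivity (E (fun x => Z x ^+ 2 + (- (2 * E Z) * Z x + E Z ^+ 2))).
    by apply: eq_wsum => x; ring.
  by rewrite [LHS]wsumD wsumD wsumZ (wsum_cst w1) /pmean; ring.
rewrite powR_mulrn ?addr_ge0//; move: (E _) (E _) (E _) => a b c; lra.
Qed.

(** Induction on the exponent with step 1, from [efron_stein] on [1 <= r <=
    2]. If the bound failed at [r], dividing [moment_recursion] by the r-th
    moment and using Hoelder's inequality on its last term would contradict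
    [kappa_contraction]. *)
Lemma moment_bound_gt0 q Z D b : 2 <= q -> 0 < b ->
  (forall x, 0 <= Z x) -> (forall x, 0 <= D x) ->
  (forall x, Vplus p Z x <= D x ^+ 2) ->
  E (fun x => D x `^ q) <= b `^ q ->
  E (fun x => Num.max (Z x - E Z) 0 `^ q) <= (Num.sqrt (2 * kappa R * q) * b) `^ q.
Proof.
move=> q2 b0 Z0 D0 VD HD; have K2 := @kappa_ge R.
set K := 2 * kappa R in K2 *; have K0 : 0 < K by lra.
have EZ0 : 0 <= E Z by exact: wsum_ge0.
have q0 : 0 < q by lra.
(* The floor b / 2 makes W positive; it adds b ^+ 2 / 4 to the second moment,
   and 2 + 1/4 <= 2 * kappa. *)
pose W x := Num.max (Z x - E Z) (b / 2).
have W0 x : 0 < W x by rewrite /W lt_max divr_gt0 ?orbT.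
have W0' x : 0 <= W x by exact: ltW.
have VW x : Vplus p W x <= D x ^+ 2.
  apply: le_trans (VD x); apply: ler_Vplus => y; rewrite /W.
  rewrite ge_max [X in _ && X]le_max lexx orbT andbT.
  have [h1|h1] := leP (Z x - E Z) (b / 2); have [h2|h2] := leP (Z y - E Z) (b / 2);
    rewrite le_max; apply/orP; (left; lra) || (right; lra).
have base : E (fun x => W x `^ 2) <= (3 / 2 * b) `^ 2.
  rewrite (@powR_mulrn _ _ 2); last by lra.
  have ED2 : E (fun x => D x ^+ 2) <= b ^+ 2.
    have := wsum_lyapunov w0 w1 (ltr0Sn R 1) q2 (ltW b0) D0 HD.
    rewrite powR_mulrn ?(ltW b0)//; apply: le_trans; rewrite le_eqVlt.
    by apply/orP; left; apply/eqP/eq_wsum => x; rewrite powR_mulrn.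
  have EV : E (Vplus p Z) <= E (fun x => D x ^+ 2) by exact: ler_wsum.
  have ES := efron_stein Z0.
  apply: (@le_trans _ _ (E (fun x => (Z x - E Z) ^+ 2) + b ^+ 2 / 4)).
    rewrite -[X in _ + X](wsum_cst w1) -wsumD; apply: ler_wsum => // x.
    rewrite (@powR_mulrn _ _ 2)// /W.
    have [h1|h1] := leP (Z x - E Z) (b / 2).
      by have := sqr_ge0 (Z x - E Z); lra.
    by rewrite lerDl divr_ge0// sqr_ge0.
  move: (E _) (E _) (E _) ES EV ED2 => a1 a2 a3; lra.
pose c r := Num.sqrt (K * r) * b.
have c0 r : 0 <= c r by rewrite mulr_ge0 ?sqrtr_ge0// ltW.
have small r : 1 <= r -> r <= 2 -> E (fun x => W x `^ r) <= c r `^ r.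
  move=> r1 r2; have r0 : 0 < r by lra.
  have b1 : 0 <= 3 / 2 * b by lra.
  apply: (le_trans (wsum_lyapunov w0 w1 r0 r2 b1 W0' base)).
  rewrite ler_powR2//.
  rewrite ler_wpM2r ?(ltW b0)//.
  have -> : 3 / 2 = Num.sqrt ((3 / 2) ^+ 2) :> R by rewrite sqrtr_sqr ger0_norm//; lra.
  apply: ler_wsqrtr; have := ler_wpM2l (ltW K0) r1; lra.
have step r : 2 <= r -> r <= q -> E (fun x => W x `^ (r - 1)) <= c (r - 1) `^ (r - 1) ->
    E (fun x => W x `^ r) <= c r `^ r.
  move=> r2 rq IH; have r0 : 0 < r by lra.
  have s0 : 0 < r - 1 by lra.
  have EWr : 0 < E (fun x => W x `^ r).
    by apply: wsum_gt0 => // x; exact: powR_gt0.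
  pose Y := E (fun x => W x `^ r) `^ r^-1.
  have Y0 : 0 < Y by exact: powR_gt0.
  have YE : E (fun x => W x `^ r) = Y `^ r.
    by rewrite /Y -powRrM mulVf ?powRr1 ?gt_eqF// ltW.
  rewrite YE ler_powR2// ?(ltW Y0)// leNgt; apply/negP => cY.
  have HDr : E (fun x => D x `^ r) <= b `^ r.
    exact (wsum_lyapunov w0 w1 r0 rq (ltW b0) D0 HD).
  have := moment_recursion p_ge0 p_sum1 r2 W0; rewrite YE.
  have H2 : E (fun x => W x `^ (r - 2) * Vplus p W x) <= Y `^ (r - 2) * b ^+ 2.
    apply: le_trans (wsum_holder2 w0 r2 b0 Y0 D0 W0' HDr _); last by rewrite -YE.
    by apply: ler_wsum => // x; rewrite ler_wpM2l ?powR_ge0.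
  have H1 : E (fun x => W x `^ (r - 1)) `^ (r / (r - 1)) <= c (r - 1) `^ r.
    have -> : c (r - 1) `^ r = (c (r - 1) `^ (r - 1)) `^ (r / (r - 1)).
      by rewrite -powRrM mulrC divfK ?gt_eqF.
    rewrite ler_powR2 ?divr_gt0 ?powR_ge0// wsum_ge0// => x; exact: powR_ge0.
  move=> /le_trans/(_ (lerD H1 (ler_wpM2l (ltW r0) H2))).
  pose rho := b / Y; have rho0 : 0 < rho by rewrite divr_gt0.
  have cr s : c s = Y * (Num.sqrt (K * s) * rho) by rewrite /c /rho; field; rewrite gt_eqF.
  have crho : Num.sqrt (K * r) * rho < 1.
    by move: cY; rewrite cr -[ltRHS]mulr1 ltr_pM2l.
  have := kappa_contraction r2 rho0 crho; rewrite -/K => C.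
  rewrite cr powRM ?(ltW Y0)//; last by rewrite mulr_ge0 ?sqrtr_ge0// ltW.
  have -> : r * (Y `^ (r - 2) * b ^+ 2) = Y `^ r * (r * rho ^+ 2).
    have -> : Y `^ r = Y `^ (r - 2) * Y ^+ 2.
      by rewrite -(@powR_mulrn _ Y 2) ?(ltW Y0)// -powRD ?subrK// (gt_eqF Y0) implybT.
    by rewrite /rho; field; rewrite gt_eqF.
  by rewrite -mulrDr leNgt -[ltRHS]mulr1 ltr_pM2l ?powR_gt0// C.
have all n r : 1 <= r -> r <= q -> r <= n%:R + 2 -> E (fun x => W x `^ r) <= c r `^ r.
  elim: n r => [r r1 _|n IH r r1 rq]; first by rewrite add0r; exact: small.
  rewrite -natr1 => rn; have [r2|/ltW r2] := leP r 2; first exact: small.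
  by apply: step => //; apply: IH; lra.
have qn : q <= (Num.truncn q).+1%:R + 2 by have := truncnS_gt q; lra.
have q1 : 1 <= q by lra.
apply: le_trans (all _ q q1 (lexx q) qn); apply: ler_wsum => // x.
apply: ge0_ler_powR; rewrite ?nnegrE ?(ltW q0)//.
  by rewrite le_max lexx orbT.
by rewrite /W ge_max !le_max lexx/= divr_ge0 ?orbT// ltW.
Qed.

Lemma moment_bound q Z D b : 2 <= q -> 0 <= b ->
  (forall x, 0 <= Z x) -> (forall x, 0 <= D x) ->
  (forall x, Vplus p Z x <= D x ^+ 2) ->
  E (fun x => D x `^ q) <= b `^ q ->
  E (fun x => Num.max (Z x - E Z) 0 `^ q) <= (Num.sqrt (2 * kappa R * q) * b) `^ q.
Proof.
move=> q2 b0 Z0 D0 VD HD; have K2 := @kappa_ge R.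
have q0 : 0 < q by lra.
set c := Num.sqrt _; have c0 : 0 < c by rewrite sqrtr_gt0 mulr_gt0//; lra.
apply: ler_powR_closure => //; first by apply: wsum_ge0 => // x; exact: powR_ge0.
  by rewrite mulr_ge0// ltW.
move=> e e0; have be : 0 < b + e / c by rewrite ltr_wpDl// divr_gt0.
have -> : c * b + e = c * (b + e / c) by field; rewrite gt_eqF.
apply: (moment_bound_gt0 q2 be Z0 D0 VD); apply: (le_trans HD).
by rewrite ler_powR2// ?(ltW be)// lerDl divr_ge0 ?(ltW c0)// ltW.
Qed.

End moment_bound.

(** * Suprema over a finite class: bounds on V_+ *)

Section finite_max.
Context {R : realType} {J : finType} (j0 : J).
Implicit Types (c : J -> R).

Definition fmax c : R := c [arg max_(j > j0) c j]%O.

Lemma le_fmax c j : c j <= fmax c.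
Proof. by rewrite /fmax; case: arg_maxP => //= k _; exact. Qed.

Lemma fmax_le c b : (forall j, c j <= b) -> fmax c <= b.
Proof. exact. Qed.

Lemma fmax_ge0 c : (forall j, 0 <= c j) -> 0 <= fmax c.
Proof. exact. Qed.

Lemma ler_fmax c c' : (forall j, c j <= c' j) -> fmax c <= fmax c'.
Proof. by move=> cc'; apply: fmax_le => j; apply: le_trans (le_fmax _ j). Qed.

Lemma eq_fmax c c' : c =1 c' -> fmax c = fmax c'.
Proof.
by move=> cc'; apply/eqP; rewrite eq_le !ler_fmax// => j; rewrite cc'.
Qed.

Lemma fmaxP c : exists j, fmax c = c j.
Proof. by exists [arg max_(j > j0) c j]%O. Qed.

End finite_max.

Section empirical.
Context {R : realType} {I A J : finType} (j0 : J) (p : I -> A -> R).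
Hypotheses (p_ge0 : forall i a, 0 <= p i a) (p_sum1 : forall i, \sum_a p i a = 1).
Notation X := {ffun I -> A}.
Notation E := (pmean p).
Implicit Types (g : I -> J -> A -> R) (x : X) (i : I) (j : J).

Definition absSup g x : R := fmax j0 (fun j => `|\sum_i g i j (x i)|).
Definition rootSup g x : R := fmax j0 (fun j => Num.sqrt (\sum_i g i j (x i) ^+ 2)).
Definition envelope g i a : R := fmax j0 (fun j => `|g i j a|).
Definition maxAbs g x : R := \big[Num.max/0]_i envelope g i (x i).

Definition centered g := forall i j, wsum (p i) (g i j) = 0.

Lemma absSup_ge0 g x : 0 <= absSup g x. Proof. exact: fmax_ge0. Qed.
Lemma rootSup_ge0 g x : 0 <= rootSup g x.
Proof. by apply: fmax_ge0 => j; exact: sqrtr_ge0. Qed.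
Lemma envelope_ge0 g i a : 0 <= envelope g i a. Proof. exact: fmax_ge0. Qed.
Lemma maxAbs_ge0 g x : 0 <= maxAbs g x.
Proof. by rewrite /maxAbs; elim/big_rec: _ => //= i m _ m0; rewrite le_max m0 orbT. Qed.

Lemma le_envelope g i j a : `|g i j a| <= envelope g i a.
Proof. exact: (le_fmax j0 (fun j => `|g i j a|)). Qed.

Lemma le_maxAbs g x i : envelope g i (x i) <= maxAbs g x.
Proof. by rewrite /maxAbs; apply: (le_bigmax _ (fun i => envelope g i (x i))). Qed.

Lemma sqr_le_maxAbs g x i j : g i j (x i) ^+ 2 <= maxAbs g x ^+ 2.
Proof.
rewrite -[leLHS]real_normK ?num_real// lerXn2r ?nnegrE ?maxAbs_ge0//.
exact: le_trans (le_envelope _ _ _ _) (le_maxAbs _ _ _).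
Qed.

Lemma sum_upd (h : I -> A -> R) x i a :
  \sum_k h k (upd x i a k) = \sum_k h k (x k) + (h i a - h i (x i)).
Proof.
rewrite (bigD1 i)//= upd_same [in RHS](bigD1 i)//=.
rewrite (eq_bigr (fun k => h k (x k))) => [|k ki]; first by ring.
by rewrite upd_other.
Qed.

Lemma wsum_sqr_diff g i j u : centered g ->
  wsum (p i) (fun a => (u - g i j a) ^+ 2) =
  u ^+ 2 + wsum (p i) (fun a => g i j a ^+ 2).
Proof.
move=> gc; transitivity (wsum (p i) (fun a => u ^+ 2 + (- (2 * u) * g i j a + g i j a ^+ 2))).
  by apply: eq_wsum => a; ring.
have g0 : wsum (p i) (fun a => g i j a) = 0 by exact: gc.
by rewrite wsumD wsum_cst// wsumD wsumZ g0 mulr0 add0r.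
Qed.

Lemma sqr_max0_le (u v : R) : u <= `|v| -> Num.max u 0 ^+ 2 <= v ^+ 2.
Proof.
move=> uv; rewrite -[leRHS]real_normK ?num_real//; apply: lerXn2r.
- by rewrite nnegrE le_max lexx orbT.
- by rewrite nnegrE.
- by rewrite ge_max uv normr_ge0.
Qed.

(** If [j] attains the supremum at [x], resampling coordinate [i] lowers it by
    at most the increment of [g i j]; as [g] is centered, the mean square of
    that increment is [g i j (x i) ^+ 2] plus a variance. *)
Lemma Vplus_absSup g x sig : centered g -> 0 <= sig ->
  (forall j, \sum_i wsum (p i) (fun a => g i j a ^+ 2) <= sig ^+ 2) ->
  Vplus p (absSup g) x <= (sig + rootSup g x) ^+ 2.
Proof.
move=> gc sig0 Hs; have [j jE] := fmaxP j0 (fun j => `|\sum_i g i j (x i)|).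
apply: (@le_trans _ _ (\sum_i wsum (p i) (fun a => (g i j (x i) - g i j a) ^+ 2))).
  apply: ler_sum => i _; apply: ler_wsum => // a; apply: sqr_max0_le.
  rewrite {1}/absSup jE lerBlDr.
  apply: le_trans (lerD (lexx _) (le_fmax j0 _ j)).
  rewrite (sum_upd (fun i => g i j)).
  have {1}-> : \sum_i g i j (x i) = (g i j (x i) - g i j a) +
      (\sum_i g i j (x i) + (g i j a - g i j (x i))) by ring.
  exact: ler_normD.
have S2 : \sum_i g i j (x i) ^+ 2 <= rootSup g x ^+ 2.
  have : Num.sqrt (\sum_i g i j (x i) ^+ 2) <= rootSup g x.
    exact: (le_fmax j0 (fun j => Num.sqrt (\sum_i g i j (x i) ^+ 2))).
  rewrite -(@ler_pXn2r _ 2)// ?nnegrE ?sqrtr_ge0 ?rootSup_ge0//.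
  by rewrite sqr_sqrtr// sumr_ge0// => i _; exact: sqr_ge0.
under eq_bigr do rewrite wsum_sqr_diff//.
rewrite big_split/=; have := Hs j.
have := mulr_ge0 sig0 (rootSup_ge0 g x); move: S2.
move: (\sum_i wsum _ _) (\sum_i _ ^+ 2) (rootSup g x) => a b c; nra.
Qed.

(** With [j] attaining the supremum [S] at [x], the Cauchy-Schwarz inequality
    gives a decrease of at most [(g i j (x i) / S) * (g i j (x i) - g i j a)]
    under resampling of coordinate [i], and the squares of the weights [g i j
    (x i) / S] sum to 1. *)
Lemma Vplus_rootSup g x s : centered g -> 0 <= s ->
  (forall i j, wsum (p i) (fun a => g i j a ^+ 2) <= s ^+ 2) ->
  Vplus p (rootSup g) x <= (s + maxAbs g x) ^+ 2.
Proof.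
move=> gc s0 Hs; set S := rootSup g x; set M := maxAbs g x.
have M0 : 0 <= M := maxAbs_ge0 g x.
have sM : s ^+ 2 + M ^+ 2 <= (s + M) ^+ 2 by have := mulr_ge0 s0 M0; nra.
have := rootSup_ge0 g x; rewrite -/S le_eqVlt => /predU1P[S0|S0].
  apply: le_trans (sqr_ge0 _); rewrite /Vplus big1// => i _.
  rewrite -[RHS](wsum_cst (p_sum1 i)); apply: eq_wsum => a.
  by rewrite -/S -S0 sub0r max_r ?expr0n// oppr_le0 rootSup_ge0.
have [j jE] := fmaxP j0 (fun j => Num.sqrt (\sum_i g i j (x i) ^+ 2)).
have S2 : \sum_i g i j (x i) ^+ 2 = S ^+ 2.
  by rewrite /S /rootSup jE sqr_sqrtr// sumr_ge0// => i _; exact: sqr_ge0.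
apply: (@le_trans _ _ (\sum_i wsum (p i) (fun a =>
    (g i j (x i) / S) ^+ 2 * (g i j (x i) - g i j a) ^+ 2))).
  apply: ler_sum => i _; apply: ler_wsum => // a; rewrite -exprMn.
  set u := g i j (x i); set v := g i j a.
  apply: sqr_max0_le; apply: le_trans (ler_norm _).
  rewrite mulrAC ler_pdivlMr//.
  set B := S ^+ 2 - u ^+ 2.
  have B0 : 0 <= B.
    rewrite /B -S2 (bigD1 i)//= -/u addrAC subrr add0r sumr_ge0// => k _.
    exact: sqr_ge0.
  have Bv : 0 <= B + v ^+ 2 by rewrite addr_ge0// sqr_ge0.
  have Sy : Num.sqrt (B + v ^+ 2) <= rootSup g (upd x i a).
    have : Num.sqrt (\sum_k g k j (upd x i a k) ^+ 2) <= rootSup g (upd x i a).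
      exact: (le_fmax j0 (fun j => Num.sqrt (\sum_k g k j (upd x i a k) ^+ 2))).
    suff -> : \sum_k g k j (upd x i a k) ^+ 2 = B + v ^+ 2 by [].
    by rewrite (sum_upd (fun i a => g i j a ^+ 2)) S2 /B /u /v; ring.
  have cs : B + u * v <= S * Num.sqrt (B + v ^+ 2).
    apply: (le_trans (ler_norm _)).
    rewrite -(@ler_pXn2r _ 2)// ?nnegrE ?mulr_ge0 ?sqrtr_ge0 ?(ltW S0)//.
    rewrite real_normK ?num_real// exprMn (sqr_sqrtr Bv).
    have -> : S ^+ 2 = B + u ^+ 2 by rewrite /B subrK.
    rewrite -subr_ge0.
    have -> : (B + u ^+ 2) * (B + v ^+ 2) - (B + u * v) ^+ 2 = B * (u - v) ^+ 2 by ring.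
    by rewrite mulr_ge0// sqr_ge0.
  have e1 := ler_wpM2l (ltW S0) Sy.
  have e2 : S ^+ 2 = B + u ^+ 2 by rewrite /B subrK.
  rewrite -subr_ge0 -/S.
  set r := rootSup g (upd x i a) in Sy e1 *.
  have -> : u * (u - v) - (S - r) * S = S * r - (B + u * v).
    by rewrite [(S - r) * S]mulrBl -expr2 e2; ring.
  by rewrite subr_ge0; exact: le_trans cs e1.
apply: le_trans sM.
apply: (@le_trans _ _ (\sum_i (g i j (x i) / S) ^+ 2 * (s ^+ 2 + M ^+ 2))).
  apply: ler_sum => i _; rewrite wsumZ wsum_sqr_diff//.
  by rewrite ler_wpM2l ?sqr_ge0// addrC lerD// sqr_le_maxAbs.
rewrite -mulr_suml (eq_bigr (fun i => g i j (x i) ^+ 2 * (S ^+ 2)^-1)).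
  by rewrite -mulr_suml S2 divff ?mul1r// gt_eqF// exprn_gt0.
by move=> i _; rewrite exprMn exprVn.
Qed.

End empirical.

Section discrete_upper_tail.
Context {R : realType} {I A J : finType} (j0 : J) (p : I -> A -> R).
Hypotheses (p_ge0 : forall i a, 0 <= p i a) (p_sum1 : forall i, \sum_a p i a = 1).
Notation X := {ffun I -> A}.
Notation E := (pmean p).
Implicit Types (g : I -> J -> A -> R) (x : X) (i : I) (j : J).

Let w0 : forall x, 0 <= pwt p x. Proof. exact: pwt_ge0. Qed.
Let w1 : \sum_x pwt p x = 1. Proof. exact: pwt_sum1. Qed.

Lemma pmean_le_sqr (Y : X -> R) (b : R) : 0 <= b -> (forall x, 0 <= Y x) ->
  E (fun x => Y x ^+ 2) <= b ^+ 2 -> E Y <= b.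
Proof.
move=> b0 Y0 H; have := @wsum_lyapunov _ _ _ w0 w1 Y 2 1 b ltr01 _ b0 Y0.
have -> : wsum (pwt p) (fun t => Y t `^ 1) = E Y.
  by apply: eq_wsum => x; rewrite powRr1.
have -> : wsum (pwt p) (fun t => Y t `^ 2) = E (fun x => Y x ^+ 2).
  by apply: eq_wsum => x; rewrite powR_mulrn.
by rewrite powR_mulrn// powRr1//; apply => //; rewrite ler1n.
Qed.

Lemma max0_ge0 (u : R) : 0 <= Num.max u 0.
Proof. by rewrite le_max lexx orbT. Qed.

(** [moment_bound] twice: for [absSup] the proxy is [(sig + rootSup) ^+ 2],
    and the fluctuations of [rootSup] have a proxy at most [(s + maxAbs) ^+
    2]. *)
Lemma discrete_upper_tail (q Sig sig Mq s : R) g : 2 <= q ->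
  0 <= Sig -> 0 <= sig -> 0 <= Mq -> 0 <= s -> centered p g ->
  E (fun x => rootSup j0 g x ^+ 2) <= Sig ^+ 2 ->
  (forall j, \sum_i wsum (p i) (fun a => g i j a ^+ 2) <= sig ^+ 2) ->
  E (fun x => maxAbs j0 g x `^ q) <= Mq `^ q ->
  (forall i j, wsum (p i) (fun a => g i j a ^+ 2) <= s ^+ 2) ->
  E (fun x => Num.max (absSup j0 g x - E (absSup j0 g)) 0 `^ q) <=
  (Num.sqrt (2 * kappa R * q) *
    (sig + Sig + Num.sqrt (2 * kappa R * q) * (s + Mq))) `^ q.
Proof.
move=> q2 Sig0 sig0 Mq0 s0 gc HS Hsig HM Hs.
have q1 : 1 <= q by lra.
have q0 : 0 <= q by lra.
set c := Num.sqrt _; have c0 : 0 <= c := sqrtr_ge0 _.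
have csM : 0 <= c * (s + Mq) by rewrite mulr_ge0// addr_ge0.
have sS : 0 <= sig + Sig by exact: addr_ge0.
set S := rootSup j0 g.
have HW : E (fun x => Num.max (S x - E S) 0 `^ q) <= (c * (s + Mq)) `^ q.
  apply: (@moment_bound _ _ _ _ p_ge0 p_sum1 _ _ (fun x => s + maxAbs j0 g x)) => //.
  - exact: addr_ge0.
  - by move=> x; exact: rootSup_ge0.
  - by move=> x; rewrite addr_ge0// maxAbs_ge0.
  - by move=> x; exact: Vplus_rootSup.
  - by apply: wsum_minkowski_cst => // x; exact: maxAbs_ge0.
apply: (@moment_bound _ _ _ _ p_ge0 p_sum1 _ _ (fun x => sig + S x)) => //.
- exact: addr_ge0.
- by move=> x; exact: absSup_ge0.
- by move=> x; rewrite addr_ge0// rootSup_ge0.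
- by move=> x; exact: Vplus_absSup.
have ES : E S <= Sig by apply: pmean_le_sqr => // x; exact: rootSup_ge0.
apply: le_trans (wsum_minkowski_cst w0 w1 q1 sS csM (fun x => max0_ge0 _) HW).
apply: ler_wsum => // x; apply: ge0_ler_powR => //; rewrite ?nnegrE.
- by rewrite addr_ge0// rootSup_ge0.
- by rewrite addr_ge0// max0_ge0.
rewrite -addrA lerD2l -lerBlDl le_max; apply/orP; left.
by rewrite lerD2l lerN2.
Qed.

End discrete_upper_tail.

(** * Symmetrization and the bound on the strong variance *)

Section symmetrization.
Context {R : realType} {J : finType} (j0 : J).
Notation fmax := (fmax j0).

Lemma fmax_wsum (T : finType) (w : T -> R) (F : J -> T -> R) :
  (forall t, 0 <= w t) ->
  fmax (fun j => wsum w (F j)) <= wsum w (fun t => fmax (F ^~ t)).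
Proof.
move=> w0; apply: fmax_le => j; apply: ler_wsum => // t.
exact: (le_fmax j0 (F ^~ t)).
Qed.

(** For one coordinate, the contraction principle only needs the two indices
    that attain the maxima on the left. *)
Lemma fmax_contraction (c h f : J -> R) (L : R) : 0 <= L ->
  (forall j k, h j - h k <= L * `|f j - f k|) ->
  fmax (fun j => c j + h j) + fmax (fun j => c j - h j) <=
  fmax (fun j => c j + L * f j) + fmax (fun j => c j - L * f j).
Proof.
move=> L0 hf.
have [j ->] := fmaxP j0 (fun j => c j + h j).
have [k ->] := fmaxP j0 (fun j => c j - h j).
have H := hf j k.
have [fjk|/ltW fjk] := leP (f k) (f j).
  have A := le_fmax j0 (fun j => c j + L * f j) j.
  have B := le_fmax j0 (fun j => c j - L * f j) k.
  by rewrite ger0_norm ?subr_ge0// in H; rewrite /= in A B; lra.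
have A := le_fmax j0 (fun j => c j + L * f j) k.
have B := le_fmax j0 (fun j => c j - L * f j) j.
by rewrite ler0_norm ?subr_le0// in H; rewrite /= in A B; lra.
Qed.

(** Centering [h] is replacing it by its difference with an independent copy;
    by convexity the two copies separate into a plus and a minus term, which
    contraction turns into [f]. *)
Lemma symmetrization_step (T : finType) (w : T -> R) (c : J -> R)
    (h f : J -> T -> R) (L : R) :
  (forall t, 0 <= w t) -> \sum_t w t = 1 -> 0 <= L ->
  (forall t j k, h j t - h k t <= L * `|f j t - f k t|) ->
  2 * wsum w (fun t => fmax (fun j => c j + (h j t - wsum w (h j)))) <=
  wsum w (fun t => fmax (fun j => c j + 2 * L * f j t)) +
  wsum w (fun t => fmax (fun j => c j - 2 * L * f j t)).
Proof.
move=> w0 w1 L0 hf.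
have step1 t : fmax (fun j => c j + (h j t - wsum w (h j))) <=
    wsum w (fun u => fmax (fun j => c j + (h j t - h j u))).
  apply: le_trans (fmax_wsum _ w0); apply: ler_fmax => j.
  by rewrite wsumD wsumB !wsum_cst.
have step2 t u : 2 * fmax (fun j => c j + (h j t - h j u)) <=
    fmax (fun j => c j + 2 * h j t) + fmax (fun j => c j - 2 * h j u).
  have [j ->] := fmaxP j0 (fun j => c j + (h j t - h j u)).
  have A := le_fmax j0 (fun j => c j + 2 * h j t) j.
  have B := le_fmax j0 (fun j => c j - 2 * h j u) j.
  by rewrite /= in A B; lra.
have step3 t : fmax (fun j => c j + 2 * h j t) + fmax (fun j => c j - 2 * h j t) <=
    fmax (fun j => c j + 2 * L * f j t) + fmax (fun j => c j - 2 * L * f j t).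
  apply: fmax_contraction => [|j k]; first by rewrite mulr_ge0.
  by rewrite -mulrBr -mulrA ler_pM2l.
pose P t := fmax (fun j => c j + 2 * h j t).
pose Q t := fmax (fun j => c j - 2 * h j t).
apply: (@le_trans _ _ (wsum w (fun t => P t + wsum w Q))).
  rewrite -wsumZ; apply: ler_wsum => // t.
  apply: (le_trans (ler_wpM2l _ (step1 t))) => //.
  rewrite -wsumZ -[X in X + _](wsum_cst w1) -wsumD.
  by apply: ler_wsum => // u; exact: step2.
rewrite wsumD wsum_cst// -wsumD -wsumD; exact: ler_wsum.
Qed.

End symmetrization.

Section discrete_symmetrization.
Context {R : realType} {I A J : finType} (j0 : J) (p : I -> A -> R).
Hypotheses (p_ge0 : forall i a, 0 <= p i a) (p_sum1 : forall i, \sum_a p i a = 1).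
Notation X := {ffun I -> A}.
Notation E := (pmean p).
Notation fmax := (fmax j0).
Implicit Types (f g h : I -> J -> A -> R) (x : X) (i : I) (j : J).

Let w0 : forall x, 0 <= pwt p x. Proof. exact: pwt_ge0. Qed.

Lemma sum_upd_split f x i a j :
  \sum_k f k j (upd x i a k) = \sum_(k | k != i) f k j (x k) + f i j a.
Proof.
rewrite (bigD1 i)//= upd_same addrC; congr (_ + _).
by apply: eq_bigr => k ki; rewrite upd_other.
Qed.

(** The coordinates are treated one at a time. Each step of
    [symmetrization_step] bounds the mean by an average over two signs, and
    the better sign is kept, so that the random signs of the usual argument
    become fixed ones. *)
Lemma exists_signs h f (L : R) : 0 <= L ->
  (forall i a j k, h i j a - h i k a <= L * `|f i j a - f i k a|) ->
  exists eps : I -> bool,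
    E (fun x => fmax (fun j => \sum_i (h i j (x i) - wsum (p i) (h i j)))) <=
    E (fun x => fmax (fun j => \sum_i (-1) ^+ eps i * (2 * L * f i j (x i)))).
Proof.
move=> L0 hf.
(* The coordinates in l are already symmetrized. *)
pose T (l : seq I) (eps : I -> bool) i j a :=
  if i \in l then (-1) ^+ eps i * (2 * L * f i j a) else h i j a - wsum (p i) (h i j).
suff H l : uniq l -> exists eps, E (fun x => fmax (fun j => \sum_i T [::] eps i j (x i))) <=
    E (fun x => fmax (fun j => \sum_i T l eps i j (x i))).
  have [eps He] := H _ (enum_uniq I); exists eps; apply: (le_trans He).
  rewrite le_eqVlt; apply/orP; left; apply/eqP; apply: eq_wsum => x.
  apply: eq_fmax => j; apply: eq_bigr => i _.
  by rewrite /T mem_enum.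
elim: l => [_|i l IH]; first by exists (fun=> true).
rewrite cons_uniq => /andP[il /IH[eps He]].
pose eb b := fun k => if k == i then b else eps k.
pose F b x := fmax (fun j => \sum_k T (i :: l) (eb b) k j (x k)).
have step : 2 * E (fun x => fmax (fun j => \sum_k T l eps k j (x k))) <=
    E (F false) + E (F true).
  rewrite -(pmean_cmean p_sum1 i) -(pmean_cmean p_sum1 i (F false)) -(pmean_cmean p_sum1 i (F true)).
  rewrite /pmean -wsumZ -wsumD; apply: ler_wsum => // x.
  pose c j := \sum_(k | k != i) T l eps k j (x k).
  have Tc b j : \sum_(k | k != i) T (i :: l) (eb b) k j (x k) = c j.
    by apply: eq_bigr => k /negbTE ki; rewrite /T inE ki /eb ki.
  have := symmetrization_step j0 c (p_ge0 i) (p_sum1 i) L0 (hf i).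
  have -> : wsum (p i) (fun t => fmax (fun j => c j + (h i j t - wsum (p i) (h i j)))) =
      cmean p i (fun x => fmax (fun j => \sum_k T l eps k j (x k))) x.
    apply: eq_wsum => a; apply: eq_fmax => j; rewrite (sum_upd_split (T l eps)).
    by rewrite /T (negbTE il).
  have -> : wsum (p i) (fun t => fmax (fun j => c j + 2 * L * f i j t)) = cmean p i (F false) x.
    apply: eq_wsum => a; apply: eq_fmax => j; rewrite (sum_upd_split (T (i :: l) (eb false))) Tc.
    by rewrite /T inE eqxx /eb eqxx/= expr0 mul1r.
  have -> // : wsum (p i) (fun t => fmax (fun j => c j - 2 * L * f i j t)) = cmean p i (F true) x.
  apply: eq_wsum => a; apply: eq_fmax => j; rewrite (sum_upd_split (T (i :: l) (eb true))) Tc.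
  by rewrite /T inE eqxx /eb eqxx/= expr1 mulN1r.
have eps_irr e e' : E (fun x => fmax (fun j => \sum_i T [::] e i j (x i))) =
  E (fun x => fmax (fun j => \sum_i T [::] e' i j (x i))) by [].
have [h1|h1] := leP (E (fun x => fmax (fun j => \sum_k T l eps k j (x k)))) (E (F false)).
  by exists (eb false); rewrite (eps_irr _ eps); exact: le_trans h1.
exists (eb true); rewrite (eps_irr _ eps); apply: (le_trans He).
by rewrite -/(F true); lra.
Qed.

Definition zero_out (l : seq I) g i j a : R := if i \in l then 0 else g i j a.

(** Jensen's inequality: a centered coordinate can be restored without
    decreasing the mean. *)
Lemma pmean_zero_out g (l : seq I) : centered p g ->
  E (absSup j0 (zero_out l g)) <= E (absSup j0 g).
Proof.
move=> gc; elim: l => [|i l IH].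
  rewrite le_eqVlt; apply/orP; left; apply/eqP; apply: eq_wsum => x.
  by apply: eq_fmax => j.
apply: le_trans IH; rewrite -(pmean_cmean p_sum1 i (absSup j0 (zero_out l g))).
apply: ler_wsum => // x; apply: fmax_le => j.
set gl := zero_out l g.
have glc : wsum (p i) (gl i j) = 0.
  rewrite -[RHS](wsum_cst (p_sum1 i)) /gl /zero_out; case: (i \in l).
    by apply: eq_wsum.
  by rewrite wsum_cst//; exact: gc.
have -> : \sum_k zero_out (i :: l) g k j (x k) =
    wsum (p i) (fun a => \sum_k gl k j (upd x i a k)).
  under eq_wsum do rewrite (sum_upd_split gl).
  have glc' : wsum (p i) (fun a => gl i j a) = 0 by exact: glc.
  rewrite wsumD glc' addr0 wsum_cst// (bigD1 i)//= {1}/zero_out /= inE eqxx add0r.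
  by apply: eq_bigr => k ki; rewrite /gl /zero_out /= inE (negbTE ki).
have absE : `|wsum (p i) (fun a => \sum_k gl k j (upd x i a k))| <=
    wsum (p i) (fun a => `|\sum_k gl k j (upd x i a k)|).
  rewrite /wsum; apply: (le_trans (ler_norm_sum _ _ _)); apply: ler_sum => a _.
  by rewrite normrM (ger0_norm (p_ge0 i a)).
apply: (le_trans absE); apply: ler_wsum => // a.
exact: (le_fmax j0 (fun j => `|\sum_k gl k j (upd x i a k)|)).
Qed.

(** The positive and the negative signs each select a partial sum, and
    [pmean_zero_out] applies to both. *)
Lemma desymmetrization g (eps : I -> bool) (K : R) : 0 <= K -> centered p g ->
  E (fun x => fmax (fun j => \sum_i (-1) ^+ eps i * (K * g i j (x i)))) <=
  2 * K * E (absSup j0 g).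
Proof.
move=> K0 gc.
pose l0 := [seq i <- enum I | eps i]; pose l1 := [seq i <- enum I | ~~ eps i].
have e0 := pmean_zero_out l0 gc; have e1 := pmean_zero_out l1 gc.
apply: (@le_trans _ _ (K * (E (absSup j0 (zero_out l0 g)) +
                            E (absSup j0 (zero_out l1 g))))); last first.
  by have := ler_wpM2l K0 (lerD e0 e1); lra.
rewrite -wsumD -wsumZ; apply: ler_wsum => // x; apply: fmax_le => j.
have -> : \sum_i (-1) ^+ eps i * (K * g i j (x i)) =
    K * (\sum_i zero_out l0 g i j (x i) - \sum_i zero_out l1 g i j (x i)).
  rewrite -sumrB mulr_sumr; apply: eq_bigr => i _.
  have m0 : (i \in l0) = eps i by rewrite /l0 mem_filter mem_enum andbT.
  have m1 : (i \in l1) = ~~ eps i by rewrite /l1 mem_filter mem_enum andbT.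
  rewrite /zero_out m0 m1; case: (eps i) => /=.
    by rewrite expr1 sub0r mulN1r mulrN.
  by rewrite expr0 mul1r subr0.
rewrite ler_wpM2l//; apply: (le_trans (ler_norm _)); apply: (le_trans (ler_normB _ _)).
apply: lerD; [exact: (le_fmax j0 (fun j => `|\sum_i zero_out l0 g i j (x i)|))|].
exact: (le_fmax j0 (fun j => `|\sum_i zero_out l1 g i j (x i)|)).
Qed.

End discrete_symmetrization.

Section discrete_strong_variance.
Context {R : realType} {I A J : finType} (j0 : J) (p : I -> A -> R).
Hypotheses (p_ge0 : forall i a, 0 <= p i a) (p_sum1 : forall i, \sum_a p i a = 1).
Notation X := {ffun I -> A}.
Notation E := (pmean p).
Notation fmax := (fmax j0).
Implicit Types (f g h : I -> J -> A -> R) (x : X) (i : I) (j : J).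

Let w0 : forall x, 0 <= pwt p x. Proof. exact: pwt_ge0. Qed.
Let w1 : \sum_x pwt p x = 1. Proof. exact: pwt_sum1. Qed.

Definition exceed g (lam : R) i a : R :=
  if envelope j0 g i a <= lam then 0 else envelope j0 g i a ^+ 2.

Lemma exceed_ge0 g lam i a : 0 <= exceed g lam i a.
Proof. by rewrite /exceed; case: ifP => // _; exact: sqr_ge0. Qed.

(** The events that [i] is the only coordinate whose envelope exceeds [2 * m]
    are disjoint, so the corresponding squares sum to at most [maxAbs ^+ 2].
    By independence, asking the other coordinates not to exceed costs a factor
    of at least 3/4, by Chebyshev's inequality. *)
Lemma sum_exceed_le g (m : R) : 0 < m ->
  E (fun x => maxAbs j0 g x ^+ 2) <= m ^+ 2 ->
  \sum_i wsum (p i) (exceed g (2 * m) i) <= 4 / 3 * m ^+ 2.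
Proof.
move=> m0 HM; set lam := 2 * m; set M := maxAbs j0 g.
have lam0 : 0 < lam by rewrite /lam mulr_gt0.
pose H i x : R := [forall k, (k != i) ==> (envelope j0 g k (x k) <= lam)]%:R.
have Hi i : indep_of i (H i).
  move=> x a; congr (_ %:R); congr nat_of_bool; apply: eq_forallb => k.
  by case: eqVneq => //= ki; rewrite upd_other.
pose G x : R := (M x <= lam)%R%:R.
have GH i x : G x <= H i x.
  rewrite /G /H; have [Mx|_] := leP (M x) lam; last by rewrite ler0n.
  suff -> : [forall k, (k != i) ==> (envelope j0 g k (x k) <= lam)] by [].
  by apply/forallP => k; apply/implyP => _; exact: le_trans (le_maxAbs _ _ _ _) Mx.
have EG : 3 / 4 <= E G.
  have : E (fun x => 1 - G x) <= E (fun x => (lam ^+ 2)^-1 * M x ^+ 2).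
    apply: ler_wsum => // x; rewrite /G; have [Mx|Mx] := leP (M x) lam.
      by rewrite subrr mulr_ge0 ?invr_ge0 ?sqr_ge0.
    rewrite subr0 mulrC ler_pdivlMr ?exprn_gt0// mul1r.
    by rewrite lerXn2r ?nnegrE ?(ltW Mx) ?maxAbs_ge0 ?(ltW lam0).
  rewrite {1 2}/pmean wsumB wsum_cst// wsumZ => H1.
  have H2 : (lam ^+ 2)^-1 * E (fun x => M x ^+ 2) <= 1 / 4.
    rewrite mulrC ler_pdivrMr ?exprn_gt0//; apply: (le_trans HM).
    by rewrite /lam exprMn; lra.
  rewrite -/(E G) -/(E (fun x => M x ^+ 2)) in H1.
  by move: (E G) (_ * E _) H1 H2 => a b; lra.
have key x : \sum_i H i x * exceed g lam i (x i) <= M x ^+ 2.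
  have [/existsP[i Ui]|] := boolP [exists i, ~~ (envelope j0 g i (x i) <= lam)].
    rewrite (bigD1 i)//= big1 ?addr0 => [|k ki].
      have h1 : H i x <= 1 by rewrite /H; case: [forall _, _].
      apply: (le_trans (ler_wpM2r (exceed_ge0 _ _ _ _) h1)); rewrite mul1r.
      rewrite /exceed (negbTE Ui) lerXn2r ?nnegrE ?maxAbs_ge0 ?envelope_ge0//.
      exact: le_maxAbs.
    suff -> : H k x = 0 by rewrite mul0r.
    rewrite /H; suff -> : [forall k0, (k0 != k) ==> (envelope j0 g k0 (x k0) <= lam)] = false by [].
    by apply/forallP => /(_ i); rewrite eq_sym ki (negbTE Ui).
  rewrite negb_exists => /forallP U; rewrite big1 ?sqr_ge0// => i _.
  by rewrite /exceed; have := U i; rewrite negbK => ->; rewrite mulr0.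
have H1 : \sum_i E (fun x => H i x * exceed g lam i (x i)) <= m ^+ 2.
  by apply: le_trans HM; rewrite -wsum_sum; apply: ler_wsum.
have H2 i : 3 / 4 * wsum (p i) (exceed g lam i) <= E (fun x => H i x * exceed g lam i (x i)).
  rewrite (pmean_cmean_indepM p_sum1 _ (Hi i)).
  have -> : E (fun x => H i x * cmean p i (fun x => exceed g lam i (x i)) x) =
      E (H i) * wsum (p i) (exceed g lam i).
    rewrite -wsumZr; apply: eq_wsum => x; congr (_ * _).
    by apply: eq_wsum => a; rewrite upd_same.
  apply: ler_wpM2r; first by apply: wsum_ge0 => // a; exact: exceed_ge0.
  by apply: (le_trans EG); apply: ler_wsum.
have := le_trans (ler_sum _ (fun i _ => H2 i)) H1.
by rewrite -mulr_sumr; move: (\sum_i _) => a; lra.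
Qed.

(** Truncation at [2 * m]. Below this level [g ^+ 2] is a Lipschitz function
    of [g], and symmetrization followed by desymmetrization bounds the
    centered sums by a multiple of [m * pmean absSup]; the rest is
    [sum_exceed_le]. *)
Lemma strong_variance_le g (sig m : R) : 0 < m -> centered p g ->
  (forall j, \sum_i wsum (p i) (fun a => g i j a ^+ 2) <= sig ^+ 2) ->
  E (fun x => maxAbs j0 g x ^+ 2) <= m ^+ 2 ->
  E (fun x => rootSup j0 g x ^+ 2) <=
  sig ^+ 2 + 16 * m * E (absSup j0 g) + 4 / 3 * m ^+ 2.
Proof.
move=> m0 gc Hsig HM; set lam := 2 * m.
have lam0 : 0 <= lam by rewrite /lam mulr_ge0// ltW.
have lam2 : 0 <= 2 * lam by rewrite mulr_ge0.
pose h i j a := if envelope j0 g i a <= lam then g i j a ^+ 2 else 0.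
have hg i j a : h i j a <= g i j a ^+ 2 by rewrite /h; case: ifP => // _; exact: sqr_ge0.
have hlip i a j k : h i j a - h i k a <= 2 * lam * `|g i j a - g i k a|.
  rewrite /h; case: ifP => [U|_]; last by rewrite subrr mulr_ge0.
  have Uj := le_trans (le_envelope j0 g i j a) U.
  have Uk := le_trans (le_envelope j0 g i k a) U.
  rewrite subr_sqr mulrC; apply: (le_trans (ler_norm _)); rewrite normrM.
  apply: ler_wpM2r => //; apply: (le_trans (ler_normD _ _)).
  by have := lerD Uj Uk; lra.
have [eps Heps] := exists_signs j0 p_ge0 p_sum1 lam2 hlip.
have lam4 : 0 <= 2 * (2 * lam) by rewrite mulr_ge0.
have := le_trans Heps (desymmetrization j0 p_ge0 p_sum1 eps lam4 gc).
set F := (F in E F <= _) => HF.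
have Hexc := sum_exceed_le m0 HM.
have key x : rootSup j0 g x ^+ 2 <= F x + sig ^+ 2 + \sum_i exceed g lam i (x i).
  have [j jE] := fmaxP j0 (fun j => Num.sqrt (\sum_i g i j (x i) ^+ 2)).
  rewrite /rootSup jE sqr_sqrtr; last by rewrite sumr_ge0// => i _; exact: sqr_ge0.
  have Fj : \sum_i (h i j (x i) - wsum (p i) (h i j)) <= F x.
    exact: (le_fmax j0 (fun j => \sum_i (h i j (x i) - wsum (p i) (h i j)))).
  have Hh : \sum_i wsum (p i) (h i j) <= sig ^+ 2.
    by apply: le_trans (Hsig j); apply: ler_sum => i _; apply: ler_wsum.
  have : \sum_i g i j (x i) ^+ 2 <= \sum_i h i j (x i) + \sum_i exceed g lam i (x i).
    rewrite -big_split/=; apply: ler_sum => i _; rewrite /h /exceed.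
    case: ifP => _; first by rewrite addr0.
    rewrite add0r -[leLHS]real_normK ?num_real// lerXn2r ?nnegrE ?envelope_ge0//.
    exact: le_envelope.
  rewrite sumrB in Fj; move: (\sum_i _) (\sum_i _) (\sum_i _) (\sum_i _) Fj Hh => a b c d.
  lra.
apply: (le_trans (ler_wsum w0 key)); rewrite wsumD wsumD wsum_cst// wsum_sum.
have -> : \sum_i wsum (pwt p) (fun x => exceed g lam i (x i)) =
    \sum_i wsum (p i) (exceed g lam i).
  by apply: eq_bigr => i _; exact: (pmean_fst p_sum1 i (exceed g lam i)).
rewrite -/(E F) -/lam in Hexc *.
move: (E F) (E _) (\sum_i _) Hexc HF => a b c; rewrite /lam; lra.
Qed.

End discrete_strong_variance.

(** * The two inequalities on a finite product space *)

Section discrete_moment.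
Context {R : realType} {I A J : finType} (j0 : J) (p : I -> A -> R).
Hypotheses (p_ge0 : forall i a, 0 <= p i a) (p_sum1 : forall i, \sum_a p i a = 1).
Notation X := {ffun I -> A}.
Notation E := (pmean p).
Implicit Types (f g h : I -> J -> A -> R) (x : X) (i : I) (j : J).

Let w0 : forall x, 0 <= pwt p x. Proof. exact: pwt_ge0. Qed.
Let w1 : \sum_x pwt p x = 1. Proof. exact: pwt_sum1. Qed.

(** The inequality between arithmetic and geometric means turns the cross term
    [m * z] of the strong variance into [z + 16 * k * m] after multiplication
    by [c ^+ 2]. *)
Lemma rosenthal_arith (k c sig m z Sig : R) : 0 <= sig -> 0 <= c -> 0 <= m -> 0 <= z ->
  0 <= Sig -> 9 / 4 <= k -> c ^+ 2 = 2 * k ->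
  Sig ^+ 2 = sig ^+ 2 + 16 * m * z + 4 / 3 * m ^+ 2 ->
  z + c * (sig + Sig + c * (m + m)) <= 2 * z + 2 * sig * c + 20 * k * m.
Proof.
move=> sig0 c0 m0 z0 Sig0 k1 cE SigE.
have km : 0 <= k * m by rewrite mulr_ge0//; lra.
have cs : 0 <= c * sig by exact: mulr_ge0.
have B0 : 0 <= c * sig + z + 16 * (k * m).
  by rewrite !addr_ge0 ?mulr_ge0//; lra.
suff H : c * Sig <= c * sig + z + 16 * (k * m).
  have -> : c * (sig + Sig + c * (m + m)) = c * sig + c * Sig + c ^+ 2 * (2 * m) by ring.
  rewrite cE; lra.
rewrite -(@ler_pXn2r _ 2)// ?nnegrE ?mulr_ge0//.
rewrite exprMn SigE cE -subr_ge0.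
have -> : (c * sig + z + 16 * (k * m)) ^+ 2 -
    2 * k * (sig ^+ 2 + 16 * m * z + 4 / 3 * m ^+ 2) =
    (c ^+ 2 - 2 * k) * sig ^+ 2 + 2 * (c * sig) * z + z ^+ 2 +
    32 * (c * sig) * (k * m) + k * m * m * (256 * k - 8 / 3) by ring.
rewrite cE subrr mul0r add0r.
have k8 : 0 <= 256 * k - 8 / 3 by lra.
have t1 := mulr_ge0 cs z0.
have t2 := mulr_ge0 cs km.
have t3 := mulr_ge0 (mulr_ge0 km m0) k8.
have := sqr_ge0 z; clear - t1 t2 t3; lra.
Qed.

Lemma discrete_moment_gt0 (q sig m : R) g : 2 <= q -> 0 <= sig -> 0 < m ->
  centered p g ->
  (forall j, \sum_i wsum (p i) (fun a => g i j a ^+ 2) <= sig ^+ 2) ->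
  E (fun x => maxAbs j0 g x `^ q) <= m `^ q ->
  E (fun x => absSup j0 g x `^ q) <=
  (2 * E (absSup j0 g) + 2 * sig * Num.sqrt (2 * kappa R * q)
   + 20 * (kappa R * q) * m) `^ q.
Proof.
move=> q2 sig0 m0 gc Hsig HM; have K2 := @kappa_ge R.
have q1 : 1 <= q by lra.
have q0 : 0 <= q by lra.
have kq : 9 / 4 <= kappa R * q by nra.
set c := Num.sqrt _; have c0 : 0 <= c := sqrtr_ge0 _.
have cE : c ^+ 2 = 2 * (kappa R * q).
  by rewrite /c -mulrA sqr_sqrtr//; lra.
have z0 : 0 <= E (absSup j0 g) by apply: wsum_ge0 => // x; exact: absSup_ge0.
have HM2 : E (fun x => maxAbs j0 g x ^+ 2) <= m ^+ 2.
  have := wsum_lyapunov w0 w1 (ltr0Sn R 1) q2 (ltW m0) (maxAbs_ge0 j0 g) HM.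
  rewrite powR_mulrn ?(ltW m0)//; apply: le_trans; rewrite le_eqVlt.
  by apply/orP; left; apply/eqP/eq_wsum => x; rewrite powR_mulrn ?maxAbs_ge0.
have Hs i j : wsum (p i) (fun a => g i j a ^+ 2) <= m ^+ 2.
  apply: le_trans HM2; rewrite -(pmean_fst p_sum1 i (fun a => g i j a ^+ 2)).
  by apply: ler_wsum => // x; exact: sqr_le_maxAbs.
pose Sig := Num.sqrt (sig ^+ 2 + 16 * m * E (absSup j0 g) + 4 / 3 * m ^+ 2).
have SigE : Sig ^+ 2 = sig ^+ 2 + 16 * m * E (absSup j0 g) + 4 / 3 * m ^+ 2.
  rewrite sqr_sqrtr//; have := mulr_ge0 (ltW m0) z0.
  by have := sqr_ge0 sig; have := sqr_ge0 m; lra.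
have HSig := strong_variance_le p_ge0 p_sum1 m0 gc Hsig HM2.
rewrite -SigE in HSig.
have Sig0 : 0 <= Sig := sqrtr_ge0 _.
have := discrete_upper_tail p_ge0 p_sum1 q2 Sig0 sig0 (ltW m0) (ltW m0) gc HSig Hsig HM Hs.
rewrite -/c => HT.
have cb : 0 <= c * (sig + Sig + c * (m + m)).
  by rewrite mulr_ge0// !addr_ge0// mulr_ge0// addr_ge0// ltW.
have T := wsum_minkowski_cst w0 w1 q1 z0 cb (fun x => max0_ge0 _) HT.
apply: (@le_trans _ _ ((E (absSup j0 g) + c * (sig + Sig + c * (m + m))) `^ q)).
  apply: le_trans T; apply: ler_wsum => // x; apply: ge0_ler_powR => //; rewrite ?nnegrE.
  - exact: absSup_ge0.
  - by rewrite addr_ge0// max0_ge0.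
  by rewrite -lerBlDl le_max lexx.
have H := rosenthal_arith sig0 c0 (ltW m0) z0 Sig0 kq cE SigE.
have L0 : 0 <= E (absSup j0 g) + c * (sig + Sig + c * (m + m)) by exact: addr_ge0.
by apply: ge0_ler_powR => //; rewrite nnegrE//; exact: le_trans H.
Qed.

Lemma discrete_moment (q sig m : R) g : 2 <= q -> 0 <= sig -> 0 <= m ->
  centered p g ->
  (forall j, \sum_i wsum (p i) (fun a => g i j a ^+ 2) <= sig ^+ 2) ->
  E (fun x => maxAbs j0 g x `^ q) <= m `^ q ->
  E (fun x => absSup j0 g x `^ q) <=
  (2 * E (absSup j0 g) + 2 * sig * Num.sqrt (2 * kappa R * q)
   + 20 * (kappa R * q) * m) `^ q.
Proof.
move=> q2 sig0 m0 gc Hsig HM; have K2 := @kappa_ge R.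
have kq : 9 / 4 <= kappa R * q by nra.
have q0 : 0 < q by lra.
have z0 : 0 <= E (absSup j0 g) by apply: wsum_ge0 => // x; exact: absSup_ge0.
apply: ler_powR_closure => //.
- by apply: wsum_ge0 => // x; exact: powR_ge0.
- have kq0 : 0 <= 20 * (kappa R * q) by lra.
  apply: addr_ge0; last exact: mulr_ge0.
  by apply: addr_ge0; apply: mulr_ge0; rewrite ?sqrtr_ge0 ?mulr_ge0.
move=> e e0; set k := 20 * (kappa R * q); have k0 : 0 < k by rewrite /k; lra.
have mk : 0 < m + e / k by rewrite ltr_wpDl// divr_gt0.
have -> : 2 * E (absSup j0 g) + 2 * sig * Num.sqrt (2 * kappa R * q) + k * m + e =
  2 * E (absSup j0 g) + 2 * sig * Num.sqrt (2 * kappa R * q) + k * (m + e / k).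
  by field; rewrite gt_eqF.
apply: discrete_moment_gt0 => //; apply: (le_trans HM).
by rewrite ler_powR2// ?(ltW mk)// lerDl divr_ge0 ?(ltW k0)// ltW.
Qed.

End discrete_moment.

Section recentering.
Context {R : realType} {I A J : finType} (j0 : J) (p : I -> A -> R).
Hypotheses (p_ge0 : forall i a, 0 <= p i a) (p_sum1 : forall i, \sum_a p i a = 1).
Notation X := {ffun I -> A}.
Notation E := (pmean p).
Implicit Types (f g h : I -> J -> A -> R) (x : X) (i : I) (j : J).

Let w0 : forall x, 0 <= pwt p x. Proof. exact: pwt_ge0. Qed.
Let w1 : \sum_x pwt p x = 1. Proof. exact: pwt_sum1. Qed.

Definition recenter g i j a : R := g i j a - wsum (p i) (g i j).

Lemma recenter_centered g : centered p (recenter g).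
Proof.
by move=> i j; rewrite /recenter -[RHS](subrr (wsum (p i) (g i j))) wsumB wsum_cst.
Qed.

Lemma recenter_var g i j :
  wsum (p i) (fun a => recenter g i j a ^+ 2) <= wsum (p i) (fun a => g i j a ^+ 2).
Proof.
set mu := wsum (p i) (g i j).
have -> : wsum (p i) (fun a => recenter g i j a ^+ 2) =
    wsum (p i) (fun a => g i j a ^+ 2 + (- (2 * mu) * g i j a + mu ^+ 2)).
  by apply: eq_wsum => a; rewrite /recenter -/mu; ring.
rewrite wsumD wsumD wsum_cst// (wsumZ (p i) (- (2 * mu)) (g i j)) -/mu.
by rewrite gerDl -subr_ge0; have := sqr_ge0 mu; lra.
Qed.

Lemma absSup_close g g' (d : R) x : (forall i j a, `|g i j a - g' i j a| <= d) ->
  absSup j0 g x <= absSup j0 g' x + #|I|%:R * d.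
Proof.
move=> gg'; apply: fmax_le => j.
have -> : \sum_i g i j (x i) = \sum_i g' i j (x i) + \sum_i (g i j (x i) - g' i j (x i)).
  by rewrite -big_split/=; apply: eq_bigr => i _; rewrite addrC subrK.
apply: (le_trans (ler_normD _ _)); apply: lerD.
  exact: (le_fmax j0 (fun j => `|\sum_i g' i j (x i)|)).
apply: (le_trans (ler_norm_sum _ _ _)).
apply: (le_trans (ler_sum _ (fun i _ => gg' i j (x i)))).
by rewrite sumr_const mulr_natl.
Qed.

Lemma rootSup_close g g' (d : R) x : 0 <= d -> (forall i j a, `|g i j a - g' i j a| <= d) ->
  rootSup j0 g x <= #|I|%:R * d + rootSup j0 g' x.
Proof.
move=> d0 gg'; apply: fmax_le => j.
set T := Num.sqrt (\sum_i g' i j (x i) ^+ 2).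
have T0 : 0 <= T := sqrtr_ge0 _.
have TS : T <= rootSup j0 g' x.
  exact: (le_fmax j0 (fun j => Num.sqrt (\sum_i g' i j (x i) ^+ 2))).
apply: (@le_trans _ _ (#|I|%:R * d + T)); last by rewrite lerD2l.
have nd : 0 <= #|I|%:R * d by rewrite mulr_ge0.
rewrite -[leRHS]ger0_norm ?addr_ge0// -sqrtr_sqr ler_wsqrtr//.
have T2 : \sum_i g' i j (x i) ^+ 2 = T ^+ 2.
  by rewrite sqr_sqrtr// sumr_ge0// => i _; exact: sqr_ge0.
have gT i : `|g' i j (x i)| <= T.
  rewrite -sqrtr_sqr ler_wsqrtr// (bigD1 i)//= lerDl sumr_ge0// => k _.
  exact: sqr_ge0.
apply: (@le_trans _ _ (\sum_i (g' i j (x i) ^+ 2 + (2 * d * T + d ^+ 2)))).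
  apply: ler_sum => i _.
  have := gg' i j (x i); set u := g i j (x i); set v := g' i j (x i) => uv.
  have vT := gT i; rewrite -/v in vT.
  have uE : `|u| <= `|v| + d.
    by rewrite -{1}(subrK v u) addrC; apply: (le_trans (ler_normD _ _)); rewrite lerD2l.
  rewrite -[u ^+ 2]real_normK ?num_real// -[v ^+ 2]real_normK ?num_real//.
  apply: (@le_trans _ _ ((`|v| + d) ^+ 2)).
    by rewrite lerXn2r ?nnegrE// addr_ge0.
  by have := ler_wpM2l d0 vT; move: (`|v|) => v'; lra.
rewrite big_split/= T2.
have -> : \sum_(i : I) (2 * d * T + d ^+ 2) = #|I|%:R * (2 * d * T + d ^+ 2).
  by rewrite sumr_const [RHS]mulr_natl.
have [n0|n1] := posnP #|I|; first by rewrite n0 !mul0r add0r addr0.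
have {}n1 : 1 <= #|I|%:R :> R by rewrite ler1n.
move: (#|I|%:R : R) n1 => n n1.
have : n * d ^+ 2 <= n ^+ 2 * d ^+ 2.
  by rewrite ler_wpM2r ?sqr_ge0// expr2 ler_peMl//; lra.
lra.
Qed.

Lemma maxAbs_close g g' (d : R) x : 0 <= d -> (forall i j a, `|g i j a - g' i j a| <= d) ->
  maxAbs j0 g x <= d + maxAbs j0 g' x.
Proof.
move=> d0 gg'; apply: bigmax_le; first by rewrite addr_ge0// maxAbs_ge0.
move=> i _; apply: fmax_le => j.
rewrite -(subrK (g' i j (x i)) (g i j (x i))).
apply: (le_trans (ler_normD _ _)); apply: lerD => //.
exact: le_trans (le_envelope j0 g' i j (x i)) (le_maxAbs j0 g' x i).
Qed.

Lemma pmean_sqr_cst (Y : X -> R) (b c : R) : 0 <= b -> 0 <= c -> (forall x, 0 <= Y x) ->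
  E (fun x => Y x ^+ 2) <= b ^+ 2 -> E (fun x => (c + Y x) ^+ 2) <= (c + b) ^+ 2.
Proof.
move=> b0 c0 Y0 H; have EY := pmean_le_sqr p_ge0 p_sum1 b0 Y0 H.
have -> : E (fun x => (c + Y x) ^+ 2) = c ^+ 2 + (2 * c * E Y + E (fun x => Y x ^+ 2)).
  rewrite -(wsum_cst w1 (c ^+ 2)) /pmean -wsumZ -!wsumD.
  by apply: eq_wsum => x; ring.
have := ler_wpM2l c0 EY; move: (E Y) (E _) H => a a'; lra.
Qed.

End recentering.

Section nearly_centered.
Context {R : realType} {I A J : finType} (j0 : J) (p : I -> A -> R).
Hypotheses (p_ge0 : forall i a, 0 <= p i a) (p_sum1 : forall i, \sum_a p i a = 1).
Notation X := {ffun I -> A}.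
Notation E := (pmean p).
Notation N := (#|I|%:R).
Implicit Types (g : I -> J -> A -> R) (x : X) (i : I) (j : J) (q d : R).

Let w0 : forall x, 0 <= pwt p x. Proof. exact: pwt_ge0. Qed.
Let w1 : \sum_x pwt p x = 1. Proof. exact: pwt_sum1. Qed.

(** Quantized values lose the exact centering; [d] measures the loss. *)
Definition nearly_centered d g := forall i j, `|wsum (p i) (g i j)| <= d.

Lemma recenter_close g d : nearly_centered d g ->
  forall i j a, `|recenter p g i j a - g i j a| <= d.
Proof. by move=> gd i j a; rewrite /recenter addrAC subrr add0r normrN. Qed.

Lemma close_recenter g d : nearly_centered d g ->
  forall i j a, `|g i j a - recenter p g i j a| <= d.
Proof. by move=> gd i j a; rewrite distrC; exact: recenter_close. Qed.

Lemma recenter_maxAbs g d q m : 2 <= q -> 0 <= d -> 0 <= m -> nearly_centered d g ->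
  E (fun x => maxAbs j0 g x `^ q) <= m `^ q ->
  E (fun x => maxAbs j0 (recenter p g) x `^ q) <= (d + m) `^ q.
Proof.
move=> q2 d0 m0 gd HM; have q1 : 1 <= q by lra.
have q0 : 0 <= q by lra.
apply: le_trans (wsum_minkowski_cst w0 w1 q1 d0 m0 (maxAbs_ge0 j0 g) HM).
apply: ler_wsum => // x; apply: ge0_ler_powR => //; rewrite ?nnegrE ?addr_ge0 ?maxAbs_ge0//.
exact: maxAbs_close d0 (recenter_close gd).
Qed.

(** Recentering changes [absSup] and [rootSup] by at most [N * d] and [maxAbs]
    by at most [d], and does not increase the variances. *)
Lemma nearly_centered_upper_tail g d (q Sig sig Mq s : R) : 2 <= q -> 0 <= d ->
  0 <= Sig -> 0 <= sig -> 0 <= Mq -> 0 <= s -> nearly_centered d g ->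
  E (fun x => rootSup j0 g x ^+ 2) <= Sig ^+ 2 ->
  (forall j, \sum_i wsum (p i) (fun a => g i j a ^+ 2) <= sig ^+ 2) ->
  E (fun x => maxAbs j0 g x `^ q) <= Mq `^ q ->
  (forall i j, wsum (p i) (fun a => g i j a ^+ 2) <= s ^+ 2) ->
  forall c, c = Num.sqrt (2 * kappa R * q) ->
  E (fun x => Num.max (absSup j0 g x - E (absSup j0 g)) 0 `^ q) <=
  (c * (sig + Sig + c * (s + Mq)) + (c * (N + c) + 2 * N) * d) `^ q.
Proof.
move=> q2 d0 Sig0 sig0 Mq0 s0 gd HS Hsig HM Hs c cE.
have q1 : 1 <= q by lra.
have q0 : 0 <= q by lra.
have c0 : 0 <= c by rewrite cE sqrtr_ge0.
set h := recenter p g.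
have Nd0 : 0 <= N * d by rewrite mulr_ge0.
have HS' : E (fun x => rootSup j0 h x ^+ 2) <= (N * d + Sig) ^+ 2.
  apply: le_trans (pmean_sqr_cst p_ge0 p_sum1 Sig0 Nd0 (rootSup_ge0 j0 g) HS).
  apply: ler_wsum => // x; apply: lerXn2r; rewrite ?nnegrE ?addr_ge0 ?rootSup_ge0//.
  exact: rootSup_close d0 (recenter_close gd).
have Hsig' j : \sum_i wsum (p i) (fun a => h i j a ^+ 2) <= sig ^+ 2.
  by apply: le_trans (Hsig j); apply: ler_sum => i _; exact: recenter_var.
have HM' := recenter_maxAbs q2 d0 Mq0 gd HM.
have Hs' i j : wsum (p i) (fun a => h i j a ^+ 2) <= s ^+ 2.
  by apply: le_trans (Hs i j); exact: recenter_var.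
have NS0 : 0 <= N * d + Sig by exact: addr_ge0.
have dM0 : 0 <= d + Mq by exact: addr_ge0.
have := discrete_upper_tail p_ge0 p_sum1 q2 NS0 sig0 dM0 s0 (recenter_centered p_sum1 g)
  HS' Hsig' HM' Hs'.
rewrite -/h -cE; set b := c * _ => H.
have b0 : 0 <= b by rewrite /b mulr_ge0// !addr_ge0// mulr_ge0// addr_ge0.
have Nd2 : 0 <= 2 * (N * d) by rewrite mulr_ge0.
have T := wsum_minkowski_cst w0 w1 q1 Nd2 b0 (fun x => max0_ge0 _) H.
have -> : c * (sig + Sig + c * (s + Mq)) + (c * (N + c) + 2 * N) * d = 2 * (N * d) + b.
  by rewrite /b; ring.
apply: le_trans T; apply: ler_wsum => // x; apply: ge0_ler_powR => //; rewrite ?nnegrE.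
- exact: max0_ge0.
- by rewrite addr_ge0// max0_ge0.
rewrite ge_max [X in _ && X]addr_ge0 ?max0_ge0// andbT.
have A1 := absSup_close j0 x (close_recenter gd).
have A2 : E (absSup j0 h) <= E (absSup j0 g) + N * d.
  rewrite -(wsum_cst w1 (N * d)) -wsumD; apply: ler_wsum => // y.
  exact: absSup_close (recenter_close gd).
have : absSup j0 h x - E (absSup j0 h) <= Num.max (absSup j0 h x - E (absSup j0 h)) 0.
  by rewrite le_max lexx.
rewrite -/h in A1.
clear - A1 A2; lra.
Qed.

Lemma nearly_centered_moment g d (q sig m : R) : 2 <= q -> 0 <= d ->
  0 <= sig -> 0 <= m -> nearly_centered d g ->
  (forall j, \sum_i wsum (p i) (fun a => g i j a ^+ 2) <= sig ^+ 2) ->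
  E (fun x => maxAbs j0 g x `^ q) <= m `^ q ->
  forall c, c = Num.sqrt (2 * kappa R * q) ->
  E (fun x => absSup j0 g x `^ q) <=
  (2 * E (absSup j0 g) + 2 * sig * c + 20 * (kappa R * q) * m +
   (3 * N + 20 * (kappa R * q)) * d) `^ q.
Proof.
move=> q2 d0 sig0 m0 gd Hsig HM c cE; have K2 := @kappa_ge R.
have kq : 9 / 4 <= kappa R * q by nra.
have q1 : 1 <= q by lra.
have q0 : 0 <= q by lra.
have c0 : 0 <= c by rewrite cE sqrtr_ge0.
set h := recenter p g.
have Nd0 : 0 <= N * d by rewrite mulr_ge0.
have Hsig' j : \sum_i wsum (p i) (fun a => h i j a ^+ 2) <= sig ^+ 2.
  by apply: le_trans (Hsig j); apply: ler_sum => i _; exact: recenter_var.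
have HM' := recenter_maxAbs q2 d0 m0 gd HM.
have dm0 : 0 <= d + m by exact: addr_ge0.
have := discrete_moment p_ge0 p_sum1 q2 sig0 dm0 (recenter_centered p_sum1 g) Hsig' HM'.
rewrite -/h -cE; set b := _ + _ + _ => H.
have z0 : 0 <= E (absSup j0 h) by apply: wsum_ge0 => // x; exact: absSup_ge0.
have k20 : 0 <= 20 * (kappa R * q) by lra.
have b0 : 0 <= b.
  apply: addr_ge0; last exact: mulr_ge0.
  by apply: addr_ge0; apply: mulr_ge0; rewrite ?mulr_ge0.
have T := wsum_minkowski_cst w0 w1 q1 Nd0 b0 (absSup_ge0 j0 h) H.
apply: (@le_trans _ _ ((N * d + b) `^ q)).
  apply: le_trans T; apply: ler_wsum => // x; apply: ge0_ler_powR => //; rewrite ?nnegrE.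
  - exact: absSup_ge0.
  - by rewrite addr_ge0// absSup_ge0.
  by rewrite addrC; exact: absSup_close (close_recenter gd).
have A2 : E (absSup j0 h) <= E (absSup j0 g) + N * d.
  rewrite -(wsum_cst w1 (N * d)) -wsumD; apply: ler_wsum => // y.
  exact: absSup_close (recenter_close gd).
have bE : N * d + b <= 2 * E (absSup j0 g) + 2 * sig * c + 20 * (kappa R * q) * m +
    (3 * N + 20 * (kappa R * q)) * d.
  rewrite /b; move: (E _) (E _) A2 => a a' A2; lra.
apply: ge0_ler_powR => //; rewrite ?nnegrE; first exact: addr_ge0.
by apply: le_trans bE; exact: addr_ge0.
Qed.

End nearly_centered.

(** * Independent codes with finitely many values *)

Section finite_valued.
Local Open Scope ereal_scope.
Context d (T : measurableType d) (R : realType) (P : probability T R).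
Context (B : finType) (C : T -> B).
Hypothesis mC : forall b, measurable (C @^-1` [set b]).
Implicit Types (h : B -> R).

Lemma finite_valuedE h t :
  (h (C t))%:E = \sum_b (h b)%:E * (\1_(C @^-1` [set b]) t)%:E.
Proof.
rewrite (bigD1 (C t))//= indicE mem_set// mule1 big1 ?adde0// => b bC.
rewrite indicE memNset ?mule0//= => Cb; move: bC; rewrite Cb.
by rewrite eqxx.
Qed.

Lemma integrable_finite_valued h : P.-integrable setT (fun t => (h (C t))%:E).
Proof.
under eq_fun do rewrite finite_valuedE.
by apply: integrable_sum => // b _; apply: integrableZl => //; exact: integrable_indic.
Qed.

Lemma measurable_finite_valued h : measurable_fun setT (fun t => h (C t)).
Proof. by apply/measurable_EFinP; case/integrableP: (integrable_finite_valued h). Qed.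

Lemma integral_finite_valued h :
  \int[P]_t (h (C t))%:E = (wsum (fun b => fine (P (C @^-1` [set b]))) h)%:E.
Proof.
under eq_integral do rewrite finite_valuedE.
rewrite integral_sum// => [|b]; last first.
  by apply: integrableZl => //; exact: integrable_indic.
rewrite -sumEFin; apply: eq_bigr => b _.
rewrite integralZl//; last exact: integrable_indic.
by rewrite integral_indic// setIT EFinM fineK ?fin_num_measure// muleC.
Qed.

Lemma finite_valued_sum1 : (\sum_b fine (P (C @^-1` [set b])) = 1)%R.
Proof.
have := integral_finite_valued (fun=> 1%R).
rewrite integral_cst//= probability_setT mule1 => -[->].
by apply: eq_bigr => b _; rewrite mulr1.
Qed.

End finite_valued.

Section independent_codes.
Local Open Scope ereal_scope.
Context d dS (T : measurableType d) (S : measurableType dS) (R : realType).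
Variables (P : probability T R) (n : nat) (X : 'I_n -> {RV P >-> S}).
Hypothesis X_indep : mutually_independent X.
Context (A : finType) (code : 'I_n -> S -> A).
Hypothesis mcode : forall i a, measurable (code i @^-1` [set a]).

Definition law i a : R := fine (P (X i @^-1` (code i @^-1` [set a]))).
Definition coded t : {ffun 'I_n -> A} := [ffun i => code i (X i t)].

Let mX i a : measurable (X i @^-1` (code i @^-1` [set a])).
Proof. by rewrite -[X in measurable X]setTI; exact: measurable_funP. Qed.

Lemma law_ge0 i a : (0 <= law i a)%R.
Proof. exact: fine_ge0. Qed.

Lemma law_sum1 i : (\sum_a law i a = 1)%R.
Proof. exact: (finite_valued_sum1 P (C := fun t => code i (X i t)) (mX i)). Qed.

Lemma integral_law i (h : A -> R) :
  \int[P]_t (h (code i (X i t)))%:E = (wsum (law i) h)%:E.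
Proof. exact: (integral_finite_valued P (C := fun t => code i (X i t)) (mX i)). Qed.

Let coded_fiber x : coded @^-1` [set x] =
  \bigcap_(i in [set` [set: 'I_n]%SET]) (X i @^-1` (code i @^-1` [set x i])).
Proof.
apply/seteqP; split => [t /= <- i _ /=|t /= H]; first by rewrite ffunE.
by apply/ffunP => i; rewrite ffunE; apply: H => /=; rewrite inE.
Qed.

Lemma measurable_coded x : measurable (coded @^-1` [set x]).
Proof.
rewrite coded_fiber; apply: fin_bigcap_measurable => //; exact: finite_finset.
Qed.

(** Independence enters here only: the joint law of the codes is the product
    of their laws. *)
Lemma integral_coded (h : {ffun 'I_n -> A} -> R) :
  \int[P]_t (h (coded t))%:E = (pmean law h)%:E.
Proof.
rewrite integral_finite_valued; last exact: measurable_coded.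
congr _%:E; apply: eq_bigr => x _; congr (_ * _)%R.
rewrite coded_fiber X_indep; last by move=> i _; exact: mcode.
rewrite /pwt -[RHS]/(fine (_%:E)) -prodEFin; congr fine.
rewrite big_mkcond/=; apply: eq_bigr => i _; rewrite inE.
by rewrite /law fineK// fin_num_measure.
Qed.

End independent_codes.

(** * Quantization of the real line *)

Section quantization.
Context {R : realType}.
Implicit Types (k : nat) (x : R).

Definition quantize k x : bool * 'I_(k.+1 * k.+1).+1 :=
  (x < 0, inord (Num.truncn (`|x| * k.+1%:R))).

Definition qval k (a : bool * 'I_(k.+1 * k.+1).+1) : R :=
  (-1) ^+ a.1 * (a.2%:R / k.+1%:R).

(** Rounding towards zero to a multiple of [1 / (k + 1)]: the absolute value
    never increases, which keeps every bound on the class valid. Values too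
    large for the grid are sent to 0 by [inord]. *)
Definition quant k x : R := qval (quantize k x).

Lemma inord_le (N m : nat) : (@inord N m <= m)%N.
Proof.
have [mN|mN] := ltnP m N.+1; first by rewrite inordK.
by rewrite /inord /insubd insubF//= ltnNge mN.
Qed.

Lemma normr_quant k x :
  `|quant k x| = (@inord (k.+1 * k.+1) (Num.truncn (`|x| * k.+1%:R)))%:R / k.+1%:R.
Proof. by rewrite /quant /qval normrM normr_sign mul1r ger0_norm. Qed.

Lemma normr_quant_le k x : `|quant k x| <= `|x|.
Proof.
rewrite normr_quant ler_pdivrMr ?ltr0n//.
have y0 : 0 <= `|x| * k.+1%:R by rewrite mulr_ge0.
have /andP[+ _] := truncn_itv y0; apply: le_trans.
by rewrite ler_nat inord_le.
Qed.

Lemma quant_dist k x : `|x| <= k%:R -> `|x - quant k x| <= k.+1%:R^-1.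
Proof.
move=> xk; rewrite {1}(realEsign (num_real x)) /quant /qval -mulrBr normrM normr_sign mul1r.
have y0 : 0 <= `|x| * k.+1%:R by rewrite mulr_ge0.
have /andP[l1 l2] := truncn_itv y0.
have K0 : (0 : R) < k.+1%:R by rewrite ltr0n.
rewrite inordK; last first.
  rewrite ltnS -(ler_nat R); apply: (le_trans l1).
  rewrite natrM ler_wpM2r//; apply: (le_trans xk); by rewrite ler_nat.
rewrite -[X in X - _](mulfK (lt0r_neq0 K0)) -mulrBl normrM [X in _ * X]ger0_norm ?invr_ge0//.
rewrite ler_piMl ?invr_ge0// ger0_norm ?subr_ge0//.
by rewrite lerBlDr (le_trans (ltW l2))// -natr1 addrC.
Qed.

Lemma cvg_quant x : quant k x @[k --> \oo] --> x.
Proof.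
apply/cvgrPdist_le => e e0; near=> k.
apply: (@le_trans _ _ k.+1%:R^-1).
  by apply: quant_dist; near: k; exact: nbhs_infty_ger.
rewrite invf_ple ?posrE ?ltr0n//.
apply: (@le_trans _ _ k%:R); last by rewrite ler_nat.
by near: k; exact: nbhs_infty_ger.
Unshelve. all: by end_near. Qed.

Lemma measurable_quantize k a : measurable (quantize k @^-1` [set a]).
Proof.
have -> : quantize k @^-1` [set a] =
    ((fun x => x < 0) @^-1` [set a.1]) `&`
    \bigcup_(m in [set m | inord m = a.2]) [set x : R | m%:R <= `|x| * k.+1%:R < m.+1%:R].
  apply/seteqP; split => [x /= <-|x /= [xa [m /= ma] /truncn_def mE]].
    split => //; exists (Num.truncn (`|x| * k.+1%:R)) => //=.
    by apply: truncn_itv; rewrite mulr_ge0.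
  by rewrite /quantize mE ma xa; case: (a).
apply: measurableI.
  rewrite -[X in measurable X]setTI; apply: measurable_fun_ltr => //.
apply: bigcup_measurable => m _.
rewrite [X in measurable X](_ : _ = (fun x : R => (m%:R <= `|x| * k.+1%:R) &&
  (`|x| * k.+1%:R < m.+1%:R)) @^-1` [set true]); last by apply/seteqP; split.
have mx : measurable_fun [set: R] (fun x : R => `|x| * k.+1%:R).
  by apply: measurable_funM => //; exact: measurableT_comp.
rewrite -[X in measurable X]setTI.
apply: measurable_and => //; [exact: measurable_fun_ler|exact: measurable_fun_ltr].
Qed.

End quantization.

(** * Limits *)

Section powR_limits.
Context {R : realType}.

Lemma cvg_powR (v : R^nat) (l q : R) : 0 < q -> (forall k, 0 <= v k) ->
  v k @[k --> \oo] --> l -> v k `^ q @[k --> \oo] --> l `^ q.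
Proof.
move=> q0 v0 vl.
have l0 : 0 <= l.
  rewrite -(cvg_lim (@Rhausdorff R) vl); apply: limr_ge; first exact: cvgP vl.
  by apply: nearW => k; exact: v0.
move: l0; rewrite le_eqVlt => /predU1P[lE|l0].
  rewrite -lE in vl *; rewrite powR0 ?gt_eqF//.
  apply/cvgrPdist_le => e e0; near=> k.
  rewrite sub0r normrN ger0_norm ?powR_ge0//.
  have -> : e = (e `^ q^-1) `^ q by rewrite -powRrM mulVf ?gt_eqF// powRr1// ltW.
  rewrite ler_powR2 ?powR_ge0//.
  have : `|0 - v k| <= e `^ q^-1.
    near: k; move/cvgrPdist_le : vl; apply; exact: powR_gt0.
  by rewrite sub0r normrN ger0_norm.
have cq : {for l, continuous (@powR R ^~ q)}.
  apply/differentiable_continuous; rewrite -derivable1_diffP.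
  by apply: derivable_powR; rewrite in_itv/= l0.
exact: (@cvg_comp _ _ _ v (@powR R ^~ q) _ _ _ vl cq).
Unshelve. all: by end_near. Qed.

Local Open Scope ereal_scope.

(** Moment bounds pass to pointwise limits. *)
Lemma fatou_powR d (T : measurableType d) (mu : {measure set T -> \bar R})
    (u : nat -> T -> R) (v : T -> R) (b : R^nat) (l q : R) : (0 < q)%R ->
  (forall k, measurable_fun setT (u k)) -> (forall k t, 0 <= u k t)%R ->
  (forall k, 0 <= b k)%R ->
  (forall t, u k t @[k --> \oo] --> v t) -> b k @[k --> \oo] --> l ->
  (forall k, \int[mu]_t (u k t `^ q)%:E <= (b k `^ q)%:E) ->
  \int[mu]_t (v t `^ q)%:E <= (l `^ q)%:E.
Proof.
move=> q0 mu_ u0 b0 uv bl H.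
have -> : \int[mu]_t (v t `^ q)%:E =
    \int[mu]_t limn_einf (fun k => (u k t `^ q)%:E).
  apply: eq_integral => t _; apply/esym.
  have /cvg_limn_einf_sup [-> _] // : (u k t `^ q)%:E @[k --> \oo] --> (v t `^ q)%:E.
  by apply: cvg_EFin; [exact: nearW|exact: cvg_powR].
apply: (le_trans (@fatou _ _ _ mu _ measurableT (fun k t => (u k t `^ q)%:E) _ _)) => [k|k t _|].
- by apply/measurable_EFinP; apply: (measurableT_comp (measurable_powR _)).
- by rewrite lee_fin powR_ge0.
have bq : (b k `^ q)%:E @[k --> \oo] --> (l `^ q)%:E.
  by apply: cvg_EFin; [exact: nearW|exact: cvg_powR].
have [<- _] := cvg_limn_einf_sup bq.
rewrite !limn_einf_lim; apply: lee_lim; [exact: is_cvg_einfs|exact: is_cvg_einfs|].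
apply: nearW => k; apply: le_ereal_inf_tmp => _ [m /= km <-].
apply: le_trans (H m); apply: ereal_inf_lbound; exists m => //.
Qed.

Lemma dominated_cvg_fine d (T : measurableType d) (mu : {measure set T -> \bar R})
    (u : nat -> T -> R) (v G : T -> R) (a : R^nat) :
  (forall k, measurable_fun setT (u k)) -> measurable_fun setT v ->
  (forall t, u k t @[k --> \oo] --> v t) ->
  mu.-integrable setT (EFin \o G) -> (forall k t, `|u k t| <= G t)%R ->
  (forall k, \int[mu]_t (u k t)%:E = (a k)%:E) ->
  a k @[k --> \oo] --> fine (\int[mu]_t (v t)%:E).
Proof.
move=> mu_ mv uv iG uG ua.
have mu' k : measurable_fun setT (fun t => (u k t)%:E) by apply/measurable_EFinP.
have mv' : measurable_fun setT (fun t => (v t)%:E) by apply/measurable_EFinP.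
have uv' : {ae mu, forall t, setT t -> (u k t)%:E @[k --> \oo] --> (v t)%:E}.
  by apply: aeW => t _; apply: cvg_EFin; [exact: nearW|exact: uv].
have uG' : {ae mu, forall t k, setT t -> `|(u k t)%:E| <= (EFin \o G) t}.
  by apply: aeW => t k _; rewrite /= lee_fin.
have [iv _ H] := dominated_convergence measurableT mu' mv' uv' iG uG'.
have ifin : \int[mu]_t (v t)%:E \is a fin_num by exact: integrable_fin_num.
rewrite -(fineK ifin) in H; have H' := fine_cvg H.
have aE : a = fine \o (fun k => \int[mu]_t (u k t)%:E) by apply/funext => k /=; rewrite ua.
by rewrite aE; exact: H'.
Qed.

Local Close Scope ereal_scope.

Lemma cvg_finite_sum (I : finType) (u : I -> R^nat) (l : I -> R) :
  (forall i, u i k @[k --> \oo] --> l i) ->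
  \sum_i u i k @[k --> \oo] --> \sum_i l i.
Proof.
by move=> ul; apply: cvg_big => [x|i _]; [exact: add_continuous|exact: ul].
Qed.

End powR_limits.

Section measurable_fmax.
Context d (T : measurableType d) (R : realType) (J : finType) (j0 : J).

Lemma fmaxE (c : J -> R) : fmax j0 c = \big[Num.max/c j0]_j c j.
Proof.
apply/eqP; rewrite eq_le; apply/andP; split.
  by apply: fmax_le => j; apply: (le_bigmax _ c).
by apply: bigmax_le => [|j _]; exact: le_fmax.
Qed.

Lemma measurable_bigmax (I : Type) (l : seq I) (h0 : T -> R) (h : I -> T -> R) :
  measurable_fun setT h0 -> (forall i, measurable_fun setT (h i)) ->
  measurable_fun setT (fun t => \big[Num.max/h0 t]_(i <- l) h i t).
Proof.
move=> m0 mh; elim: l => [|i l IH].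
  by under eq_fun do rewrite big_nil.
under eq_fun do rewrite big_cons; exact: measurable_maxr.
Qed.

Lemma measurable_fmax (h : J -> T -> R) : (forall j, measurable_fun setT (h j)) ->
  measurable_fun setT (fun t => fmax j0 (h ^~ t)).
Proof. by move=> mh; under eq_fun do rewrite fmaxE; exact: measurable_bigmax. Qed.

Lemma fmax_dist (c c' : J -> R) : `|fmax j0 c - fmax j0 c'| <= \sum_j `|c j - c' j|.
Proof.
wlog H : c c' / fmax j0 c' <= fmax j0 c.
  move=> H; have [h|/ltW h] := leP (fmax j0 c') (fmax j0 c); first exact: H.
  by rewrite distrC; under eq_bigr do rewrite distrC; exact: H.
rewrite ger0_norm ?subr_ge0//; have [j ->] := fmaxP j0 c.
rewrite (bigD1 j)//= lerBlDr; apply: (@le_trans _ _ (`|c j - c' j| + c' j)).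
  by rewrite -lerBlDr ler_norm.
rewrite lerD ?le_fmax// lerDl; apply: sumr_ge0 => k _; exact: normr_ge0.
Qed.

End measurable_fmax.

Section cvg_fmax.
Context {R : realType} {J : finType} (j0 : J).

Lemma cvg_fmax (c : nat -> J -> R) (l : J -> R) :
  (forall j, c k j @[k --> \oo] --> l j) ->
  fmax j0 (c k) @[k --> \oo] --> fmax j0 l.
Proof.
move=> cl; apply/cvgrPdist_le => e e0.
have : \sum_j `|l j - c k j| @[k --> \oo] --> \sum_(j : J) (0 : R).
  apply: cvg_finite_sum => j; rewrite -(@normr0 _ R) -(subrr (l j)).
  by apply: cvg_norm; apply: cvgB; [exact: cvg_cst|exact: cl].
rewrite big1// => /cvgrPdist_le /(_ _ e0); apply: filterS => k.
rewrite sub0r normrN; apply: le_trans; apply: (le_trans (fmax_dist _ _ _)).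
exact: ler_norm.
Qed.

End cvg_fmax.

Lemma cvg_max0 {R : realType} (u : R^nat) (l : R) :
  u k @[k --> \oo] --> l -> Num.max (u k) 0 @[k --> \oo] --> Num.max l 0.
Proof.
move=> ul; rewrite [X in _ --> X]maxr_absE; under eq_cvg do rewrite maxr_absE.
apply: cvgM; last exact: cvg_cst.
apply: cvgD; first by apply: cvgD; [exact: ul|exact: cvg_cst].
by apply: cvg_norm; apply: cvgB; [exact: ul|exact: cvg_cst].
Qed.

(** * Finite classes on a general probability space *)

Section finite_class.
Local Open Scope ereal_scope.
Context d dS (T : measurableType d) (S : measurableType dS) (R : realType).
Variables (P : probability T R) (n : nat) (X : 'I_n -> {RV P >-> S}).
Hypothesis X_indep : mutually_independent X.
Context (J : finType) (j0 : J) (f : J -> S -> R).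
Hypothesis mf : forall j, measurable_fun setT (f j).
Hypothesis f_int : forall i j, P.-integrable setT (fun t => (f j (X i t))%:E).
Hypothesis f_centered : forall i j, \int[P]_t (f j (X i t))%:E = 0.

Definition classAbs t : R := fmax j0 (fun j => `|\sum_(i < n) f j (X i t)|)%R.
Definition classRoot t : R :=
  fmax j0 (fun j => Num.sqrt (\sum_(i < n) f j (X i t) ^+ 2))%R.
Definition classMax t : R :=
  (\big[Num.max/0]_(i < n) fmax j0 (fun j => `|f j (X i t)|))%R.

Let mfX i j : measurable_fun setT (fun t => f j (X i t)).
Proof. by apply: measurableT_comp => //; exact: mf. Qed.

Lemma measurable_classAbs : measurable_fun setT classAbs.
Proof.
apply: (measurable_fmax j0) => j; apply: measurableT_comp => //.
exact: measurable_sum.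
Qed.

Lemma measurable_classRoot : measurable_fun setT classRoot.
Proof.
apply: (measurable_fmax j0) => j.
apply: (measurableT_comp (continuous_measurable_fun (@sqrt_continuous R))).
by apply: measurable_sum => i; exact: measurable_funX.
Qed.

Lemma measurable_classMax : measurable_fun setT classMax.
Proof.
apply: (@measurable_bigmax _ _ _ _ _ (fun=> 0%R)) => // i.
by apply: (measurable_fmax j0) => j; apply: measurableT_comp.
Qed.

Let qcode k (s : S) : {ffun J -> bool * 'I_(k.+1 * k.+1).+1} := [ffun j => quantize k (f j s)].
Let qfun k (i : 'I_n) j (a : {ffun J -> bool * 'I_(k.+1 * k.+1).+1}) : R := qval (a j).
Arguments qfun : clear implicits.

Let measurable_qcode k (i : 'I_n) a : measurable (qcode k @^-1` [set a]).
Proof.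
have -> : qcode k @^-1` [set a] =
    \bigcap_(j in [set: J]) (f j @^-1` (quantize k @^-1` [set a j])).
  apply/seteqP; split => [s /= <- j _ /=|s /= H]; first by rewrite ffunE.
  by apply/ffunP => j; rewrite ffunE; exact: H.
apply: fin_bigcap_measurable => [|j _]; first exact: finite_finset.
rewrite -[Y in measurable Y]setTI; apply: mf => //; exact: measurable_quantize.
Qed.

Let w k := law X (fun=> qcode k).
Arguments w : clear implicits.
Let C k := coded X (fun=> qcode k).
Let w_ge0 k i a : (0 <= w k i a)%R. Proof. exact: law_ge0. Qed.
Let w_sum1 k i : (\sum_a w k i a = 1)%R.
Proof. by apply: law_sum1; exact: measurable_qcode. Qed.

Let integral_C k h : \int[P]_t (h (C k t))%:E = (pmean (w k) h)%:E.
Proof. by apply: integral_coded => // i a; exact: measurable_qcode. Qed.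

Let integral_w k i h : \int[P]_t (h (qcode k (X i t)))%:E = (wsum (w k i) h)%:E.
Proof. by apply: (integral_law X (code := fun=> qcode k)) => i' a; exact: measurable_qcode. Qed.

Let measurable_C k h : measurable_fun setT (fun t => h (C k t) : R).
Proof.
apply: (measurable_finite_valued P) => b; apply: measurable_coded => i a.
exact: measurable_qcode.
Qed.

Let measurable_w k i h : measurable_fun setT (fun t => h (qcode k (X i t)) : R).
Proof.
have -> : (fun t => h (qcode k (X i t))) = (fun t => h (C k t i)).
  by apply/funext => t; rewrite /C /coded ffunE.
exact: (@measurable_C k (fun x => h (x i))).
Qed.

Let qfunE k i j t : qfun k i j (C k t i) = quant k (f j (X i t)).
Proof. by rewrite /qfun /C /coded !ffunE. Qed.

Let absSup_le k t : (absSup j0 (qfun k) (C k t) <= \sum_i \sum_j `|f j (X i t)|)%R.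
Proof.
apply: fmax_le => j; apply: (le_trans (ler_norm_sum _ _ _)); apply: ler_sum => i _.
rewrite qfunE (le_trans (normr_quant_le _ _))// (bigD1 j)//= lerDl.
by apply: sumr_ge0 => k' _; exact: normr_ge0.
Qed.

Let rootSup_le k t : (rootSup j0 (qfun k) (C k t) <= classRoot t)%R.
Proof.
apply: ler_fmax => j; rewrite ler_wsqrtr//; apply: ler_sum => i _; rewrite qfunE.
by rewrite -real_normK ?num_real// -[leRHS]real_normK ?num_real// lerXn2r ?nnegrE ?normr_quant_le.
Qed.

Let maxAbs_le k t : (maxAbs j0 (qfun k) (C k t) <= classMax t)%R.
Proof.
apply: le_bigmax2 => i _; apply: ler_fmax => j; rewrite qfunE.
exact: normr_quant_le.
Qed.

Let cvg_absSup t : absSup j0 (qfun k) (C k t) @[k --> \oo] --> classAbs t.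
Proof.
apply: cvg_fmax => j; apply: cvg_norm; apply: cvg_finite_sum => i.
by under eq_cvg do rewrite qfunE; exact: cvg_quant.
Qed.

Let classRoot_ge0 t : (0 <= classRoot t)%R.
Proof. by apply: fmax_ge0 => j; exact: sqrtr_ge0. Qed.

Let gap k : R := (\sum_i \sum_j `|wsum (w k i) (qfun k i j)|)%R.

Let gap_ge0 k : (0 <= gap k)%R.
Proof. by apply: sumr_ge0 => i _; apply: sumr_ge0. Qed.

Let qfun_nearly_centered k : nearly_centered (w k) (gap k) (qfun k).
Proof.
move=> i j; rewrite /gap (bigD1 i)//= (bigD1 j)//= -addrA lerDl addr_ge0//.
  by apply: sumr_ge0.
by apply: sumr_ge0 => i' _; apply: sumr_ge0.
Qed.

Let cvg_gap : gap k @[k --> \oo] --> (0 : R)%R.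
Proof.
have -> : (0 = \sum_(i < n) \sum_(j : J) 0 :> R)%R.
  by rewrite big1// => i _; rewrite big1.
apply: cvg_finite_sum => i; apply: cvg_finite_sum => j.
rewrite -(@normr0 _ R); apply: cvg_norm.
have -> : (0 = fine (\int[P]_t (f j (X i t))%:E) :> R)%R by rewrite f_centered.
apply: (@dominated_cvg_fine _ _ _ P (fun k t => qfun k i j (qcode k (X i t))) _
  (fun t => `|f j (X i t)|%R)) => //.
- move=> t; under eq_cvg do rewrite /qfun ffunE; exact: cvg_quant.
- have := f_int i j => /integrable_abse; rewrite /comp /=; exact.
- by move=> k t; rewrite /qfun ffunE; exact: normr_quant_le.
Qed.

Let cvg_mean : pmean (w k) (absSup j0 (qfun k)) @[k --> \oo] -->
  fine (\int[P]_t (classAbs t)%:E).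
Proof.
apply: (@dominated_cvg_fine _ _ _ P (fun k t => absSup j0 (qfun k) (C k t)) _
  (fun t => \sum_i \sum_j `|f j (X i t)|)%R) => //.
- exact: measurable_classAbs.
- rewrite [Y in _.-integrable _ Y](_ : _ = fun t => \sum_i \sum_j (`|f j (X i t)|)%:E); last first.
    by apply/funext => t /=; rewrite -sumEFin; apply: eq_bigr => i _; rewrite -sumEFin.
  apply: integrable_sum => // i _; apply: integrable_sum => // j _.
  have := f_int i j => /integrable_abse; rewrite /comp /=; exact.
- by move=> k t; rewrite ger0_norm ?absSup_ge0// absSup_le.
Qed.

Lemma integral_le_mono (u v : T -> R) : (forall t, 0 <= u t)%R ->
  measurable_fun setT u -> measurable_fun setT v -> (forall t, u t <= v t)%R ->
  \int[P]_t (u t)%:E <= \int[P]_t (v t)%:E.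
Proof.
move=> u0 mu mv uv; apply: ge0_le_integral => //.
- by move=> t _; rewrite lee_fin.
- exact/measurable_EFinP.
- exact/measurable_EFinP.
- by move=> t _; rewrite lee_fin.
Qed.

Let qvar_le k i j : (wsum (w k i) (fun a => qfun k i j a ^+ 2))%:E <=
  \int[P]_t (f j (X i t) ^+ 2)%:E.
Proof.
rewrite -integral_w; apply: integral_le_mono.
- by move=> t; exact: sqr_ge0.
- exact: (@measurable_w k i (fun a => (qfun k i j a ^+ 2)%R)).
- exact: measurable_funX.
move=> t; rewrite /qfun ffunE -[leLHS]real_normK ?num_real// -[leRHS]real_normK ?num_real//.
by rewrite lerXn2r ?nnegrE ?normr_quant_le.
Qed.

Let qvar_sum_le k j (s : R) : \sum_(i < n) \int[P]_t (f j (X i t) ^+ 2)%:E <= s%:E ->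
  (\sum_i wsum (w k i) (fun a => qfun k i j a ^+ 2) <= s)%R.
Proof.
move=> H; rewrite -lee_fin -sumEFin; apply: le_trans H.
by apply: lee_sum => i _; exact: qvar_le.
Qed.

Let qmax_le k (q m : R) : (0 <= q)%R ->
  \int[P]_t (classMax t `^ q)%:E <= (m `^ q)%:E ->
  (pmean (w k) (fun x => maxAbs j0 (qfun k) x `^ q) <= m `^ q)%R.
Proof.
move=> q0 H; rewrite -lee_fin -integral_C; apply: le_trans H.
apply: integral_le_mono.
- by move=> t; exact: powR_ge0.
- exact: (@measurable_C k (fun x => (maxAbs j0 (qfun k) x `^ q)%R)).
- by apply: (measurableT_comp (measurable_powR q)); exact: measurable_classMax.
move=> t; apply: ge0_ler_powR => //; rewrite ?nnegrE ?maxAbs_ge0//.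
exact: le_trans (maxAbs_ge0 _ _ _) (maxAbs_le _ _).
Qed.

(** The quantized class satisfies the hypotheses of
    [nearly_centered_upper_tail] with the same bounds and with a defect of
    centering that tends to 0 by dominated convergence; Fatou's lemma passes
    to the limit. *)
Lemma class_upper_tail (q Sig sig m s : R) : (2 <= q)%R ->
  (0 <= Sig)%R -> (0 <= sig)%R -> (0 <= m)%R -> (0 <= s)%R ->
  \int[P]_t (classRoot t ^+ 2)%:E <= (Sig ^+ 2)%:E ->
  (forall j, \sum_(i < n) \int[P]_t (f j (X i t) ^+ 2)%:E <= (sig ^+ 2)%:E) ->
  \int[P]_t (classMax t `^ q)%:E <= (m `^ q)%:E ->
  (forall i j, \int[P]_t (f j (X i t) ^+ 2)%:E <= (s ^+ 2)%:E) ->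
  forall c, c = Num.sqrt (2 * kappa R * q) ->
  \int[P]_t (Num.max (classAbs t - fine (\int[P]_t (classAbs t)%:E)) 0 `^ q)%:E <=
  ((c * (sig + Sig + c * (s + m))) `^ q)%:E.
Proof.
move=> q2 Sig0 sig0 m0 s0 HS Hsig HM Hs c cE.
have q0 : (0 < q)%R by lra.
have c0 : (0 <= c)%R by rewrite cE sqrtr_ge0.
pose K : R := (c * (#|'I_n|%:R + c) + 2 * #|'I_n|%:R)%R.
have K0 : (0 <= K)%R by rewrite addr_ge0 ?mulr_ge0 ?addr_ge0.
set r := (c * _)%R.
have r0 : (0 <= r)%R by rewrite /r mulr_ge0 ?addr_ge0 ?mulr_ge0 ?addr_ge0.
apply: (@fatou_powR _ _ _ P
  (fun k t => Num.max (absSup j0 (qfun k) (C k t) - pmean (w k) (absSup j0 (qfun k))) 0)%R _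
  (fun k => r + K * gap k)%R) => //.
- move=> k; exact: (@measurable_C k (fun x =>
    Num.max (absSup j0 (qfun k) x - pmean (w k) (absSup j0 (qfun k))) 0)%R).
- by move=> k t; exact: max0_ge0.
- by move=> k; rewrite addr_ge0// mulr_ge0.
- by move=> t; apply: cvg_max0; apply: cvgB; [exact: cvg_absSup|exact: cvg_mean].
- rewrite -[X in _ --> X]addr0 -[X in _ --> (_ + X)%R](mulr0 K).
  by apply: cvgD; [exact: cvg_cst|apply: cvgM => //; exact: cvg_cst].
move=> k; rewrite (@integral_C k (fun x =>
    Num.max (absSup j0 (qfun k) x - pmean (w k) (absSup j0 (qfun k))) 0 `^ q)%R) lee_fin.
apply: nearly_centered_upper_tail => //.
- move: HS; rewrite -lee_fin -integral_C; apply: le_trans; apply: integral_le_mono.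
  + by move=> t; exact: sqr_ge0.
  + exact: (@measurable_C k (fun x => (rootSup j0 (qfun k) x ^+ 2)%R)).
  + by apply: measurable_funX; exact: measurable_classRoot.
  + by move=> t; rewrite lerXn2r ?nnegrE ?rootSup_ge0.
- by move=> j; exact: qvar_sum_le.
- by apply: qmax_le => //; exact: ltW.
- by move=> i j; rewrite -lee_fin; apply: le_trans (qvar_le _ _ _) _.
Qed.

(** Same limit as in [class_upper_tail], starting from
    [nearly_centered_moment]. *)
Lemma class_moment (q sig m : R) : (2 <= q)%R -> (0 <= sig)%R -> (0 <= m)%R ->
  (forall j, \sum_(i < n) \int[P]_t (f j (X i t) ^+ 2)%:E <= (sig ^+ 2)%:E) ->
  \int[P]_t (classMax t `^ q)%:E <= (m `^ q)%:E ->
  forall c, c = Num.sqrt (2 * kappa R * q) ->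
  \int[P]_t (classAbs t `^ q)%:E <=
  ((2 * fine (\int[P]_t (classAbs t)%:E) + 2 * sig * c +
    20 * (kappa R * q) * m) `^ q)%:E.
Proof.
move=> q2 sig0 m0 Hsig HM c cE.
have q0 : (0 < q)%R by lra.
have K2 := @kappa_ge R.
have kq : (9 / 4 <= kappa R * q)%R by nra.
have c0 : (0 <= c)%R by rewrite cE sqrtr_ge0.
pose K : R := (3 * #|'I_n|%:R + 20 * (kappa R * q))%R.
have k0 : (0 <= 20 * (kappa R * q))%R by lra.
have K0 : (0 <= K)%R by rewrite addr_ge0// mulr_ge0.
pose e k := pmean (w k) (absSup j0 (qfun k)).
have e0 k : (0 <= e k)%R.
  by apply: wsum_ge0 => [x|x]; [apply: pwt_ge0|exact: absSup_ge0].
apply: (@fatou_powR _ _ _ P (fun k t => absSup j0 (qfun k) (C k t)) _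
  (fun k => 2 * e k + 2 * sig * c + 20 * (kappa R * q) * m + K * gap k)%R) => //.
- by move=> k t; exact: absSup_ge0.
- move=> k; have h1 := mulr_ge0 (ler0n R 2) (e0 k).
  have h2 := mulr_ge0 (mulr_ge0 (ler0n R 2) sig0) c0.
  have h3 := mulr_ge0 k0 m0; have h4 := mulr_ge0 K0 (gap_ge0 k).
  by rewrite !addr_ge0.
- set r := (X in _ --> X); rewrite -[r]addr0 -[X in _ --> (_ + X)%R](mulr0 K) /r.
  apply: cvgD; last by apply: cvgM => //; exact: cvg_cst.
  apply: cvgD; last exact: cvg_cst.
  apply: cvgD; last exact: cvg_cst.
  by apply: cvgM; [exact: cvg_cst|exact: cvg_mean].
move=> k; rewrite (@integral_C k (fun x => absSup j0 (qfun k) x `^ q)%R) lee_fin.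
apply: nearly_centered_moment => //.
- by move=> j; exact: qvar_sum_le.
- by apply: qmax_le => //; exact: ltW.
Qed.

End finite_class.

Lemma ler_poweR {R : realType} (r : R) (x y : \bar R) : 0 <= r ->
  (0 <= x -> x <= y -> x `^ r <= y `^ r)%E.
Proof.
move=> r0 x0 xy; apply: gt0_ler_poweR => //; rewrite in_itv/= leey andbT//.
exact: le_trans xy.
Qed.

(** * From finite subclasses to a countable class *)

Section sup_approx.
Local Open Scope ereal_scope.
Context d (T : measurableType d) (R : realType).
Variables (P : {measure set T -> \bar R}) (V : nat -> T -> R) (Z : T -> \bar R).

Definition sup_approx := forall t,
  [/\ forall m, (V m t)%:E <= Z t,
      forall m k, (m <= k)%N -> (V m t <= V k t)%R &
      forall L, (forall m, (V m t)%:E <= L) -> Z t <= L].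

Hypothesis VZ : sup_approx.
Hypothesis mV : forall m, measurable_fun setT (V m).

Lemma sup_approx_cvg t : (V m t)%:E @[m --> \oo] --> Z t.
Proof.
have [h1 h2 h3] := VZ t.
have -> : Z t = ereal_sup (range (fun m => (V m t)%:E)).
  apply/eqP; rewrite eq_le; apply/andP; split.
    by apply: h3 => m; apply: ereal_sup_ubound; exists m.
  by apply: ge_ereal_sup => _ [m _ <-].
by apply: ereal_nondecreasing_cvgn => m k mk; rewrite lee_fin h2.
Qed.

Lemma measurable_sup_approx : measurable_fun setT Z.
Proof.
apply: (emeasurable_fun_cvg (fun m t => (V m t)%:E)) => [m|t _].
  exact/measurable_EFinP.
exact: sup_approx_cvg.
Qed.

Lemma integral_sup_approx m : (forall t, 0 <= V m t)%R ->
  \int[P]_t (V m t)%:E <= \int[P]_t Z t.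
Proof.
move=> V0; apply: ge0_le_integral => //.
- by move=> t _; rewrite lee_fin.
- exact/measurable_EFinP.
- exact: measurable_sup_approx.
- by move=> t _; have [] := VZ t.
Qed.

(** Monotone convergence; the limit is identified pointwise, including where
    [Z] is infinite. *)
Lemma Lnorm_sup_approx (a q r : R) : (0 < q)%R -> (0 <= r)%R ->
  (forall m, \int[P]_t (Num.max (V m t - a) 0 `^ q)%:E <= (r `^ q)%:E) ->
  'N[P]_q%:E[(fun t => maxe (Z t - a%:E) 0)] <= r%:E.
Proof.
move=> q0 r0 H; have qV0 : (0 <= q^-1)%R by rewrite invr_ge0 ltW.
pose u m t := (Num.max (V m t - a) 0 `^ q)%:E.
have u0 m t : 0 <= u m t by rewrite lee_fin powR_ge0.
have nd t : {homo u^~ t : m k / (m <= k)%N >-> m <= k}.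
  move=> m k mk; rewrite lee_fin; apply: ge0_ler_powR; rewrite ?nnegrE ?max0_ge0 ?(ltW q0)//.
  rewrite ge_max max0_ge0 andbT le_max; apply/orP; left.
  by rewrite lerD2r; have [_ + _] := VZ t; exact.
have mu_ m : measurable_fun setT (u m).
  apply/measurable_EFinP; apply: (measurableT_comp (measurable_powR q)).
  apply: measurable_maxr; last exact: measurable_cst.
  by apply: measurable_funB => //; exact: measurable_cst.
(* The inverse power turns a bound on the limit into a bound on every V m t. *)
have limE t : `|maxe (Z t - a%:E) 0| `^ q = limn (u^~ t).
  have [h1 h2 h3] := VZ t.
  have cu : cvgn (u^~ t) by apply: ereal_nondecreasing_is_cvgn; exact: nd.
  have m0 : 0 <= maxe (Z t - a%:E) 0 by rewrite le_max lexx orbT.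
  rewrite gee0_abs//; apply/eqP; rewrite eq_le; apply/andP; split; last first.
    apply: lime_le => //; apply: nearW => m; rewrite /u -poweR_EFin.
    apply: ler_poweR; [exact: ltW|by rewrite lee_fin max0_ge0|].
    by rewrite EFin_max EFinB; apply: le_max2; rewrite // leeD2r.
  have uL m : u m t <= limn (u^~ t).
    rewrite (cvg_lim _ (ereal_nondecreasing_cvgn (nd t)))//.
    by apply: ereal_sup_ubound; exists m.
  have := uL 0%N; move: uL; case: (limn (u^~ t)) => [L| |] uL uL0.
  - have L0 : (0 <= L)%R by rewrite -lee_fin; exact: le_trans (u0 0%N t) uL0.
    have ZL : Z t <= (a + L `^ q^-1)%:E.
      apply: h3 => m; rewrite lee_fin -lerBlDl.
      apply: (@le_trans _ _ (Num.max (V m t - a) 0)%R); first by rewrite le_max lexx.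
      have := uL m; rewrite /u lee_fin => HL.
      rewrite -(@ler_powR2 _ q) ?max0_ge0 ?powR_ge0//.
      by rewrite -powRrM mulVf ?gt_eqF// powRr1.
    have mL : maxe (Z t - a%:E) 0 <= (L `^ q^-1)%:E.
      rewrite ge_max lee_fin powR_ge0 andbT leeBlDr//.
      by rewrite -EFinD addrC.
    have -> : L%:E = ((L `^ q^-1)%:E) `^ q.
      by rewrite poweR_EFin -powRrM mulVf ?gt_eqF// powRr1.
    by apply: ler_poweR => //; exact: ltW.
  - by rewrite leey.
  - by move: uL0; rewrite leeNy_eq.
have intE : \int[P]_t `|maxe (Z t - a%:E) 0| `^ q <= (r `^ q)%:E.
  under eq_integral do rewrite limE.
  have cm := @cvg_monotone_convergence _ _ _ P setT measurableT u mu_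
    (fun m t _ => u0 m t) (fun t _ => @nd t).
  rewrite -(cvg_lim _ cm)//; apply: lime_le; first by apply/cvg_ex; eexists; exact: cm.
  exact: nearW.
rewrite unlock /=.
have -> : r%:E = ((r `^ q)%:E) `^ q^-1.
  by rewrite poweR_EFin -powRrM mulfV ?gt_eqF// powRr1.
apply: ler_poweR => //; apply: integral_ge0 => t _; exact: poweR_ge0.
Qed.

End sup_approx.

Section enumeration.
Local Open Scope ereal_scope.

(** The zero function fills the sequence when [F] is finite or empty; it
    changes no supremum of nonnegative quantities. *)
Lemma countable_enum {S : Type} {R : realType} (F : set (S -> R)) : countable F ->
  exists e : nat -> S -> R, (forall k, F (e k) \/ e k = (fun=> 0%R)) /\
    (forall g, F g -> exists k, e k = g).
Proof.
move=> /countable_injP[h h_inj].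
pose e k : S -> R := xget (fun=> 0%R) [set g | F g /\ h g = k].
exists e; split => [k|g Fg].
  by rewrite /e; case: xgetP => [g -> [Fg _]|_]; [left|right].
exists (h g); rewrite /e; case: xgetP => [g' _ [Fg' hg]|/(_ g)]; last first.
  by case; split.
by apply: h_inj => //; rewrite inE.
Qed.

Lemma nneg_sup_approx {T S : Type} {R : realType} (F : set (S -> R))
    (e : nat -> S -> R) (v : (S -> R) -> T -> R) :
  (forall k, F (e k) \/ e k = (fun=> 0%R)) -> (forall g, F g -> exists k, e k = g) ->
  (forall g t, 0 <= v g t)%R -> (forall t, v (fun=> 0) t = 0)%R ->
  forall t,
  [/\ forall m, (fmax ord0 (fun j : 'I_m.+1 => v (e j) t))%:E <=
        nneg_sup F (fun g => (v g t)%:E),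
      forall m k, (m <= k)%N -> (fmax ord0 (fun j : 'I_m.+1 => v (e j) t) <=
        fmax ord0 (fun j : 'I_k.+1 => v (e j) t))%R &
      forall L, (forall m, (fmax ord0 (fun j : 'I_m.+1 => v (e j) t))%:E <= L) ->
        nneg_sup F (fun g => (v g t)%:E) <= L].
Proof.
move=> eF Fe v0 v00 t; split=> [m|m k mk|L HL].
- have [j ->] := fmaxP ord0 (fun j : 'I_m.+1 => v (e j) t).
  apply: ereal_sup_ubound; have [Fj|->] := eF j; last by left; rewrite v00.
  by right; exists (e j).
- apply: fmax_le => j; have jk : (j < k.+1)%N by apply: leq_trans (ltn_ord j) _.
  exact: (le_fmax ord0 (fun j : 'I_k.+1 => v (e j) t) (Ordinal jk)).
- apply: ge_ereal_sup => x [->|[g Fg <-]].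
    by apply: le_trans (HL 0%N); rewrite lee_fin fmax_ge0.
  have [k <-] := Fe _ Fg; apply: le_trans (HL k); rewrite lee_fin.
  exact: (le_fmax ord0 (fun j : 'I_k.+1 => v (e j) t) ord_max).
Qed.

End enumeration.

Section empirical_sup.
Local Open Scope ereal_scope.
Context d dS (T : measurableType d) (S : measurableType dS) (R : realType).
Variables (P : probability T R) (n : nat) (X : 'I_n -> {RV P >-> S}).
Variables (F : set (S -> R)) (e : nat -> S -> R).
Hypothesis eF : forall k, F (e k) \/ e k = (fun=> 0%R).
Hypothesis Fe : forall g, F g -> exists k, e k = g.
Hypothesis F_measurable : forall f, F f -> measurable_fun [set: S] f.
Hypothesis X_indep : mutually_independent X.
Hypothesis X_integrable : forall f i, F f ->
      P.-integrable [set: T] (EFin \o (f \o X i)).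
Hypothesis X_centered : forall f i, F f -> 'E_P[f \o X i] = 0.

Let me k : measurable_fun setT (e k).
Proof. by case: (eF k) => [/F_measurable //|->]. Qed.

Let meX i k : measurable_fun setT (fun t => e k (X i t)).
Proof. by apply: measurableT_comp => //; exact: me. Qed.

Let e_int i k : P.-integrable setT (fun t => (e k (X i t))%:E).
Proof.
by case: (eF k) => [/(X_integrable i)//|->]; exact: integrable0.
Qed.

Let e_centered i k : \int[P]_t (e k (X i t))%:E = 0.
Proof.
case: (eF k) => [/(X_centered i)|->]; last by rewrite integral0.
by rewrite unlock.
Qed.

Let Vabs m := classAbs X ord0 (fun j : 'I_m.+1 => e j).
Let Vmax m := classMax X ord0 (fun j : 'I_m.+1 => e j).
Let Vroot m := classRoot X ord0 (fun j : 'I_m.+1 => e j).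

Lemma supZ_approx : sup_approx Vabs (supZ X F).
Proof.
apply: (nneg_sup_approx (v := fun g t => `|\sum_(i < n) g (X i t)|%R)) => //.
by move=> t; rewrite big1 ?normr0.
Qed.

Let Q t := nneg_sup F (fun f => (\sum_(i < n) f (X i t) ^+ 2)%R%:E).
Let VQ m t : R := fmax ord0 (fun j : 'I_m.+1 => \sum_(i < n) e j (X i t) ^+ 2)%R.

Let Q_approx : sup_approx VQ Q.
Proof.
apply: (nneg_sup_approx (v := fun g t => \sum_(i < n) g (X i t) ^+ 2)%R) => //.
- by move=> g t; apply: sumr_ge0 => i _; exact: sqr_ge0.
- by move=> t; rewrite big1// => i _; rewrite expr0n.
Qed.

Let mVQ m : measurable_fun setT (VQ m).
Proof.
apply: (measurable_fmax ord0 (h := fun (j : 'I_m.+1) t => \sum_(i < n) e j (X i t) ^+ 2)%R) => j.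
by apply: measurable_sum => i; exact: measurable_funX.
Qed.

Let vmax (g : S -> R) t : R := (\big[Num.max/0]_(i < n) `|g (X i t)|)%R.

Let supME t : supM X F t = nneg_sup F (fun g => (vmax g t)%:E).
Proof.
apply/eqP; rewrite eq_le; apply/andP; split; apply: ge_ereal_sup => x.
  case=> [->|[[i f] [_ Ff] <-]]; first by apply: ereal_sup_ubound; left.
  apply: (@le_trans _ _ (vmax f t)%:E).
    by rewrite lee_fin; apply: (le_bigmax _ (fun i => `|f (X i t)|)%R).
  by apply: ereal_sup_ubound; right; exists f.
case=> [->|[f Ff <-]]; first by apply: ereal_sup_ubound; left.
rewrite /vmax; elim/big_rec: _ => [|i y _ IH].
  by apply: ereal_sup_ubound; left.
rewrite EFin_max ge_max IH andbT; apply: ereal_sup_ubound; right.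
by exists (i, f).
Qed.

Let M_approx : sup_approx (fun m t => fmax ord0 (fun j : 'I_m.+1 => vmax (e j) t)) (supM X F).
Proof.
move=> t; rewrite supME; apply: (nneg_sup_approx (v := vmax)) => //.
  by move=> g u; rewrite /vmax; elim/big_rec: _ => //= i y _ y0; rewrite le_max y0 orbT.
by move=> u; rewrite /vmax; elim/big_rec: _ => //= i y _ ->; rewrite normr0 maxxx.
Qed.

Let mM : measurable_fun setT (supM X F).
Proof.
apply: (measurable_sup_approx M_approx) => m.
apply: (measurable_fmax ord0 (h := fun (j : 'I_m.+1) t => vmax (e j) t)) => j.
by apply: (@measurable_bigmax _ _ _ _ _ (fun=> 0%R)) => // i; exact: measurableT_comp.
Qed.

Let Vmax_le m t : (Vmax m t)%:E <= supM X F t.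
Proof.
apply: (@le_trans _ _ (fmax ord0 (fun j : 'I_m.+1 => vmax (e j) t))%:E); last first.
  by have [+ _ _] := M_approx t; exact.
rewrite lee_fin; apply: bigmax_le.
  apply: fmax_ge0 => j; rewrite /vmax; elim/big_rec: _ => //= i y _ y0.
  by rewrite le_max y0 orbT.
move=> i _; apply: fmax_le => j.
apply: le_trans (le_fmax ord0 (fun j : 'I_m.+1 => vmax (e j) t) j).
exact: (le_bigmax _ (fun i => `|e j (X i t)|)%R).
Qed.

Let mVabs m : measurable_fun setT (Vabs m).
Proof. by apply: measurable_classAbs => j; exact: me. Qed.
Let mVmax m : measurable_fun setT (Vmax m).
Proof. by apply: measurable_classMax => j; exact: me. Qed.
Let mVroot m : measurable_fun setT (Vroot m).
Proof. by apply: measurable_classRoot => j; exact: me. Qed.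

Let Vabs_ge0 m t : (0 <= Vabs m t)%R.
Proof. by apply: fmax_ge0 => j; exact: normr_ge0. Qed.
Let Vmax_ge0 m t : (0 <= Vmax m t)%R.
Proof. by rewrite /Vmax /classMax; elim/big_rec: _ => //= i y _ y0; rewrite le_max y0 orbT. Qed.

Let sqr_sqrte_fin (x : \bar R) (r : R) : 0 <= x -> sqrte x = r%:E -> x = (r ^+ 2)%:E.
Proof. by move=> x0 xr; rewrite -(sqr_sqrte x0) xr EFin_expe. Qed.

Let nneg_sup_ge0 (I : Type) (A : set I) (g : I -> \bar R) : 0 <= nneg_sup A g.
Proof. by apply: ereal_sup_ubound; left. Qed.

Lemma root_bound m (Sig : R) : strong_sd X F = Sig%:E ->
  \int[P]_t (Vroot m t ^+ 2)%:E <= (Sig ^+ 2)%:E.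
Proof.
move=> H; rewrite -(sqr_sqrte_fin _ H); last by apply: integral_ge0.
apply: ge0_le_integral => //.
- by move=> t _; rewrite lee_fin sqr_ge0.
- by apply/measurable_EFinP; exact: measurable_funX.
- exact: (measurable_sup_approx Q_approx mVQ).
move=> t _; have [+ _ _] := Q_approx t => /(_ m); apply: le_trans; rewrite lee_fin.
have [j jE] := fmaxP ord0 (fun j : 'I_m.+1 => Num.sqrt (\sum_(i < n) e j (X i t) ^+ 2)%R).
rewrite /Vroot /classRoot jE sqr_sqrtr; last by apply: sumr_ge0 => i _; exact: sqr_ge0.
exact: (le_fmax ord0 (fun j : 'I_m.+1 => \sum_(i < n) e j (X i t) ^+ 2)%R).
Qed.

Lemma weak_bound k (sig : R) : weak_sd X F = sig%:E ->
  \sum_(i < n) \int[P]_t (e k (X i t) ^+ 2)%:E <= (sig ^+ 2)%:E.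
Proof.
move=> H; rewrite -(sqr_sqrte_fin _ H); last exact: nneg_sup_ge0.
case: (eF k) => [Fk|->]; last first.
  rewrite big1 ?nneg_sup_ge0// => i _.
  by under eq_integral do rewrite expr0n; rewrite integral0.
rewrite -ge0_integral_sum//; last 2 first.
- by move=> i; apply/measurable_EFinP; exact: measurable_funX.
- by move=> i t _; rewrite lee_fin sqr_ge0.
apply: ereal_sup_ubound; right; exists (e k) => //.
by rewrite unlock; apply: eq_integral => t _; rewrite sumEFin.
Qed.

Lemma max_bound m (q M : R) : (0 < q)%R -> 'N[P]_q%:E[supM X F] = M%:E ->
  \int[P]_t (Vmax m t `^ q)%:E <= (M `^ q)%:E.
Proof.
move=> q0 H; rewrite -poweR_EFin -H poweR_Lnorm ?gt_eqF//.
apply: ge0_le_integral => //.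
- by move=> t _; rewrite lee_fin powR_ge0.
- by apply/measurable_EFinP; exact: (measurableT_comp (measurable_powR q)).
- apply: (measurableT_comp (measurable_poweR q)); exact: measurableT_comp.
move=> t _; rewrite -poweR_EFin; apply: ler_poweR; first exact: ltW.
  by rewrite lee_fin.
by apply: le_trans (lee_abs _); exact: Vmax_le.
Qed.

Lemma norm2_bound i k (s : R) : sup_norm2 X F = s%:E ->
  \int[P]_t (e k (X i t) ^+ 2)%:E <= (s ^+ 2)%:E.
Proof.
move=> H; have s0 : (0 <= s)%R by rewrite -lee_fin -H nneg_sup_ge0.
case: (eF k) => [Fk|->]; last first.
  under eq_integral do rewrite expr0n.
  by rewrite integral0 lee_fin sqr_ge0.
have : 'N[P]_2%:E[EFin \o (e k \o X i)] <= s%:E.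
  by rewrite -H; apply: ereal_sup_ubound; right; exists (i, e k).
move=> /(ler_poweR (ler0n R 2) (Lnorm_ge0 _ _ _)).
rewrite poweR_Lnorm// poweR_EFin powR_mulrn//; apply: le_trans.
rewrite le_eqVlt; apply/orP; left; apply/eqP; apply: eq_integral => t _.
by rewrite /comp abse_EFin poweR_EFin powR_mulrn// real_normK// num_real.
Qed.

Let Vabs_mean m (ez : R) : \int[P]_t supZ X F t = ez%:E ->
  (0 <= fine (\int[P]_t (Vabs m t)%:E) <= ez)%R.
Proof.
move=> EZ; have H : \int[P]_t (Vabs m t)%:E <= ez%:E.
  by rewrite -EZ; exact: (integral_sup_approx P supZ_approx mVabs).
have H0 : 0 <= \int[P]_t (Vabs m t)%:E.
  by apply: integral_ge0 => t _; rewrite lee_fin.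
have fin : \int[P]_t (Vabs m t)%:E \is a fin_num.
  by rewrite ge0_fin_numE//; apply: le_lt_trans H (ltry _).
by rewrite -lee_fin fineK// -lee_fin fineK// H0 H.
Qed.

(** [class_upper_tail] for the finite subclasses. Their means are at most
    [ez], so centering at [ez] instead only decreases the positive part. *)
Lemma supZ_upper_tail (q Sig sig M s ez : R) : (2 <= q)%R ->
  strong_sd X F = Sig%:E -> weak_sd X F = sig%:E ->
  'N[P]_q%:E[supM X F] = M%:E -> sup_norm2 X F = s%:E ->
  \int[P]_t supZ X F t = ez%:E ->
  forall c, c = Num.sqrt (2 * kappa R * q) ->
  'N[P]_q%:E[(fun t => maxe (supZ X F t - ez%:E) 0)] <=
  (c * (sig + Sig + c * (s + M)))%:E.
Proof.
move=> q2 HS Hsig HM Hs EZ c cE; have q0 : (0 < q)%R by lra.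
have Sig0 : (0 <= Sig)%R by rewrite -lee_fin -HS sqrte_ge0.
have sig0 : (0 <= sig)%R by rewrite -lee_fin -Hsig sqrte_ge0.
have M0 : (0 <= M)%R by rewrite -lee_fin -HM Lnorm_ge0.
have s0 : (0 <= s)%R by rewrite -lee_fin -Hs nneg_sup_ge0.
have c0 : (0 <= c)%R by rewrite cE sqrtr_ge0.
apply: (Lnorm_sup_approx supZ_approx mVabs q0).
  by rewrite mulr_ge0// !addr_ge0// mulr_ge0// addr_ge0.
move=> m; have HT := @class_upper_tail _ _ _ _ _ P n X X_indep _ (ord0 : 'I_m.+1)
  (fun j => e j) (fun j => me j) (fun i j => e_int i j) (fun i j => e_centered i j)
  q Sig sig M s q2 Sig0 sig0 M0 s0 (root_bound m HS) (fun j => weak_bound j Hsig)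
  (max_bound m q0 HM) (fun i j => norm2_bound i j Hs) c cE.
apply: le_trans HT.
have /andP[_ Hm] := Vabs_mean m EZ.
apply: integral_le_mono.
- by move=> t; exact: powR_ge0.
- apply: (measurableT_comp (measurable_powR q)).
  apply: measurable_maxr; last exact: measurable_cst.
  by apply: measurable_funB => //; exact: mVabs.
- apply: (measurableT_comp (measurable_powR q)).
  apply: measurable_maxr; last exact: measurable_cst.
  by apply: measurable_funB => //; exact: mVabs.
move=> t; apply: ge0_ler_powR; rewrite ?nnegrE ?max0_ge0 ?(ltW q0)//.
by apply: le_max2 => //; rewrite lerD2l lerN2.
Qed.

Lemma supZ_moment (q sig M ez : R) : (2 <= q)%R ->
  weak_sd X F = sig%:E -> 'N[P]_q%:E[supM X F] = M%:E ->
  \int[P]_t supZ X F t = ez%:E ->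
  forall c, c = Num.sqrt (2 * kappa R * q) ->
  'N[P]_q%:E[supZ X F] <=
  (2 * ez + 2 * sig * c + 20 * (kappa R * q) * M)%:E.
Proof.
move=> q2 Hsig HM EZ c cE; have q0 : (0 < q)%R by lra.
have K2 := @kappa_ge R.
have kq : (0 <= 20 * (kappa R * q))%R by nra.
have sig0 : (0 <= sig)%R by rewrite -lee_fin -Hsig sqrte_ge0.
have M0 : (0 <= M)%R by rewrite -lee_fin -HM Lnorm_ge0.
have c0 : (0 <= c)%R by rewrite cE sqrtr_ge0.
have ez0 : (0 <= ez)%R by have /andP[] := Vabs_mean 0 EZ; exact: le_trans.
(* The case of centering at 0. *)
have ZE : supZ X F = (fun t => maxe (supZ X F t - 0%:E) 0).
  by apply/funext => t; rewrite sube0 max_l//; exact: nneg_sup_ge0.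
rewrite ZE; have r0 : (0 <= 2 * ez + 2 * sig * c + 20 * (kappa R * q) * M)%R.
  by rewrite !addr_ge0// ?(mulr_ge0 kq M0)// !mulr_ge0.
apply: (Lnorm_sup_approx supZ_approx mVabs q0 r0) => m.
have /andP[m0 Hm] := Vabs_mean m EZ.
under eq_integral do rewrite subr0 max_l//.
have HT := @class_moment _ _ _ _ _ P n X X_indep _ (ord0 : 'I_m.+1)
  (fun j => e j) (fun j => me j) (fun i j => e_int i j) (fun i j => e_centered i j)
  q sig M q2 sig0 M0 (fun j => weak_bound j Hsig) (max_bound m q0 HM) c cE.
apply: (le_trans HT).
rewrite lee_fin; apply: ge0_ler_powR; rewrite ?nnegrE ?(ltW q0)//.
  by rewrite !addr_ge0// ?(mulr_ge0 kq M0)// ?mulr_ge0.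
by rewrite !lerD2r ler_pM2l.
Qed.

End empirical_sup.

(** * The theorem *)

Local Open Scope ereal_scope.

Theorem theorem12 (R : realType) (d dS : measure_display)
    (T : measurableType d) (S : measurableType dS) (P : probability T R)
    (n : nat) (X : 'I_n -> {RV P >-> S}) (F : set (S -> R))
    (F_countable : countable F)
    (F_measurable : forall f, F f -> measurable_fun [set: S] f)
    (X_indep : mutually_independent X)
    (X_integrable : forall f i, F f ->
      P.-integrable [set: T] (EFin \o (f \o X i)))
    (X_centered : forall f i, F f -> 'E_P[f \o X i] = 0)
    (q : R) (q_ge2 : (2 <= q)%R) :
  let Z := supZ X F in
  let EZ := \int[P]_t Z t in
  let M := supM X F in
  let Sigma := strong_sd X F in
  let sigma := weak_sd X F in
  let k := kappa R in
  'N[P]_q%:E[(fun t => maxe (Z t - EZ) 0)] <=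
      (Num.sqrt (2 * k * q))%:E * (Sigma + sigma) +
      (2 * k * q)%:E * ('N[P]_q%:E[M] + sup_norm2 X F)
  /\
  'N[P]_q%:E[Z] <=
      2%:E * EZ + 2%:E * sigma * (Num.sqrt (2 * k * q))%:E +
      (20 * k * q)%:E * 'N[P]_q%:E[M] +
      (4 * Num.sqrt (k * q))%:E * 'N[P]_2%:E[M].
Proof.
move=> Z EZ M Sigma sigma k.
have [e [eF Fe]] := countable_enum F_countable.
have K2 : (9 / 4 <= 2 * k)%R := kappa_ge.
have q0 : (0 < q)%R by lra.
have kq0 : (0 < 2 * k * q)%R by nra.
have kq20 : (0 < 20 * k * q)%R by nra.
have c0 : (0 < Num.sqrt (2 * k * q))%R by rewrite sqrtr_gt0.
have cc : (2 * k * q = Num.sqrt (2 * k * q) * Num.sqrt (2 * k * q))%R.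
  by rewrite -expr2 sqr_sqrtr// ltW.
have NM0 : 0 <= 'N[P]_q%:E[M] := Lnorm_ge0 _ _ _.
have S0 : 0 <= Sigma := sqrte_ge0 _.
have s0 : 0 <= sigma := sqrte_ge0 _.
have N0 : 0 <= sup_norm2 X F by apply: ereal_sup_ubound; left.
have Z0 t : 0 <= Z t by apply: ereal_sup_ubound; left.
have EZ0 : 0 <= EZ by exact: integral_ge0.
have t4 : 0 <= (4 * Num.sqrt (k * q))%:E * 'N[P]_2%:E[M].
  by rewrite mule_ge0 ?Lnorm_ge0// lee_fin mulr_ge0// sqrtr_ge0.
have nNy (x : \bar R) : 0 <= x -> x != -oo by case: x.
have B0 : 0 <= (2 * k * q)%:E * ('N[P]_q%:E[M] + sup_norm2 X F).
  by rewrite mule_ge0 ?adde_ge0// lee_fin ltW.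
have cpos : 0 < (Num.sqrt (2 * k * q))%:E by rewrite lte_fin.
have kpos : 0 < (2 * k * q)%:E by rewrite lte_fin.
split.
- case EZE : EZ EZ0 => [ez| |] // EZ0; last first.
    rewrite (@eq_Lnorm _ _ _ _ _ _ (cst 0)) => [|t].
      rewrite Lnorm0; last by rewrite eqe gt_eqF.
      by rewrite adde_ge0// mule_ge0 ?adde_ge0// ltW.
    by rewrite /= addeNy max_r// leNye.
  case SE : Sigma S0 => [Sig| |] // S0; last first.
    by rewrite (addye (nNy _ s0)) gt0_muley// (addye (nNy _ B0)) leey.
  case sE : sigma s0 => [sig| |] // s0; last first.
    by rewrite (addey (nNy _ S0)) gt0_muley// (addye (nNy _ B0)) leey.
  have A0 : 0 <= (Num.sqrt (2 * k * q))%:E * (Sig%:E + sig%:E).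
    by rewrite mule_ge0 ?adde_ge0// ltW.
  case NE : 'N[P]_q%:E[M] NM0 => [m| |] // NM0; last first.
    by rewrite (addye (nNy _ N0)) gt0_muley// (addey (nNy _ A0)) leey.
  case N2E : (sup_norm2 X F) N0 => [b| |] // N0; last first.
    by rewrite (addey (nNy _ NM0)) gt0_muley// (addey (nNy _ A0)) leey.
  have := supZ_upper_tail eF Fe F_measurable X_indep X_integrable X_centered
    q_ge2 SE sE NE N2E EZE erefl.
  move=> /le_trans; apply; rewrite -!EFinD lee_fin.
  rewrite -/k; set c := Num.sqrt (2 * k * q) in cc *; rewrite cc.
  by rewrite le_eqVlt; apply/orP; left; apply/eqP; ring.
case EZE : EZ EZ0 => [ez| |] // EZ0; last first.
  rewrite gt0_muley ?lte_fin//.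
  have h1 : 0 <= 2%:E * sigma * (Num.sqrt (2 * k * q))%:E by rewrite !mule_ge0// ltW.
  have h2 : 0 <= (20 * k * q)%:E * 'N[P]_q%:E[M] by rewrite mule_ge0// lee_fin ltW.
  by rewrite (addye (nNy _ h1)) (addye (nNy _ h2)) (addye (nNy _ t4)) leey.
have E2 : 0 <= 2%:E * ez%:E by rewrite mule_ge0.
case sE : sigma s0 => [sig| |] // s0; last first.
  rewrite gt0_muley ?lte_fin// gt0_mulye// (addey (nNy _ E2)).
  have h2 : 0 <= (20 * k * q)%:E * 'N[P]_q%:E[M] by rewrite mule_ge0// lee_fin ltW.
  by rewrite (addye (nNy _ h2)) (addye (nNy _ t4)) leey.
have h1 : 0 <= 2%:E * ez%:E + 2%:E * sig%:E * (Num.sqrt (2 * k * q))%:E.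
  by rewrite adde_ge0// !mule_ge0// ltW.
case NE : 'N[P]_q%:E[M] NM0 => [m| |] // NM0; last first.
  by rewrite gt0_muley ?lte_fin// (addey (nNy _ h1)) (addye (nNy _ t4)) leey.
have := supZ_moment eF Fe F_measurable X_indep X_integrable X_centered
  q_ge2 sE NE EZE erefl.
move=> /le_trans; apply; apply: le_trans (leeDl _ t4).
rewrite -!EFinM -!EFinD lee_fin. rewrite -/k.
by rewrite le_eqVlt; apply/orP; left; apply/eqP; ring.
Qed.
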